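(* Suppose Assumption 1 holds, $\Psi$ is directionally pathwise differentiable at $P$ relative to $\mathcal T$ with derivative $\gamma$, and $T_n$ is $V$-efficient for a linearity subspace $V$ of $\gamma$. Put $s^2=V_V>0$, let $\hat s_n\ge0$ satisfy $\hat s_n\to s$ in $P^n$-probability, and define, for $0<\alpha<1$, $$\delta(h)=\langle\tilde\psi_V,h\rangle-\gamma(h),\qquad I_n=\Big[T_n-z_{1-\alpha/2}\frac{\hat s_n}{\sqrt n},\ T_n+z_{1-\alpha/2}\frac{\hat s_n}{\sqrt n}\Big].$$ For every fixed $h\in\mathcal T$ and every DQM path with score $h$, $$P^n_{n,h}\{\Psi(P_{n,h})\in I_n\}\longrightarrow\Phi\Big(z_{1-\alpha/2}-\frac{\delta(h)}s\Big)-\Phi\Big(-z_{1-\alpha/2}-\frac{\delta(h)}s\Big).$$ This limit is $1-\alpha$ if $\delta(h)=0$, in particular on $V$, and is smaller otherwise. If $\delta(h)\le0$, the lower confidence bound $$\underline\Psi_n=T_n-z_{1-\alpha}\frac{\hat s_n}{\sqrt n}$$ satisfies $P^n_{n,h}\{\Psi(P_{n,h})\ge\underline\Psi_n\}\to\Phi(z_{1-\alpha}-\delta(h)/s)\ge1-\alpha$.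
   Context: $\Phi$ is the standard normal distribution function and $z_p=\Phi^{-1}(p)$. Model. $\mathcal P$ is a set of probability measures, $P\in\mathcal P$ fixed, $X_1,\dots,X_n$ i.i.d. observations; $L_2^0(P)$ is the mean-zero subspace of $L_2(P)$ with inner product $\langle\cdot,\cdot\rangle$. A DQM path with score $h$ is a map $t\mapsto P_{t,h}\in\mathcal P$, $t\in[0,\varepsilon)$, $P_{0,h}=P$, with $\int[(dP_{t,h}^{1/2}-dP^{1/2})/t-\tfrac12h\,dP^{1/2}]^2\to0$ as $t\downarrow0$; $P_{n,h}:=P_{n^{-1/2},h}$, $P^n_{n,h}$ its $n$-fold product. $\mathcal T\subseteq L_2^0(P)$ is a linear subspace. Assumption 1: $\mathcal T$ is closed in $L_2(P)$ and every $h\in\mathcal T$ is the score of some DQM path in $\mathcal P$. Directional pathwise differentiability: $\gamma:\mathcal T\to\mathbb R$ is positively homogeneous and $t^{-1}\{\Psi(P_{t,h})-\Psi(P)\}\to\gamma(h)$ for every $h\in\mathcal T$ and every DQM path with score $h$; $\gamma$ is then continuous. A linearity subspace is a linear subspace $V\subseteq\mathcal T$ with $\gamma|_V$ linear; $\tilde\psi_V\in\overline V$ is the Riesz representer of the continuous extension of $\gamma|_V$ and $V_V:=\|\tilde\psi_V\|^2$. $T_n$ is $V$-efficient if for every $h\in V$ and every DQM path with score $h$, $\sqrt n\{T_n-\Psi(P_{n,h})\}\rightsquigarrow N(0,V_V)$ under $P^n_{n,h}$. *)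

(* Defs.v *)
From HB Require Import structures.
From mathcomp Require Import all_boot all_order all_algebra.
From mathcomp Require Import all_classical all_reals all_analysis.

Set Implicit Arguments.
Unset Strict Implicit.
Unset Printing Implicit Defensive.

Import Order.TTheory GRing.Theory Num.Theory.
Import numFieldNormedType.Exports.

Local Open Scope classical_set_scope.
Local Open Scope ring_scope.

Section normal.
Context {R : realType}.

Definition Phi (x : R) : R := fine (normal_prob (0 : R) 1 `]-oo, x]).

(* [Phi] is a bijection from R onto ]0, 1[; the default value [0] is only
   taken for [p] outside ]0, 1[ *)
Definition zq (p : R) : R := xget 0 [set x | Phi x = p].

(* N(0, v); [normal_prob m s] is parameterized by the standard deviation and
   is not a point mass for [s = 0], whence the case distinction *)
Definition gauss0 (v : R) : probability (measurableTypeR R) R :=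
  if v == 0 then (\d_(0 : measurableTypeR R) : probability _ R)
  else (normal_prob (0 : R) (Num.sqrt v) : probability _ R).

End normal.

Section product.
Context {d} {X : measurableType d} {R : realType}.

Definition cons_pair n (x : X * n.-tuple X) : n.+1.-tuple X :=
  [tuple of x.1 :: x.2].

Lemma measurable_cons_pair n : measurable_fun setT (@cons_pair n).
Proof. exact: measurable_cons. Qed.

HB.instance Definition _ n :=
  isMeasurableFun.Build _ _ _ _ (@cons_pair n) (@measurable_cons_pair n).

Fixpoint prodn (P : probability X R) n : probability (n.-tuple X) R :=
  match n with
  | 0 => \d_([tuple] : 0.-tuple X)
  | m.+1 => distribution (P \x prodn P m)%E (@cons_pair m)
  end.

Lemma prodn_rect (P : probability X R) n (A : 'I_n -> set X) :
  (forall i, measurable (A i)) ->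
  prodn P n [set x | forall i, A i (tnth x i)] = (\prod_(i < n) P (A i))%E.
Proof.
elim: n A => [|n IHn] A mA /=.
  rewrite big_ord0 (_ : [set _ | _] = setT) ?diracT//.
  by apply/seteqP; split=> // x _ [].
rewrite /distribution /pushforward /= big_ord_recl.
rewrite -(IHn (fun i => A (lift ord0 i)))//.
have mB : measurable [set x : n.-tuple X | forall i, A (lift ord0 i) (tnth x i)].
  rewrite (_ : [set _ | _] =
    \bigcap_(i in [set: 'I_n]) ((@tnth n X)^~ i @^-1` A (lift ord0 i))); last first.
    by apply/seteqP; split=> [x h i _|x h i]; [exact: h|exact: (h i I)].
  apply: fin_bigcap_measurable => [|i _]; first exact: finite_finset.
  rewrite -[X in measurable X]setTI; exact: measurable_tnth.
rewrite -product_measure1E//; congr (_ _).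
apply/seteqP; split=> [[x y]/= h|[x y]/= [h0 h] i].
  split; first exact: (h ord0).
  by move=> i; have := h (lift ord0 i); rewrite tnthS.
case: (unliftP ord0 i) => [j ->|->]; last exact: h0.
by rewrite tnthS; exact: h.
Qed.

(* Y_n ~> nu, where Y_n is defined on the n-fold sample space with law P_n *)
Definition cvg_in_law (Pn : forall n, probability (n.-tuple X) R)
    (Y : forall n, n.-tuple X -> R) (nu : probability (measurableTypeR R) R) :=
  forall f : R -> R, continuous f -> bounded_fun f ->
    (fun n => \int[Pn n]_x f (Y n x)) @ \oo --> \int[nu]_y f y.

Definition cvg_in_prob (Pn : forall n, probability (n.-tuple X) R)
    (Y : forall n, n.-tuple X -> R) (c : R) :=
  forall e : R, 0 < e ->
    (fun n => Pn n [set x | e <= `|Y n x - c|]) @ \oo --> 0%E.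

End product.

Lemma one_le_two_ereal (R : realType) : (1 <= 2%:E :> \bar R)%E.
Proof. by rewrite lee_fin ler1n. Qed.

(* Elements of L_2(P) are represented by square-integrable functions; a set of
   elements of L_2(P) is a set of representatives closed under a.e. equality
   ([linear_subspace] below). *)
Notation L2 P := (LfunType P (one_le_two_ereal _)).

Section L2_space.
Context {d} {X : measurableType d} {R : realType}.
Variable P : probability X R.
Implicit Types (A V : set (L2 P)) (f g h psi : L2 P) (gamma : L2 P -> R).

Definition dot f g : R := \int[P]_x (f x * g x).

Definition L2norm f : R := fine ('N[P]_(2%:E)[EFin \o f])%E.

Definition L2closure A : set (L2 P) :=
  [set f | forall e : R, 0 < e -> exists2 g, A g & L2norm (g - f) < e].

Definition L2closed A := L2closure A `<=` A.

Definition mean_zero : set (L2 P) := [set h | \int[P]_x h x = 0].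

Definition linear_subspace A :=
  submod_closed (mem A) /\
  (forall f g, A f -> (f : X -> R) = g %[ae P] -> A g).

Definition positively_homogeneous A gamma :=
  forall (a : R) h, 0 < a -> A h -> gamma (a *: h) = a * gamma h.

Definition linear_on A gamma :=
  forall (a : R) f g, A f -> A g -> gamma (a *: f + g) = a * gamma f + gamma g.

Definition continuous_on A gamma :=
  forall f, A f -> forall e : R, 0 < e -> exists2 r : R, 0 < r &
    forall g, A g -> L2norm (g - f) < r -> `|gamma g - gamma f| < e.

Definition linearity_subspace (T : set (L2 P)) gamma V :=
  [/\ linear_subspace V, V `<=` T & linear_on V gamma].

Definition riesz_representer V gamma psi :=
  L2closure V psi /\
  exists ext : L2 P -> R,
    [/\ forall h, V h -> ext h = gamma h, continuous_on (L2closure V) ext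
      & forall h, L2closure V h -> ext h = dot psi h].

End L2_space.
Arguments mean_zero {d X R} P.

Section dominating_measure.
Context {d} {X : measurableType d} {R : realType}.
Variables P Q : probability X R.

Definition sum_measure : set X -> \bar R := measure_add P Q.

HB.instance Definition _ := Measure.on sum_measure.

Lemma sum_measure_fin : fin_num_fun sum_measure.
Proof.
by move=> A mA; rewrite /sum_measure measure_addE fin_numD !fin_num_measure.
Qed.

HB.instance Definition _ :=
  Measure_isFinite.Build _ _ _ sum_measure sum_measure_fin.

End dominating_measure.

Section model.
Context {d} {X : measurableType d} {R : realType}.
(* the statistical model; the values of [Psi] outside it are irrelevant *)
Variable calP : set (probability X R).
Implicit Types (P Q : probability X R) (path : R -> probability X R).

(* a version of the density dP/dmu; for each use below mu dominates P *)
Definition dens (mu : {sigma_finite_measure set X -> \bar R}) P (x : X) : R :=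
  fine ((Radon_Nikodym (charge_of_finite_measure P) mu) x).

(* The integral of ((dQ^(1/2) - dP^(1/2)) / t - h dP^(1/2) / 2)^2, which does
   not depend on the measure dominating P and Q; it is computed with P + Q. *)
Definition dqm_remainder P Q (t : R) (h : X -> R) : \bar R :=
  let mu := sum_measure P Q in
  (\int[mu]_x
    (((Num.sqrt (dens mu Q x) - Num.sqrt (dens mu P x)) / t
      - 2^-1 * h x * Num.sqrt (dens mu P x)) ^+ 2)%:E)%E.

(* the values of [path] outside [0, eps[ are irrelevant *)
Definition dqm_path P (h : L2 P) path :=
  [/\ path 0 = P,
      exists2 eps : R, 0 < eps & forall t, 0 <= t < eps -> calP (path t)
    & dqm_remainder P (path t) t h @[t --> 0^'+] --> 0%E].

Definition assumption1 P (T : set (L2 P)) :=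
  L2closed T /\ forall h, T h -> exists path, dqm_path h path.

Definition dir_pathwise_differentiable P (T : set (L2 P))
    (Psi : probability X R -> R) (gamma : L2 P -> R) :=
  positively_homogeneous T gamma /\
  forall h path, T h -> dqm_path h path ->
    t^-1 * (Psi (path t) - Psi P) @[t --> 0^'+] --> gamma h.

(* P_{n,h} = P_{n^(-1/2),h} *)
Definition local_law path n : probability X R := path (Num.sqrt n%:R)^-1.

Definition V_efficient P (V : set (L2 P)) (psi : L2 P)
    (Psi : probability X R -> R) (Tn : forall n, n.-tuple X -> R) :=
  forall h path, V h -> dqm_path h path ->
    cvg_in_law (fun n => prodn (local_law path n) n)
      (fun n x => Num.sqrt n%:R * (Tn n x - Psi (local_law path n)))
      (gauss0 (L2norm psi ^+ 2)).

End model.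

(* Main.v *)
(* Under the hypotheses on [V] only the linear directions are controlled, and no
   central limit theorem or weak compactness is needed to reach the others.
   Quadratic mean differentiability makes the n-fold product of P_{n,h} close in
   total variation to prod_i (1 + h(X_i) / sqrt n) P^n, the error being a
   Hellinger distance. V-efficiency thus gives, for Z_n = sqrt n (T_n - Psi(P))
   and directions g in V, the limits of E_P f(Z_n) prod_i (1 + g(X_i) / sqrt n),
   and these pass to all multiples t psi of the representer. Exponentials e^{tz}
   span a dense subspace of L2(N(0, s^2)), so f(Z_n) is asymptotically in L2 a
   linear combination of the products prod_i (1 + t psi(X_i) / sqrt n). Pairing
   it with prod_i (1 + h(X_i) / sqrt n) for an arbitrary h in T shows that Z_n
   converges to N(<psi, h>, s^2) under P_{n,h}, whereas
   sqrt n (Psi(P_{n,h}) - Psi(P)) tends to gamma(h); the difference of the two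
   limits is delta(h). Consistency of the scale estimator transfers from P to
   P_{n,h} because prod_i (1 + h(X_i) / sqrt n) is bounded in L2. *)
Require Import Defs.
From HB Require Import structures.
From mathcomp Require Import all_boot all_order all_algebra.
From mathcomp Require Import all_classical all_reals all_analysis.
From mathcomp Require Import measurable_realfun ring lra.

Set Implicit Arguments.
Unset Strict Implicit.
Unset Printing Implicit Defensive.

Import Order.TTheory GRing.Theory Num.Theory.
Import numFieldNormedType.Exports.

Local Open Scope classical_set_scope.
Local Open Scope ring_scope.

(** * Densities and product measures *)

(** The test functions are the double exponentials exp(- e^(a z + c)). Affine changes of z stay in
    the family, so drifts and scales are absorbed into its parameters; squaring stays in it, so the
    limit of E f(Z)^2 needed for an L2 comparison is known as soon as that of E f(Z) is; and
    half-lines are approximated by it, so distribution functions are reached directly. A comparison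
    in total variation needs genuine densities, while h may be unbounded. A bounded centered k
    replaces h, so that 1 + k / sqrt n is a density once n is large; the explicit L2 distance
    between products of linear factors leads back to h. Density of exponentials rests on closure
    properties alone: difference quotients produce z, power series produce exponentials of
    multipliers, and domination by a Gaussian growth bound keeps the limits in L2. Against the
    products for t psi, the product for h has the same limiting pairings e^(t <psi, h>) as the one
    for tau psi with tau = <psi, h> / s^2. The component of h orthogonal to psi leaves no trace in
    the law of Z, although it may enter gamma(h). *)

Section density.
Local Open Scope ereal_scope.
Context d (X : measurableType d) (R : realType).
Variables (nu : {sigma_finite_measure set X -> \bar R}).
Variables (Q : {finite_measure set X -> \bar R}) (q : X -> R).
Hypotheses (mq : measurable_fun setT q) (q0 : forall x, (0 <= q x)%R).
Hypothesis Qq : forall A, measurable A -> Q A = \int[nu]_(x in A) (q x)%:E.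

(** [q] and the Radon-Nikodym derivative have the same integral over every measurable set, hence
    agree almost everywhere, and the change of variables for the latter applies. *)
Lemma ge0_integral_density D (f : X -> \bar R) : measurable D ->
  measurable_fun D f -> (forall x, 0 <= f x) ->
  \int[Q]_(x in D) f x = \int[nu]_(x in D) (f x * (q x)%:E).
Proof.
move=> mD mf f0.
have Qnu : Q `<< nu.
  apply/null_content_dominatesP => A mA A0; rewrite Qq//.
  apply: null_set_integral => //.
  by apply: measurable_funTS; exact/measurable_EFinP.
rewrite -(Radon_Nikodym_SigmaFinite.change_of_variables Qnu f0)//.
have iq : nu.-integrable setT (EFin \o q).
  apply/integrableP; split; first exact/measurable_EFinP.
  under eq_integral do rewrite /= ger0_norm//.
  by rewrite -Qq//; have := @fin_num_measure _ _ _ Q setT measurableT;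
    rewrite ge0_fin_numE.
have aeq : ae_eq nu D (Radon_Nikodym_SigmaFinite.f Q nu) (EFin \o q).
  apply: integral_ae_eq => //.
  - apply: (integrableS measurableT) => //.
    exact: Radon_Nikodym_SigmaFinite.f_integrable.
  - by apply: measurable_funTS; exact/measurable_EFinP.
  by move=> A _ mA; rewrite -Qq// -Radon_Nikodym_SigmaFinite.f_integral.
apply: ge0_ae_eq_integral => //.
- apply: emeasurable_funM => //; apply: measurable_funTS.
  exact: measurable_int (Radon_Nikodym_SigmaFinite.f_integrable _).
- apply: emeasurable_funM => //.
  by apply: measurable_funTS; exact/measurable_EFinP.
- by move=> x _; rewrite mule_ge0//; exact: Radon_Nikodym_SigmaFinite.f_ge0.
- by move=> x _; rewrite mule_ge0// lee_fin.
- exact: ae_eqe_mul2l.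
Qed.

End density.

(** Both sides are [fine] of the same difference between the integrals of the positive and negative
    parts, so the identity holds with no integrability assumption on [F]. *)
Lemma Rintegral_density d (X : measurableType d) (R : realType)
    (nu Q : {measure set X -> \bar R}) (q : X -> R) :
  (forall x, 0 <= q x) ->
  (forall f : X -> \bar R, measurable_fun setT f -> (forall x, 0 <= f x)%E ->
    \int[Q]_x f x = \int[nu]_x (f x * (q x)%:E))%E ->
  forall F : X -> R, measurable_fun setT F ->
  \int[Q]_x F x = \int[nu]_x (F x * q x).
Proof.
move=> q0 Qq F mF; congr fine.
rewrite (integralE _ _ (fun x => (F x)%:E)) [RHS]integralE.
have mF' : measurable_fun setT (EFin \o F) by exact/measurable_EFinP.
rewrite !Qq//; last 2 first.
- exact/measurable_funeneg.
- exact/measurable_funepos.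
by congr (_ - _)%E; apply: eq_integral => x _;
  rewrite ?funeposE ?funenegE maxe_pMl ?lee_fin// mul0e ?EFinM ?mulNe.
Qed.

Section prodn_integral.
Local Open Scope ereal_scope.
Context d (X : measurableType d) (R : realType).
Implicit Types P : probability X R.

Lemma ge0_integral_prodnS P n (F : n.+1.-tuple X -> \bar R) :
  measurable_fun setT F -> (forall x, 0 <= F x) ->
  \int[prodn P n.+1]_x F x =
  \int[P]_x \int[prodn P n]_y F (@cons_pair _ _ n (x, y)).
Proof.
move=> mF F0; rewrite /= /distribution ge0_integral_pushforward//=.
rewrite fubini_tonelli1//.
by apply: measurableT_comp => //; exact: measurable_cons_pair.
Qed.

Lemma measurable_prod_tnth n (g : X -> R) : measurable_fun setT g ->
  measurable_fun setT (fun x : n.-tuple X => (\prod_(i < n) g (tnth x i))%R).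
Proof.
move=> mg; apply: measurable_prod => i _ /=.
by apply: measurableT_comp => //; exact: measurable_tnth.
Qed.

Lemma prod_tnth_cons n (g : X -> R) x (y : n.-tuple X) :
  (\prod_(i < n.+1) g (tnth (cons_pair (x, y)) i) =
   g x * \prod_(i < n) g (tnth y i))%R.
Proof.
by rewrite big_ord_recl /cons_pair/= tnth0; congr (_ * _)%R; apply: eq_bigr => i _; rewrite tnthS.
Qed.

Lemma ge0_integral_prodn_density P (Q : probability X R) (q : X -> R) n (F : n.-tuple X -> \bar R) :
  measurable_fun setT q -> (forall x, (0 <= q x)%R) ->
  (forall A, measurable A -> Q A = \int[P]_(x in A) (q x)%:E) ->
  measurable_fun setT F -> (forall x, 0 <= F x) ->
  \int[prodn Q n]_x F x =
  \int[prodn P n]_x (F x * (\prod_(i < n) q (tnth x i))%:E).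
Proof.
move=> mq q0 Qq; elim: n F => [|n IHn] F mF F0.
  by apply: eq_integral => x _; rewrite big_ord0 mule1.
have mFc x : measurable_fun setT (fun y => F (cons_pair (x, y))).
  apply: (measurableT_comp mF).
  apply: (measurableT_comp (@measurable_cons_pair _ _ n)).
  exact: measurable_pair1.
rewrite !ge0_integral_prodnS//; last 2 first.
- apply: emeasurable_funM => //; apply/measurable_EFinP.
  exact: measurable_prod_tnth.
- by move=> x; rewrite mule_ge0// lee_fin prodr_ge0.
under eq_integral => x _ do rewrite IHn//.
rewrite (ge0_integral_density mq q0 Qq measurableT); last 2 first.
- apply: (@measurable_fun_fubini_tonelli_F _ _ _ _ _ (prodn P n)
    (fun z => F (cons_pair z) * (\prod_(i < n) q (tnth z.2 i))%:E)).
    apply: emeasurable_funM; first exact: (measurableT_comp mF (@measurable_cons_pair _ _ n)).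
    apply/measurable_EFinP.
    apply: (@measurableT_comp _ _ _ _ _ _
      (fun y : n.-tuple X => (\prod_(i < n) q (tnth y i))%R)) => //.
    exact: measurable_prod_tnth.
  by move=> z; rewrite mule_ge0// lee_fin prodr_ge0.
- by move=> x; apply: integral_ge0 => y _; rewrite mule_ge0// lee_fin prodr_ge0.
apply: eq_integral => x _; rewrite muleC -ge0_integralZl//=; last 3 first.
- apply: emeasurable_funM => //; apply/measurable_EFinP.
  exact: measurable_prod_tnth.
- by move=> y _; rewrite mule_ge0// lee_fin prodr_ge0.
- by rewrite lee_fin.
by apply: eq_integral => y _; rewrite prod_tnth_cons EFinM muleCA.
Qed.

Lemma ge0_integral_prodn_prod P n (g : X -> R) :
  measurable_fun setT g -> (forall x, (0 <= g x)%R) ->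
  \int[prodn P n]_x (\prod_(i < n) g (tnth x i))%:E = (\int[P]_x (g x)%:E) ^+ n.
Proof.
move=> mg g0; elim: n => [|n IHn].
  under eq_integral do rewrite big_ord0.
  by rewrite integral_cst// expe0 mul1e; exact: probability_setT.
rewrite ge0_integral_prodnS//; last 2 first.
- by apply/measurable_EFinP; exact: measurable_prod_tnth.
- by move=> x; rewrite lee_fin prodr_ge0.
under eq_integral => x _.
  under eq_integral do rewrite prod_tnth_cons EFinM.
  rewrite ge0_integralZl//; last 3 first.
  - by apply/measurable_EFinP; exact: measurable_prod_tnth.
  - by move=> y _; rewrite lee_fin prodr_ge0.
  - by rewrite lee_fin.
  rewrite IHn.
over.
rewrite ge0_integralZr//; first by rewrite expeS.
- exact/measurable_EFinP.
- by move=> x _; rewrite lee_fin.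
- by rewrite expe_ge0// integral_ge0// => y _; rewrite lee_fin.
Qed.

Lemma integrable_prodn_prod P n (g : X -> R) :
  P.-integrable setT (EFin \o g) ->
  (prodn P n).-integrable setT (fun x => (\prod_(i < n) g (tnth x i))%:E).
Proof.
move=> ig.
have mg : measurable_fun setT g by apply/measurable_EFinP; exact: measurable_int ig.
apply/integrableP; split.
  by apply/measurable_EFinP; exact: measurable_prod_tnth.
under eq_integral do rewrite abse_EFin normr_prod.
rewrite (@ge0_integral_prodn_prod _ _ (fun x => `|g x|%R))//.
  move/integrableP : ig => [_ ig]; rewrite -ge0_fin_numE ?expe_ge0 ?integral_ge0//.
  by rewrite fin_numX// ge0_fin_numE// integral_ge0.
exact: measurableT_comp.
Qed.

(** A signed [g] is needed because factors 1 + h / sqrt n may be negative. Tonelli gives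
    integrability of the product from that of |g|, and Fubini then peels off one coordinate at a
    time. *)
Lemma integral_prodn_prod P n (g : X -> R) : P.-integrable setT (EFin \o g) ->
  (\int[prodn P n]_x (\prod_(i < n) g (tnth x i)) = (\int[P]_x g x) ^+ n)%R.
Proof.
move=> ig.
have mg : measurable_fun setT g by apply/measurable_EFinP; exact: measurable_int ig.
have ip m := @integrable_prodn_prod P m g ig.
rewrite /Rintegral.
suff -> : \int[prodn P n]_x (\prod_(i < n) g (tnth x i))%:E = (\int[P]_x (g x)%:E) ^+ n.
  rewrite -[X in fine (X ^+ n)]fineK; last exact: integrable_fin_num.
  by rewrite -EFin_expe.
elim: n => [|n IHn].
  under eq_integral do rewrite big_ord0.
  by rewrite integral_cst// expe0 mul1e; exact: probability_setT.
have mG := @measurable_prod_tnth n.+1 _ mg.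
have ipS : (P \x prodn P n).-integrable setT
    (fun z => (\prod_(i < n.+1) g (tnth (cons_pair z) i))%:E).
  apply/integrableP; split.
    apply/measurable_EFinP; apply: (measurableT_comp mG).
    exact: measurable_cons_pair.
  have /integrableP[_] := ip n.+1.
  rewrite /= /distribution ge0_integral_pushforward//=.
  by apply/measurable_EFinP; exact: measurableT_comp.
transitivity (\int[P \x prodn P n]_z
    (\prod_(i < n.+1) g (tnth (cons_pair z) i))%:E).
  by rewrite /prodn -/prodn /distribution integral_pushforward//; exact/measurable_EFinP.
rewrite -integral12_prod_meas1//.
rewrite /fubini_F.
under eq_integral => x _.
  under eq_integral do rewrite prod_tnth_cons EFinM.
  rewrite integralZl//.
  rewrite IHn.
over.
have cf : (\int[P]_x (g x)%:E) ^+ n \is a fin_num.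
  by rewrite fin_numX//; exact: integrable_fin_num.
by rewrite expeS -(fineK cf) -integralZr.
Qed.

End prodn_integral.

(** * Square-integrable functions and the Hellinger bound *)

Section square_integrable.
Context d (T : measurableType d) (R : realType).
Variable mu : {measure set T -> \bar R}.
Implicit Types f g : T -> R.
Local Notation L2mu := (Lfun mu 2%:E).

Lemma Lfun2_measurable f : f \in L2mu -> measurable_fun setT f.
Proof. by move/sub_Lfun_mfun; rewrite inE. Qed.

Lemma Lfun2_sqr f : measurable_fun setT f ->
  (\int[mu]_x (f x ^+ 2)%:E < +oo)%E -> f \in L2mu.
Proof.
move=> mf fi; rewrite inE; apply/andP; split; first by rewrite inE.
rewrite inE/= /finite_norm unlock.
apply: poweR_lty.
rewrite (eq_integral (fun x => (f x ^+ 2)%:E))// => x _.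
by rewrite /= powR_mulrn// real_normK ?num_real.
Qed.

Lemma Lfun2_bounded f g M : measurable_fun setT f -> g \in L2mu ->
  (forall x, `|f x| <= M * `|g x|) -> f \in L2mu.
Proof.
move=> mf g2 fM; apply: Lfun2_sqr => //.
have ig := Lfun2_integrable_sqr g2.
apply: (@le_lt_trans _ _ (\int[mu]_x ((M ^+ 2)%:E * (g x ^+ 2)%:E))%E).
  apply: ge0_le_integral => //.
  - by move=> x _; rewrite lee_fin sqr_ge0.
  - by apply/measurable_EFinP; exact: measurable_funX.
  - by apply/measurable_EFinP; apply: measurable_funM => //;
      apply: measurable_funX; exact: Lfun2_measurable g2.
  - move=> x _; rewrite -EFinM lee_fin -exprMn -[leLHS]real_normK ?num_real//.
    rewrite -[leRHS]real_normK ?num_real// ler_sqr ?nnegrE// normrM.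
    apply: (le_trans (fM x)); apply: ler_wpM2r => //; exact: ler_norm.
by rewrite integralZl// lte_mul_pinfty ?lee_fin ?sqr_ge0//; exact: integrable_lty.
Qed.

Lemma Lfun2D f g : f \in L2mu -> g \in L2mu -> (fun x => f x + g x) \in L2mu.
Proof.
by move=> f2 g2; apply: (Lfun_addr_closed mu (@one_le_two_ereal R)).2.
Qed.

Lemma Lfun2Z a f : f \in L2mu -> (fun x => a * f x) \in L2mu.
Proof.
move=> f2; apply: (@Lfun2_bounded _ f `|a|) => //.
  by apply: measurable_funM => //; exact: Lfun2_measurable.
by move=> x; rewrite normrM.
Qed.

Lemma Lfun2B f g : f \in L2mu -> g \in L2mu -> (fun x => f x - g x) \in L2mu.
Proof.
move=> f2 g2; have := Lfun2D f2 (Lfun2Z (-1) g2).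
by under eq_fun do rewrite mulN1r.
Qed.

Lemma Lfun2_sum (I : Type) (s : seq I) (F : I -> T -> R) :
  (forall i, F i \in L2mu) -> (fun x => \sum_(i <- s) F i x) \in L2mu.
Proof.
move=> F2; elim: s => [|i s ih].
  rewrite (_ : (fun _ => _) = cst 0); last by apply/funext => x; rewrite big_nil.
  exact: (Lfun_addr_closed mu (@one_le_two_ereal R)).1.
rewrite (_ : (fun _ => _) = (fun x => F i x + \sum_(j <- s) F j x)).
  exact: Lfun2D.
by apply/funext => x; rewrite big_cons.
Qed.

Lemma integrable_Lfun2M f g : f \in L2mu -> g \in L2mu ->
  mu.-integrable setT (fun x => (f x * g x)%:E).
Proof. by move=> f2 g2; apply/Lfun1_integrable; exact: Lfun2_mul_Lfun1. Qed.

Lemma integrable_Lfun2X f : f \in L2mu -> mu.-integrable setT (fun x => (f x ^+ 2)%:E).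
Proof. exact: Lfun2_integrable_sqr. Qed.

Lemma Rintegral_EFin f : mu.-integrable setT (EFin \o f) ->
  (\int[mu]_x (f x)%:E)%E = (\int[mu]_x f x)%:E.
Proof. by move=> fi; rewrite /Rintegral fineK//; exact: integrable_fin_num. Qed.

Lemma Rintegral_sqr_ge0 f : 0 <= \int[mu]_x (f x ^+ 2).
Proof. by apply: Rintegral_ge0 => x _; exact: sqr_ge0. Qed.

Lemma Rintegral_sqrZD f g a : f \in L2mu -> g \in L2mu ->
  \int[mu]_x ((f x + a * g x) ^+ 2) = \int[mu]_x (f x ^+ 2)
    + 2 * a * (\int[mu]_x (f x * g x)) + a ^+ 2 * (\int[mu]_x (g x ^+ 2)).
Proof.
move=> f2 g2.
have iff := integrable_Lfun2X f2; have igg := integrable_Lfun2X g2.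
have ifg := integrable_Lfun2M f2 g2.
have ifg' := integrable_Lfun2M f2 (Lfun2Z (2 * a) g2).
have igg' := integrable_Lfun2M (Lfun2Z a g2) (Lfun2Z a g2).
under eq_Rintegral => x _.
  rewrite (_ : _ ^+ 2 = f x ^+ 2 + (f x * (2 * a * g x) + (a * g x) * (a * g x))); last by ring.
over.
have iD := integrableD measurableT ifg' igg'.
rewrite RintegralD//.
rewrite RintegralD// -addrA; congr (_ + (_ + _)).
  by rewrite -RintegralZl//; apply: eq_Rintegral => x _; ring.
by rewrite -RintegralZl//; apply: eq_Rintegral => x _; ring.
Qed.

Lemma cauchy_schwarz f g : f \in L2mu -> g \in L2mu ->
  (\int[mu]_x (f x * g x)) ^+ 2 <=
  (\int[mu]_x (f x ^+ 2)) * (\int[mu]_x (g x ^+ 2)).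
Proof.
move=> f2 g2.
have := fun a => Rintegral_sqrZD a f2 g2.
set A := \int[mu]_x (f x ^+ 2); set B := \int[mu]_x (g x ^+ 2).
set C := \int[mu]_x (f x * g x) => H.
have {}H a : 0 <= A + 2 * a * C + a ^+ 2 * B by rewrite -H Rintegral_sqr_ge0.
have B0 : 0 <= B by exact: Rintegral_sqr_ge0.
have [B_0|Bn0] := eqVneq B 0.
  rewrite B_0 mulr0; have [->|Cn0] := eqVneq C 0; first by rewrite expr0n.
  (* With B = 0 the nonnegative quadratic is affine in a; this choice of a would give it the value
     -1. *)
  have := H (- (A + 1) / (2 * C)); rewrite B_0 mulr0 addr0.
  rewrite (_ : A + _ = -1); first by rewrite ler0N1.
  by field.
have {}B0 : 0 < B by rewrite lt_neqAle eq_sym Bn0.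
have := H (- C / B); rewrite (_ : A + _ + _ = A - C ^+ 2 / B); last by field.
by rewrite subr_ge0 ler_pdivrMr.
Qed.

End square_integrable.

Section probability_integral.
Context d (T : measurableType d) (R : realType).
Variable P : probability T R.

Lemma integrable_bounded (f : T -> R) (M : R) : measurable_fun setT f ->
  (forall x, `|f x| <= M) -> P.-integrable setT (EFin \o f).
Proof.
move=> mf fM; apply: (@le_integrable _ _ _ P setT _ _ (EFin \o cst M)) => //.
- exact/measurable_EFinP.
- by move=> x _ /=; rewrite lee_fin (le_trans (fM x))// ler_norm.
- exact: finite_measure_integrable_cst.
Qed.

Lemma Rintegral_prob_cst (r : R) : \int[P]_x r = r.
Proof.
rewrite Rintegral_cst// -[RHS]mulr1; congr (_ * _).
by rewrite -[RHS]/(fine 1); congr fine; exact: probability_setT.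
Qed.

Lemma normr_Rintegral_le (f : T -> R) (M : R) : measurable_fun setT f ->
  (forall x, `|f x| <= M) -> `|\int[P]_x f x| <= M.
Proof.
move=> mf fM; have fi := integrable_bounded mf fM.
rewrite (le_trans (le_normr_Rintegral _ fi))// -[leRHS]Rintegral_prob_cst.
apply: le_Rintegral => //; last exact: finite_measure_integrable_cst.
exact: integrable_norm.
Qed.

Lemma Lfun2_bounded_prob (f : T -> R) (M : R) : measurable_fun setT f ->
  (forall x, `|f x| <= M) -> f \in Lfun P 2%:E.
Proof.
move=> mf fM; apply: Lfun2_sqr => //; apply: (integrable_lty measurableT).
apply: (@integrable_bounded (fun x => f x ^+ 2) (M ^+ 2)).
  exact: measurable_funX.
by move=> x; rewrite normrX lerXn2r// nnegrE// (le_trans _ (fM x)).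
Qed.

Lemma Lfun2_integrable (f : T -> R) : f \in Lfun P 2%:E -> P.-integrable setT (EFin \o f).
Proof.
move=> f2; have c2 : cst 1 \in Lfun P 2%:E by apply: (@Lfun2_bounded_prob _ 1) => // x; rewrite normr1.
have := integrable_Lfun2M f2 c2; apply: eq_integrable => // x _ /=.
by rewrite mulr1.
Qed.

Lemma normr_indic_le1 (A : set T) x : `|\1_A x| <= 1 :> R.
Proof. by rewrite indicE ger0_norm ?ler0n// lern1 leq_b1. Qed.

Lemma probability_Rintegral (A : set T) : measurable A ->
  P A = (\int[P]_x (\1_A x : R))%:E.
Proof.
move=> mA; rewrite -Rintegral_EFin.
  by rewrite integral_indic// setIT.
by apply: (@integrable_bounded _ 1); [exact: measurable_indic|exact: normr_indic_le1].
Qed.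

End probability_integral.

Section hellinger.
Context d (X : measurableType d) (R : realType).
Variable nu : probability X R.

(** Bernoulli's inequality, used for the Hellinger affinity of products and for the limit of (1 + a
    / n)^n. *)
Lemma one_sub_expr_le (r : R) n : 0 <= r <= 1 -> 1 - r ^+ n <= n%:R * (1 - r).
Proof.
move=> /andP[r0 r1]; elim: n => [|n IHn]; first by rewrite expr0 subrr mul0r.
rewrite (_ : 1 - r ^+ n.+1 = (1 - r ^+ n) + r ^+ n * (1 - r)); last by rewrite exprSr; ring.
rewrite -natr1 mulrDl lerD// ler_wpM2r ?subr_ge0//.
by rewrite exprn_ile1.
Qed.

Lemma Lfun2_prod n (a : X -> R) : a \in Lfun nu 2%:E ->
  (fun x : n.-tuple X => \prod_(i < n) a (tnth x i)) \in Lfun (prodn nu n) 2%:E.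
Proof.
move=> a2; have ma := Lfun2_measurable a2.
apply: Lfun2_sqr; first exact: measurable_prod_tnth.
under eq_integral do rewrite -prodrXl.
have := @integrable_prodn_prod _ _ _ nu n (fun x => a x ^+ 2) (integrable_Lfun2X a2).
exact: integrable_lty.
Qed.

Lemma Rintegral_prodM n (a b : X -> R) : a \in Lfun nu 2%:E -> b \in Lfun nu 2%:E ->
  \int[prodn nu n]_x ((\prod_(i < n) a (tnth x i)) * \prod_(i < n) b (tnth x i))
  = (\int[nu]_x (a x * b x)) ^+ n.
Proof.
move=> a2 b2; rewrite -integral_prodn_prod; last exact: integrable_Lfun2M.
by apply: eq_Rintegral => x _; rewrite -big_split.
Qed.

Lemma Lfun2_bounded_mul dT (T : measurableType dT) (mu : {measure set T -> \bar R})
  (F f : T -> R) (M : R) :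
  measurable_fun setT F -> (forall x, `|F x| <= M) -> f \in Lfun mu 2%:E ->
  (fun x => F x * f x) \in Lfun mu 2%:E.
Proof.
move=> mF FM f2; apply: (@Lfun2_bounded _ _ _ _ _ f M) => //.
  by apply: measurable_funM => //; exact: Lfun2_measurable f2.
by move=> x; rewrite normrM ler_wpM2r.
Qed.

Lemma Rintegral_bounded_sqr dT (T : measurableType dT) (mu : {measure set T -> \bar R})
  (F f : T -> R) (M : R) :
  measurable_fun setT F -> (forall x, `|F x| <= M) -> f \in Lfun mu 2%:E ->
  \int[mu]_x ((F x * f x) ^+ 2) <= M ^+ 2 * \int[mu]_x (f x ^+ 2).
Proof.
move=> mF FM f2; have if2 := integrable_Lfun2X f2.
rewrite -RintegralZl//; apply: le_Rintegral => //.
- by apply: integrable_Lfun2X; apply: Lfun2_bounded_mul f2.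
- exact: (integrableZl measurableT (M ^+ 2) if2).
- move=> x _; rewrite exprMn ler_wpM2r ?sqr_ge0//.
  by rewrite -[leLHS]real_normK ?num_real// lerXn2r// nnegrE// (le_trans _ (FM x)).
Qed.

(** The affinity [rho] of the factors is multiplicative, so the products have affinity rho^n, and 1
    - rho^n <= n (1 - rho). Writing A^2 - B^2 = (A - B)(A + B), Cauchy-Schwarz bounds the squared
    difference by M^2 times 2 (1 - rho^n) times 2 (1 + rho^n), where the last factor is at most
    4. *)
Lemma hellinger_prodn n (a b : X -> R) (F : n.-tuple X -> R) (M : R) :
  a \in Lfun nu 2%:E -> b \in Lfun nu 2%:E ->
  (forall x, 0 <= a x) -> (forall x, 0 <= b x) ->
  \int[nu]_x (a x ^+ 2) = 1 -> \int[nu]_x (b x ^+ 2) = 1 ->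
  measurable_fun setT F -> (forall x, `|F x| <= M) ->
  (\int[prodn nu n]_x (F x * (\prod_(i < n) a (tnth x i)) ^+ 2)
   - \int[prodn nu n]_x (F x * (\prod_(i < n) b (tnth x i)) ^+ 2)) ^+ 2
  <= 4 * M ^+ 2 * (n%:R * \int[nu]_x ((a x - b x) ^+ 2)).
Proof.
move=> a2 b2 a0 b0 a1 b1 mF FM.
pose A (x : n.-tuple X) := \prod_(i < n) a (tnth x i).
pose B (x : n.-tuple X) := \prod_(i < n) b (tnth x i).
have A2 : A \in Lfun (prodn nu n) 2%:E by exact: Lfun2_prod.
have B2 : B \in Lfun (prodn nu n) 2%:E by exact: Lfun2_prod.
set rho := \int[nu]_x (a x * b x).
have E1 : \int[prodn nu n]_x (A x ^+ 2) = 1.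
  have := Rintegral_prodM n a2 a2; under [X in _ = X ^+ _]eq_Rintegral do rewrite -expr2.
  by rewrite a1 expr1n.
have E2 : \int[prodn nu n]_x (B x ^+ 2) = 1.
  have := Rintegral_prodM n b2 b2; under [X in _ = X ^+ _]eq_Rintegral do rewrite -expr2.
  by rewrite b1 expr1n.
have E3 : \int[prodn nu n]_x (A x * B x) = rho ^+ n by exact: Rintegral_prodM.
have sq_ab : \int[nu]_x ((a x - b x) ^+ 2) = 2 * (1 - rho).
  have := Rintegral_sqrZD (-1) a2 b2; rewrite a1 b1 -/rho.
  by under eq_Rintegral do rewrite mulN1r; move=> ->; ring.
have sqB : \int[prodn nu n]_x ((A x - B x) ^+ 2) = 2 * (1 - rho ^+ n).
  have := Rintegral_sqrZD (-1) A2 B2; rewrite E1 E2 E3.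
  by under eq_Rintegral do rewrite mulN1r; move=> ->; ring.
have sqD : \int[prodn nu n]_x ((A x + B x) ^+ 2) = 2 * (1 + rho ^+ n).
  have := Rintegral_sqrZD 1 A2 B2; rewrite E1 E2 E3.
  by under eq_Rintegral do rewrite mul1r; move=> ->; ring.
have rho0 : 0 <= rho by apply: Rintegral_ge0 => x _; rewrite mulr_ge0.
have rho1 : rho <= 1.
  by have := Rintegral_sqr_ge0 nu (fun x => a x - b x); rewrite sq_ab; lra.
have FA := Lfun2_bounded_mul mF FM A2; have FB := Lfun2_bounded_mul mF FM B2.
have AB2 := Lfun2B A2 B2.
have -> : \int[prodn nu n]_x (F x * A x ^+ 2) - \int[prodn nu n]_x (F x * B x ^+ 2)
    = \int[prodn nu n]_x ((F x * (A x - B x)) * (A x + B x)).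
  rewrite -RintegralB//; last 2 first.
  - by have := integrable_Lfun2M FA A2; apply: eq_integrable => // x _ /=; rewrite expr2 mulrA.
  - by have := integrable_Lfun2M FB B2; apply: eq_integrable => // x _ /=; rewrite expr2 mulrA.
  by apply: eq_Rintegral => x _; ring.
apply: (le_trans (cauchy_schwarz _ _)); [exact: Lfun2_bounded_mul AB2|exact: Lfun2D|].
rewrite sqD.
have := Rintegral_bounded_sqr mF FM AB2; rewrite sqB => H.
apply: (@le_trans _ _ ((M ^+ 2 * (2 * (1 - rho ^+ n))) * (2 * (1 + rho ^+ n)))).
  by rewrite ler_wpM2r// mulr_ge0// addr_ge0// exprn_ge0.
rewrite sq_ab.
have r01 : 0 <= rho <= 1 by rewrite rho0 rho1.
have Hn := one_sub_expr_le n r01.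
have rn1 : rho ^+ n <= 1 by exact: exprn_ile1.
rewrite (_ : 4 * M ^+ 2 * _ = M ^+ 2 * (8 * (n%:R * (1 - rho)))); last by ring.
rewrite -mulrA ler_wpM2l ?sqr_ge0//.
nra.
Qed.

End hellinger.

(** * Local laws and products of linear factors *)

Section half_sum.
Context d (X : measurableType d) (R : realType).
Variables P Q : probability X R.

(** [prodn] takes a probability, whereas P + Q has mass 2. *)
Definition half_sum : set X -> \bar R := mscale (2^-1)%:nng (sum_measure P Q).

HB.instance Definition _ := Measure.on half_sum.

Let half_sumT : half_sum setT = 1%E.
Proof.
rewrite /half_sum /mscale/= /sum_measure measure_addE.
transitivity (2^-1%:E * (1 + 1) : \bar R)%E.
  by congr (_ * (_ + _))%E; exact: probability_setT.
by rewrite -EFinD -EFinM; congr EFin; field.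
Qed.

HB.instance Definition _ := Measure_isProbability.Build _ _ R half_sum half_sumT.

Lemma ge0_integral_half_sum (f : X -> \bar R) :
  measurable_fun setT f -> (forall x, (0 <= f x)%E) ->
  (\int[half_sum]_x f x = 2^-1%:E * \int[sum_measure P Q]_x f x)%E.
Proof. by move=> mf f0; rewrite ge0_integral_mscale. Qed.

End half_sum.

Section dens.
Context d (X : measurableType d) (R : realType).
Variable mu : {sigma_finite_measure set X -> \bar R}.
Variable P : probability X R.
Hypothesis Pmu : P `<< mu.

Lemma measurable_dens : measurable_fun setT (dens mu P).
Proof. exact: measurableT_comp. Qed.

Lemma measurable_sqrt_dens : measurable_fun setT (fun x => Num.sqrt (dens mu P x)).
Proof.
apply: (@measurableT_comp _ _ _ _ _ _ (@Num.sqrt R)); last exact: measurable_dens.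
by apply: continuous_measurable_fun; exact: sqrt_continuous.
Qed.

(* [dens] may be negative on a null set, which squaring its square root hides *)
Lemma integral_sqrt_dens A : measurable A ->
  (P A = \int[mu]_(x in A) ((Num.sqrt (dens mu P x)) ^+ 2)%:E)%E.
Proof.
move=> mA; rewrite (Radon_Nikodym_SigmaFinite.f_integral Pmu mA).
apply: ge0_ae_eq_integral => //.
- apply: measurable_funTS.
  exact: measurable_int (Radon_Nikodym_SigmaFinite.f_integrable Pmu).
- apply/measurable_EFinP/measurable_funTS/measurable_funX.
  exact: measurable_sqrt_dens.
- by move=> x _; exact: Radon_Nikodym_SigmaFinite.f_ge0.
- have := ae_eq_Radon_Nikodym_SigmaFinite Pmu mA.
  apply: filterS => x H /H; rewrite /dens => <-.
  rewrite sqr_sqrtr ?fine_ge0 ?Radon_Nikodym_SigmaFinite.f_ge0//.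
  by rewrite fineK//; exact: Radon_Nikodym_SigmaFinite.f_fin_num.
Qed.

End dens.

Section prodn_density.
Context d (X : measurableType d) (R : realType).
Variables P Q : probability X R.
Variable q : X -> R.
Hypotheses (mq : measurable_fun setT q) (q0 : forall x, 0 <= q x).
Hypothesis Qq : forall A, measurable A -> (Q A = \int[P]_(x in A) (q x)%:E)%E.

Lemma Rintegral_prodn_density n (F : n.-tuple X -> R) : measurable_fun setT F ->
  \int[prodn Q n]_x F x = \int[prodn P n]_x (F x * \prod_(i < n) q (tnth x i)).
Proof.
apply: Rintegral_density => [x|f mf f0]; first exact: prodr_ge0.
exact: ge0_integral_prodn_density.
Qed.

End prodn_density.

Section dqm_bound.
Context d (X : measurableType d) (R : realType).
Variables P Q : probability X R.
Local Notation mu := (sum_measure P Q).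

Lemma sum_measure_dominatesl : P `<< mu.
Proof.
apply/null_content_dominatesP => A mA muA; apply/eqP.
have : (measure_add P Q A == 0)%E by exact/eqP.
by rewrite measure_addE padde_eq0// => /andP[].
Qed.

Lemma sum_measure_dominatesr : Q `<< mu.
Proof.
apply/null_content_dominatesP => A mA muA; apply/eqP.
have : (measure_add P Q A == 0)%E by exact/eqP.
by rewrite measure_addE padde_eq0// => /andP[].
Qed.

(** In terms of r = sqrt (1 + y) the error is exactly (r - 1)^2 / 2, and |r - 1| <= |r - 1| (r + 1)
    = |y|. *)
Lemma sqrt_taylor1 (y : R) : -1 <= y ->
  `|y / 2 - (Num.sqrt (1 + y) - 1)| <= y ^+ 2 / 2.
Proof.
move=> y1; have y0 : 0 <= 1 + y by lra.
set r := Num.sqrt (1 + y); have r0 : 0 <= r by exact: sqrtr_ge0.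
have -> : y = r ^+ 2 - 1 by rewrite sqr_sqrtr//; ring.
rewrite (_ : _ - _ = (r - 1) ^+ 2 / 2); last by field.
rewrite ger0_norm ?divr_ge0 ?sqr_ge0// ler_pM2r ?invr_gt0//.
rewrite (_ : r ^+ 2 - 1 = (r - 1) * (r + 1)); last by ring.
by rewrite exprMn ler_peMr ?sqr_ge0// exprn_ege1//; lra.
Qed.

Lemma sqr_sum3 (x y z : R) : (x + y + z) ^+ 2 <= 3 * (x ^+ 2 + y ^+ 2 + z ^+ 2).
Proof.
have := sqr_ge0 (x - y); have := sqr_ge0 (y - z); have := sqr_ge0 (x - z); nra.
Qed.

(** Here a and b stand for the square roots of the densities of Q and P, and k for a bounded
    substitute of h. The scaled difference splits into the remainder of differentiability, the
    substitution error (h - k) b / 2, and the Taylor error of the square root, at most t K^2 b / 2;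
    the 3 comes from squaring a sum of three terms. *)
Lemma dqm_pointwise (t a b h k K : R) : 0 < t -> `|k| <= K -> t * K <= 1 ->
  t^-1 ^+ 2 * (a - Num.sqrt (1 + t * k) * b) ^+ 2 <=
  3 * (((a - b) / t - 2^-1 * h * b) ^+ 2
       + 4^-1 * ((h - k) ^+ 2 + t ^+ 2 * K ^+ 4) * b ^+ 2).
Proof.
move=> t0 kK tK.
have tk1 : `|t * k| <= 1.
  by rewrite normrM gtr0_norm// (le_trans _ tK)// ler_pM2l.
have tk : -1 <= t * k by move: tk1; rewrite ler_norml => /andP[].
pose e := (t * k / 2 - (Num.sqrt (1 + t * k) - 1)) / t.
have eE : t^-1 * (a - Num.sqrt (1 + t * k) * b) =
    ((a - b) / t - 2^-1 * h * b) + 2^-1 * (h - k) * b + e * b.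
  by rewrite /e; field; rewrite gt_eqF.
have eK : `|e| <= t * K ^+ 2 / 2.
  rewrite /e normrM normfV (gtr0_norm t0) ler_pdivrMr//.
  apply: (le_trans (sqrt_taylor1 tk)).
  rewrite (_ : t * K ^+ 2 / 2 * t = (t * K) ^+ 2 / 2); last by ring.
  rewrite ler_pM2r ?invr_gt0// -[leLHS]real_normK ?num_real// lerXn2r ?nnegrE//.
    by rewrite mulr_ge0 ?(ltW t0)// (le_trans _ kK).
  by rewrite normrM gtr0_norm// ler_pM2l.
rewrite -exprMn eE; clearbody e.
apply: (le_trans (sqr_sum3 _ _ _)); rewrite ler_wpM2l// -addrA lerD2l.
rewrite !exprMn mulrDr mulrDl lerD//.
  by rewrite ler_wpM2r ?sqr_ge0// exprVn (_ : (2 ^+ 2 : R) = 4)//; ring.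
rewrite ler_wpM2r ?sqr_ge0//.
rewrite -[leLHS]real_normK ?num_real//.
rewrite (_ : _ * (_ * _) = (t * K ^+ 2 / 2) ^+ 2); last by field.
by rewrite lerXn2r ?nnegrE// (le_trans _ eK).
Qed.

(* With respect to the probability (P + Q) / 2, the n-fold products of Q and of
   (1 + t k) P are compared through the Hellinger distance of the factors;
   sqrt (1 + t k) is then expanded to first order. *)
Lemma dqm_bound n (h k : X -> R) (K M : R) (F : n.-tuple X -> R) : (0 < n)%N ->
  let t := (Num.sqrt n%:R)^-1 in
  h \in Lfun P 2%:E -> measurable_fun setT k -> (forall x, `|k x| <= K) ->
  \int[P]_x k x = 0 -> t * K <= 1 ->
  measurable_fun setT F -> (forall x, `|F x| <= M) ->
  (((\int[prodn Q n]_x F x -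
     \int[prodn P n]_x (F x * \prod_(i < n) (1 + t * k (tnth x i)))) ^+ 2)%:E <=
  (12 * M ^+ 2)%:E * (dqm_remainder P Q t h +
    (4^-1 * (\int[P]_x ((h x - k x) ^+ 2) + t ^+ 2 * K ^+ 4))%:E))%E.
Proof.
move=> n0 t h2 mk kK k0 tK mF FM.
have t0 : 0 < t by rewrite invr_gt0 sqrtr_gt0 ltr0n.
(* The factor n lost in passing to products is exactly the normalization 1 / t^2 of the remainder of
   differentiability. *)
have tn : n%:R = t^-1 ^+ 2 :> R by rewrite invrK sqr_sqrtr.
pose nu : probability X R := half_sum P Q.
(* Halving the dominating measure doubles densities, hence multiplies their square roots by sqrt
   2. *)
pose c : R := Num.sqrt 2.
have c2 : c ^+ 2 = 2 by rewrite sqr_sqrtr.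
pose p x := c * Num.sqrt (dens mu P x).
pose q x := c * Num.sqrt (dens mu Q x).
pose b x := Num.sqrt (1 + t * k x) * p x.
have tk x : 0 <= 1 + t * k x.
  have : `|t * k x| <= 1.
    by rewrite normrM gtr0_norm// (le_trans _ tK)// ler_pM2l.
  by rewrite ler_norml => /andP[]; lra.
have mdP := measurable_sqrt_dens sum_measure_dominatesl.
have mdQ := measurable_sqrt_dens sum_measure_dominatesr.
have mp : measurable_fun setT p by exact: measurable_funM.
have mq : measurable_fun setT q by exact: measurable_funM.
have msk : measurable_fun setT (fun x => Num.sqrt (1 + t * k x)).
  apply: (@measurableT_comp _ _ _ _ _ _ (@Num.sqrt R)).
    by apply: continuous_measurable_fun; exact: sqrt_continuous.
  by apply: measurable_funD => //; exact: measurable_funM.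
have mb : measurable_fun setT b by exact: measurable_funM.
have half (Q' : probability X R) : Q' `<< mu -> forall A, measurable A ->
    (Q' A = \int[nu]_(x in A) ((c * Num.sqrt (dens mu Q' x)) ^+ 2)%:E)%E.
  move=> Q'mu A mA; have md := measurable_sqrt_dens Q'mu.
  rewrite ge0_integral_mscale//=; last 2 first.
  - apply/measurable_EFinP/measurable_funTS/measurable_funX.
    exact: measurable_funM.
  - by move=> x _; rewrite lee_fin sqr_ge0.
  under eq_integral do rewrite exprMn c2 EFinM.
  rewrite ge0_integralZl//; last first.
    by apply/measurable_EFinP/measurable_funTS/measurable_funX.
  by rewrite muleA -EFinM mulVf// mul1e -integral_sqrt_dens.
have Pp := half P sum_measure_dominatesl.
have Qq := half Q sum_measure_dominatesr.
have mp2 : measurable_fun setT (fun x => p x ^+ 2) by exact: measurable_funX.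
have mq2 : measurable_fun setT (fun x => q x ^+ 2) by exact: measurable_funX.
have p20 x : 0 <= p x ^+ 2 by exact: sqr_ge0.
have q20 x : 0 <= q x ^+ 2 by exact: sqr_ge0.
have b2E x : b x ^+ 2 = (1 + t * k x) * p x ^+ 2 by rewrite exprMn sqr_sqrtr.
have ik : P.-integrable setT (EFin \o k).
  exact: integrable_bounded kK.
have ik1 : P.-integrable setT (fun x => (1 + t * k x)%:E).
  have i1 : P.-integrable setT (EFin \o cst 1) by exact: finite_measure_integrable_cst.
  exact: (integrableD measurableT i1 (integrableZl measurableT t ik)).
have intq : (\int[nu]_x (q x ^+ 2)%:E = 1)%E by rewrite -Qq//; exact: probability_setT.
(* Centering of k makes (1 + t k) P a probability, as the Hellinger bound requires of both laws. *)
have intb : (\int[nu]_x (b x ^+ 2)%:E = 1)%E.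
  under eq_integral do rewrite b2E EFinM.
  rewrite -(ge0_integral_density mp2 p20 Pp)//; last first.
    by apply/measurable_EFinP/measurable_funD => //; exact: measurable_funM.
  rewrite Rintegral_EFin//.
  have -> : \int[P]_x (1 + t * k x) = \int[P]_x 1 + \int[P]_x (t * k x).
    apply: RintegralD => //; first exact: finite_measure_integrable_cst.
    exact: (integrableZl measurableT t ik).
  by rewrite RintegralZl// k0 mulr0 addr0 Rintegral_prob_cst.
have q2 : q \in Lfun nu 2%:E by apply: Lfun2_sqr => //; rewrite intq ltry.
have b2 : b \in Lfun nu 2%:E by apply: Lfun2_sqr => //; rewrite intb ltry.
have HF : \int[prodn Q n]_x F x =
    \int[prodn nu n]_x (F x * (\prod_(i < n) q (tnth x i)) ^+ 2).
  rewrite (Rintegral_prodn_density mq2 q20 Qq)//.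
  by apply: eq_Rintegral => x _; rewrite prodrXl.
have HG : \int[prodn P n]_x (F x * \prod_(i < n) (1 + t * k (tnth x i))) =
    \int[prodn nu n]_x (F x * (\prod_(i < n) b (tnth x i)) ^+ 2).
  rewrite (Rintegral_prodn_density mp2 p20 Pp); last first.
    apply: measurable_funM => //.
    apply: (@measurable_prod_tnth _ _ _ n (fun y => 1 + t * k y)).
    by apply: measurable_funD => //; exact: measurable_funM.
  apply: eq_Rintegral => x _; rewrite -mulrA -big_split/=.
  by congr (_ * _); rewrite -prodrXl; apply: eq_bigr => i _; rewrite b2E.
rewrite HF HG.
have q0 x : 0 <= q x by rewrite mulr_ge0 ?sqrtr_ge0.
have b0 x : 0 <= b x by rewrite mulr_ge0 ?mulr_ge0 ?sqrtr_ge0.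
have q1 : \int[nu]_x (q x ^+ 2) = 1 by rewrite /Rintegral intq.
have b1 : \int[nu]_x (b x ^+ 2) = 1 by rewrite /Rintegral intb.
have := hellinger_prodn q2 b2 q0 b0 q1 b1 mF FM.
rewrite -lee_fin => /le_trans; apply.
(* The 4 belongs to the Hellinger bound, the 3 to [dqm_pointwise]. *)
rewrite (_ : 12 * M ^+ 2 = (4 * M ^+ 2) * 3); last by ring.
rewrite EFinM [in leRHS]EFinM -muleA; apply: lee_wpmul2l.
  by rewrite lee_fin mulr_ge0// sqr_ge0.
have iqb := integrable_Lfun2X (Lfun2B q2 b2).
rewrite EFinM -Rintegral_EFin// ge0_integral_half_sum; last 2 first.
- by apply/measurable_EFinP/measurable_funX; exact: measurable_funB.
- by move=> x; rewrite lee_fin sqr_ge0.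
pose u x := Num.sqrt (dens mu Q x) - Num.sqrt (1 + t * k x) * Num.sqrt (dens mu P x).
have mu_ : measurable_fun setT u by apply: measurable_funB => //; exact: measurable_funM.
under eq_integral => x _.
  rewrite (_ : (q x - b x) ^+ 2 = 2 * (u x ^+ 2)); last first.
    by rewrite -c2 -exprMn; congr (_ ^+ 2); rewrite /q /b /p /u; ring.
  rewrite EFinM.
over.
rewrite ge0_integralZl//; last 2 first.
- by apply/measurable_EFinP/measurable_funX.
- by move=> x _; rewrite lee_fin sqr_ge0.
rewrite (muleA 2^-1%:E) -EFinM mulVf// mul1e tn -ge0_integralZl//; last 3 first.
- by apply/measurable_EFinP/measurable_funX.
- by move=> x _; rewrite lee_fin sqr_ge0.
- by rewrite lee_fin sqr_ge0.
have mh := Lfun2_measurable h2.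
pose r x := (Num.sqrt (dens mu Q x) - Num.sqrt (dens mu P x)) / t
      - 2^-1 * h x * Num.sqrt (dens mu P x).
pose g x := 4^-1 * ((h x - k x) ^+ 2 + t ^+ 2 * K ^+ 4).
have g0 x : 0 <= g x.
  by rewrite mulr_ge0// addr_ge0 ?sqr_ge0// mulr_ge0 ?sqr_ge0// exprn_even_ge0.
have mr : measurable_fun setT (fun x => (r x ^+ 2)%:E).
  apply/measurable_EFinP/measurable_funX/measurable_funB.
    by apply: measurable_funM => //; exact: measurable_funB.
  by apply: measurable_funM => //; exact: measurable_funM.
have mg : measurable_fun setT (EFin \o g).
  apply/measurable_EFinP/measurable_funM => //; apply: measurable_funD => //.
  by apply: measurable_funX; exact: measurable_funB.
pose dp x := Num.sqrt (dens mu P x) ^+ 2.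
have mdp : measurable_fun setT dp by exact: measurable_funX.
have dp0 x : 0 <= dp x by exact: sqr_ge0.
have mgd : measurable_fun setT (fun x => (g x)%:E * (dp x)%:E)%E.
  by apply: emeasurable_funM => //; exact/measurable_EFinP.
apply: (@le_trans _ _ (\int[mu]_x (3%:E * ((r x ^+ 2)%:E + (g x)%:E * (dp x)%:E)))%E).
  apply: ge0_le_integral => //.
  - by move=> x _; rewrite -EFinM lee_fin mulr_ge0 ?sqr_ge0.
  - by apply: emeasurable_funM => //; apply/measurable_EFinP/measurable_funX.
  - by apply: emeasurable_funM => //; exact: emeasurable_funD.
  - move=> x _; rewrite -(EFinM (g x)) -EFinD -!EFinM lee_fin.
    exact: dqm_pointwise.
rewrite ge0_integralZl//; last 2 first.
- exact: emeasurable_funD.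
- by move=> x _; rewrite -EFinM -EFinD lee_fin addr_ge0 ?sqr_ge0// mulr_ge0.
rewrite ge0_integralD//; last 2 first.
- by move=> x _; rewrite lee_fin sqr_ge0.
- by move=> x _; rewrite -EFinM lee_fin mulr_ge0.
rewrite -(ge0_integral_density mdp dp0 (integral_sqrt_dens sum_measure_dominatesl))//.
rewrite lee_wpmul2l// leeD2l//.
have k2 : k \in Lfun P 2%:E by exact: Lfun2_bounded_prob kK.
have ihk := integrable_Lfun2X (Lfun2B h2 k2).
have ic : P.-integrable setT (EFin \o cst (t ^+ 2 * K ^+ 4)).
  exact: finite_measure_integrable_cst.
rewrite Rintegral_EFin; last exact: (integrableZl measurableT 4^-1 (integrableD measurableT ihk ic)).
rewrite lee_fin RintegralZl//; last exact: (integrableD measurableT ihk ic).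
by rewrite RintegralD// Rintegral_prob_cst.
Qed.

End dqm_bound.

Lemma Rintegral_dominated_cvg d (T : measurableType d) (R : realType)
    (mu : {measure set T -> \bar R}) (f_ : nat -> T -> R) (f g : T -> R) :
  (forall n, measurable_fun setT (f_ n)) -> measurable_fun setT f ->
  (forall x, f_ n x @[n --> \oo] --> f x) ->
  mu.-integrable setT (EFin \o g) -> (forall n x, `|f_ n x| <= g x) ->
  (\int[mu]_x f_ n x) @[n --> \oo] --> \int[mu]_x f x.
Proof.
move=> mf_ mf ff ig fg.
have [||||fi _ H] := @dominated_convergence _ _ _ mu setT measurableT
  (fun n => EFin \o f_ n) (EFin \o f) (EFin \o g) _ _ _ ig.
- by move=> n; exact/measurable_EFinP.
- exact/measurable_EFinP.
- by apply/aeW => x _; apply: cvg_EFin; [exact: nearW|exact: ff].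
- by apply/aeW => x n _ /=; rewrite lee_fin.
apply: fine_cvg; rewrite fineK//; exact: integrable_fin_num.
Qed.

Section cvg_one_plus.
Context (R : realType).

Lemma cvg_invn : (n%:R^-1 : R) @[n --> \oo] --> (0 : R).
Proof. by rewrite -(@cvg_shiftS _ (fun n => n%:R^-1 : R^o)); exact: cvg_harmonic. Qed.

Lemma cvg_inv_sqrtn : (Num.sqrt n%:R)^-1 @[n --> \oo] --> (0 : R).
Proof.
have -> : (fun n : nat => (Num.sqrt n%:R : R)^-1) = (fun n => Num.sqrt n%:R^-1).
  by apply/funext => n; rewrite sqrtrV.
rewrite -[X in _ --> X]sqrtr0.
by apply: (continuous_cvg _ (@sqrt_continuous R 0)); exact: cvg_invn.
Qed.

Lemma cvg_inv_sqrtn_right : (Num.sqrt n%:R)^-1 @[n --> \oo] --> (0 : R)^'+.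
Proof.
move=> A A0; have := cvg_inv_sqrtn A0 => HA.
rewrite !near_simpl in HA *; near=> n.
have : (fun x => 0 < x -> A x) (Num.sqrt n%:R : R)^-1 by near: n; exact: HA.
by apply; rewrite invr_gt0 sqrtr_gt0 ltr0n; near: n; exact: nbhs_infty_gt.
Unshelve. all: by end_near. Qed.

(** Divided by e^a, the power is ((1 + x) e^(-x))^n with x = a / n. From 1 + x <= e^x and 1 - x <=
    e^(-x) the base lies between 1 - x^2 and 1, and Bernoulli's inequality gives (1 - x^2)^n >= 1 -
    a^2 / n. *)
Lemma cvg_expr_one_plus (a : R) : (1 + a / n%:R) ^+ n @[n --> \oo] --> expR a.
Proof.
rewrite -[X in _ --> X]mul1r.
have -> : (fun n : nat => (1 + a / n%:R) ^+ n) =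
    (fun n => ((1 + a / n%:R) ^+ n * expR (- a)) * expR a).
  by apply/funext => n; rewrite -mulrA -expRD addNr expR0 mulr1.
apply: cvgMr_tmp.
apply: (@squeeze_cvgr _ _ _ _ (fun n : nat => 1 - a ^+ 2 * n%:R^-1) (fun=> 1)).
- near=> n.
  have n0 : 0 < n%:R :> R by near: n; exact: nbhs_infty_gtr.
  have an : `|a| < n%:R by near: n; exact: nbhs_infty_gtr.
  have : `|a / n%:R| < 1 by rewrite normrM normfV (gtr0_norm n0) ltr_pdivrMr// mul1r.
  rewrite ltr_norml => /andP[h1 h2].
  have -> : expR (- a) = expR (- (a / n%:R)) ^+ n.
    by rewrite -expRM_natl; congr expR; field; rewrite gt_eqF.
  rewrite -exprMn; apply/andP; split; last first.
    apply: exprn_ile1; first by rewrite mulr_ge0 ?expR_ge0//; lra.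
    rewrite -[leRHS](expRxMexpNx_1 (a / n%:R)) ler_wpM2r ?expR_ge0//.
    exact: expR_ge1Dx.
  have r01 : 0 <= 1 - (a / n%:R) ^+ 2 <= 1.
    by apply/andP; split; [nra|rewrite gerBl sqr_ge0].
  apply: (@le_trans _ _ ((1 - (a / n%:R) ^+ 2) ^+ n)).
    have := one_sub_expr_le n r01.
    rewrite (_ : n%:R * _ = a ^+ 2 / n%:R); last by field; rewrite gt_eqF.
    lra.
  rewrite lerXn2r// ?nnegrE; [by case/andP: r01| |].
    by rewrite mulr_ge0 ?expR_ge0//; lra.
  rewrite (_ : 1 - _ ^+ 2 = (1 + a / n%:R) * (1 - a / n%:R)); last by ring.
  by rewrite ler_wpM2l//; [lra|exact: expR_ge1Dx].
- rewrite -[X in _ --> X]subr0; apply: cvgB; first exact: cvg_cst.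
  rewrite -(mulr0 (a ^+ 2)); apply: cvgMl_tmp.
  exact: cvg_invn.
- exact: cvg_cst.
Unshelve. all: by end_near. Qed.

(** Suited to bounds obtained by Cauchy-Schwarz, which control squares, and to approximating
    functions chosen according to [e]: only [C] must not depend on [e]. *)
Lemma cvg0_approx (u : nat -> R) (C : R) : 0 <= C ->
  (forall e, 0 < e -> \forall n \near \oo, u n ^+ 2 <= C * e) ->
  u n @[n --> \oo] --> (0 : R).
Proof.
move=> C0 H; apply/cvgr0Pnorm_lt => e e0.
have e1 : 0 < e ^+ 2 / (C + 1) by rewrite divr_gt0 ?exprn_gt0// ltr_wpDl.
have := H _ e1; apply: filterS => n un.
rewrite -ltr_sqr ?nnegrE// ?ltW//.
rewrite real_normK ?num_real// (le_lt_trans un)// mulrA ltr_pdivrMr ?ltr_wpDl//.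
by rewrite mulrC ltr_pM2l ?exprn_gt0// ltrDl.
Qed.

End cvg_one_plus.

(* Not a likelihood ratio: the factors may be negative. It stands for the
   likelihood ratio of the local law with score [h]. *)
Definition lik (R : realType) d (X : measurableType d) n (h : X -> R)
  (x : n.-tuple X) : R := \prod_(i < n) (1 + (Num.sqrt n%:R)^-1 * h (tnth x i)).

Lemma sqr_Rintegral_bounded d (T : measurableType d) (R : realType)
    (P : probability T R) (F g : T -> R) (M : R) :
  measurable_fun setT F -> (forall x, `|F x| <= M) -> g \in Lfun P 2%:E ->
  (\int[P]_x (F x * g x)) ^+ 2 <= M ^+ 2 * \int[P]_x (g x ^+ 2).
Proof.
move=> mF FM g2; have Fg2 := Lfun2_bounded_mul mF FM g2.
have c2 : cst 1 \in Lfun P 2%:E.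
  by apply: (@Lfun2_bounded_prob _ _ _ _ _ 1) => // x; rewrite normr1.
have := cauchy_schwarz Fg2 c2.
under eq_Rintegral do rewrite mulr1.
under [X in _ * X]eq_Rintegral do rewrite expr1n.
rewrite Rintegral_prob_cst mulr1 => /le_trans; apply.
exact: Rintegral_bounded_sqr.
Qed.

Section lik.
Context d (X : measurableType d) (R : realType).
Variable P : probability X R.
Implicit Types h k : X -> R.

Let lik_Lfun1 n h : h \in Lfun P 2%:E ->
  (fun y => 1 + (Num.sqrt n%:R)^-1 * h y) \in Lfun P 2%:E.
Proof.
move=> h2; apply: Lfun2D; last exact: Lfun2Z.
by apply: (@Lfun2_bounded_prob _ _ _ _ _ 1) => // x; rewrite normr1.
Qed.

Lemma Lfun2_lik n h : h \in Lfun P 2%:E -> @lik _ _ _ n h \in Lfun (prodn P n) 2%:E.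
Proof. by move=> h2; exact: (Lfun2_prod n (lik_Lfun1 n h2)). Qed.

(** In one factor the linear terms of (1 + t h)(1 + t k) integrate to zero by centering, and t^2 = 1
    / n multiplies the inner product; independence gives the n-th power. *)
Lemma Rintegral_likM n h k : h \in Lfun P 2%:E -> k \in Lfun P 2%:E ->
  \int[P]_x h x = 0 -> \int[P]_x k x = 0 -> (0 < n)%N ->
  \int[prodn P n]_x (lik h x * lik k x) =
  (1 + (\int[P]_x (h x * k x)) / n%:R) ^+ n.
Proof.
move=> h2 k2 h0 k0 n0.
rewrite (Rintegral_prodM n (lik_Lfun1 n h2) (lik_Lfun1 n k2)); congr (_ ^+ n).
set t := (Num.sqrt n%:R)^-1.
have t2 : t ^+ 2 = n%:R^-1 by rewrite exprVn sqr_sqrtr.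
have c2 : cst 1 \in Lfun P 2%:E.
  by apply: (@Lfun2_bounded_prob _ _ _ _ _ 1) => // x; rewrite normr1.
have i1 := Lfun2_integrable (Lfun2Z t h2).
have i2 := Lfun2_integrable (Lfun2Z t k2).
have i3 := integrable_Lfun2M (Lfun2Z (t ^+ 2) h2) k2.
have ic : P.-integrable setT (EFin \o cst 1) by exact: Lfun2_integrable.
under eq_Rintegral => x _.
  rewrite (_ : (1 + t * h x) * (1 + t * k x) = 1 + (t * h x + (t * k x + t ^+ 2 * h x * k x))); last by ring.
over.
have i23 := integrableD measurableT i2 i3.
rewrite RintegralD//; last exact: (integrableD measurableT i1 i23).
rewrite RintegralD// RintegralD// Rintegral_prob_cst.
rewrite (RintegralZl _ measurableT (Lfun2_integrable h2)).
rewrite (RintegralZl _ measurableT (Lfun2_integrable k2)) h0 k0.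
rewrite !mulr0 !add0r; congr (1 + _).
under eq_Rintegral do rewrite -mulrA.
rewrite RintegralZl//; last exact: integrable_Lfun2M.
by rewrite t2 mulrC.
Qed.

Lemma cvg_Rintegral_likM h k : h \in Lfun P 2%:E -> k \in Lfun P 2%:E ->
  \int[P]_x h x = 0 -> \int[P]_x k x = 0 ->
  (\int[prodn P n]_x (lik h x * lik k x)) @[n --> \oo]
  --> expR (\int[P]_x (h x * k x)).
Proof.
move=> h2 k2 h0 k0.
have := @cvg_expr_one_plus R (\int[P]_x (h x * k x)); apply: cvg_trans.
apply: near_eq_cvg.
near=> n; rewrite Rintegral_likM//; near: n; exact: nbhs_infty_gt.
Unshelve. all: by end_near. Qed.

(** For fixed j the squared distance tends to e^A - 2 e^(B j) + e^(C j) as n grows, with the inner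
    products A = <h, h>, B j = <h, k_j> and C j = <k_j, k_j>; this vanishes as j grows since B and C
    both tend to A. The threshold on n depends on j, whence the nested filters. *)
Lemma near_lik_sub h (k_ : nat -> X -> R) : h \in Lfun P 2%:E ->
  (forall j, k_ j \in Lfun P 2%:E) ->
  \int[P]_x h x = 0 -> (forall j, \int[P]_x k_ j x = 0) ->
  (\int[P]_x ((h x - k_ j x) ^+ 2)) @[j --> \oo] --> (0 : R) ->
  forall e, 0 < e -> \forall j \near \oo, \forall n \near \oo,
    \int[prodn P n]_x ((lik h x - lik (k_ j) x) ^+ 2) <= e.
Proof.
move=> h2 k2 h0 k0 hk e e0.
set A := \int[P]_x (h x ^+ 2).
pose D j := \int[P]_x ((h x - k_ j x) ^+ 2).
pose B j := \int[P]_x (h x * k_ j x).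
pose C j := \int[P]_x (k_ j x ^+ 2).
pose E j := \int[P]_x (h x * (h x - k_ j x)).
have DE j : D j = A - 2 * B j + C j.
  have := Rintegral_sqrZD (-1) h2 (k2 j); rewrite -/A -/(B j) -/(C j).
  by under eq_Rintegral do rewrite mulN1r; rewrite -/(D j) => ->; ring.
have BE j : E j = A - B j.
  have i1 := integrable_Lfun2X h2; have i2 := integrable_Lfun2M h2 (k2 j).
  by rewrite -RintegralB//; apply: eq_Rintegral => x _; ring.
have cE : E j @[j --> \oo] --> (0 : R).
  apply: (@cvg0_approx R _ A) => //; first exact: Rintegral_sqr_ge0.
  move=> e' e'0; have /cvgr0Pnorm_lt/(_ _ e'0) := hk.
  apply: filterS => j Hj.
  apply: (le_trans (cauchy_schwarz h2 (Lfun2B h2 (k2 j)))).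
  apply: ler_wpM2l; first exact: Rintegral_sqr_ge0.
  by apply: ltW; apply: le_lt_trans Hj; exact: ler_norm.
have cB : B j @[j --> \oo] --> A.
  rewrite (_ : B = fun j => A - E j); last by apply/funext => j; rewrite BE; ring.
  by rewrite -[X in _ --> X]subr0; apply: cvgB cE; exact: cvg_cst.
have cC : C j @[j --> \oo] --> A.
  rewrite (_ : C = fun j => D j - A + 2 * B j); last by apply/funext => j; rewrite DE; ring.
  rewrite -[X in _ --> X](_ : 0 - A + 2 * A = A); last by ring.
  apply: cvgD; last exact: cvgMl_tmp.
  by apply: cvgB => //; exact: cvg_cst.
have cl : expR A - 2 * expR (B j) + expR (C j) @[j --> \oo] --> (0 : R).
  rewrite -[X in _ --> X](_ : expR A - 2 * expR A + expR A = 0); last by ring.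
  apply: cvgD; last by apply: continuous_cvg => //; exact: continuous_expR.
  apply: cvgB; first exact: cvg_cst.
  by apply: cvgMl_tmp; apply: continuous_cvg => //; exact: continuous_expR.
have /cvgr0Pnorm_lt/(_ _ e0) := cl; apply: filterS => j Hj.
have cn : (\int[prodn P n]_x ((lik h x - lik (k_ j) x) ^+ 2)) @[n --> \oo] -->
    expR A - 2 * expR (B j) + expR (C j).
  rewrite (_ : (fun n => _) = fun n => \int[prodn P n]_x (lik h x * lik h x)
      - 2 * \int[prodn P n]_x (lik h x * lik (k_ j) x)
      + \int[prodn P n]_x (lik (k_ j) x * lik (k_ j) x)); last first.
    apply/funext => n.
    have := Rintegral_sqrZD (-1) (Lfun2_lik n h2) (Lfun2_lik n (k2 j)).
    under eq_Rintegral do rewrite mulN1r; move=> ->.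
    rewrite (_ : 2 * -1 = - 2) ?mulrN1// sqrrN expr1n mul1r mulNr.
    by congr (_ - _ + _); apply: eq_Rintegral => x _; rewrite expr2.
  apply: cvgD; last first.
    rewrite /C; under [X in expR X]eq_Rintegral do rewrite expr2.
    exact: cvg_Rintegral_likM.
  apply: cvgB.
    rewrite /A; under [X in expR X]eq_Rintegral do rewrite expr2.
    exact: cvg_Rintegral_likM.
  by apply: cvgMl_tmp; exact: cvg_Rintegral_likM.
have {}Hj : expR A - 2 * expR (B j) + expR (C j) < e by apply: le_lt_trans Hj; exact: ler_norm.
have := @cvgr_lt _ _ _ _ _ _ cn _ Hj.
by move=> /(_ _); apply: filterS => n /ltW.
Qed.

Lemma normr_clip_sub (c y : R) : 0 <= c ->
  `|y - Num.max (- c) (Num.min y c)| <= `|y|.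
Proof.
move=> c0.
case: (leP y c) => h1.
- by case: (leP (- c) y) => h2; case: (leP 0 y) => h3;
    rewrite ?(ger0_norm h3) ?(ltr0_norm h3) ler_norml; lra.
- by case: (leP (- c) c) => h2; case: (leP 0 y) => h3;
    rewrite ?(ger0_norm h3) ?(ltr0_norm h3) ler_norml; lra.
Qed.

Lemma bounded_approximation h : h \in Lfun P 2%:E -> \int[P]_x h x = 0 ->
  exists k_ : nat -> X -> R,
    [/\ forall j, measurable_fun setT (k_ j),
        forall j x, `|k_ j x| <= 2 * j%:R,
        forall j, \int[P]_x k_ j x = 0
      & (\int[P]_x ((h x - k_ j x) ^+ 2)) @[j --> \oo] --> (0 : R)].
Proof.
move=> h2 h0; have mh := Lfun2_measurable h2.
pose g (j : nat) x := Num.max (- j%:R) (Num.min (h x) j%:R).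
have mg j : measurable_fun setT (g j).
  by apply: measurable_maxr => //; exact: measurable_minr.
have gj j x : `|g j x| <= j%:R.
  rewrite ler_norml /g le_max lexx/= ge_max ge_min lexx orbT andbT.
  by rewrite (@le_trans _ _ 0) ?oppr_le0.
have gh j x : `|h x - g j x| <= `|h x|.
  exact: normr_clip_sub.
have ig j := integrable_bounded P (mg j) (gj j).
have g2 j : g j \in Lfun P 2%:E by exact: Lfun2_bounded_prob (gj j).
pose m j := \int[P]_x g j x.
have mj j : `|m j| <= j%:R by exact: normr_Rintegral_le.
exists (fun j x => g j x - m j); split.
- by move=> j; exact: measurable_funB.
- by move=> j x; rewrite (le_trans (ler_normB _ _))// mulr_natl mulr2n lerD.
- move=> j; rewrite RintegralB//; last exact: finite_measure_integrable_cst.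
  by rewrite Rintegral_prob_cst subrr.
- have cD : (\int[P]_x ((h x - g j x) ^+ 2)) @[j --> \oo] --> (0 : R).
    rewrite -[X in _ --> X](Rintegral_prob_cst P).
    apply: (@Rintegral_dominated_cvg _ _ _ _ _ _ (fun x => h x ^+ 2)) => //.
    + by move=> j; apply: measurable_funX; exact: measurable_funB.
    + move=> x; apply: cvg_near_cst; near=> j.
      have hj : `|h x| <= j%:R by near: j; exact: nbhs_infty_ger.
      move: hj; rewrite ler_norml => /andP[h1 h2'].
      by rewrite /g min_l// max_r// subrr expr0n.
    + exact: integrable_Lfun2X.
    + by move=> j x; rewrite normrX -[leRHS]real_normK ?num_real// lerXn2r ?nnegrE.
  apply: (@squeeze_cvgr _ _ _ _ (fun=> 0) _ _ _ _ _ cD); last exact: cvg_cst.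
  apply: nearW => j; rewrite Rintegral_sqr_ge0/=.
  have c2 : cst 1 \in Lfun P 2%:E.
    by apply: (@Lfun2_bounded_prob _ _ _ _ _ 1) => // x; rewrite normr1.
  have -> : \int[P]_x ((h x - (g j x - m j)) ^+ 2) =
      \int[P]_x ((h x - g j x + m j * cst 1 x) ^+ 2).
    by apply: eq_Rintegral => x _ /=; congr (_ ^+ 2); ring.
  rewrite (Rintegral_sqrZD (m j) (Lfun2B h2 (g2 j)) c2).
  have -> : \int[P]_x ((h x - g j x) * cst 1 x) = - m j.
    under eq_Rintegral do rewrite mulr1.
    by rewrite RintegralB ?h0 ?sub0r//; exact: Lfun2_integrable.
  have -> : \int[P]_x (cst 1 x ^+ 2) = 1.
    by under eq_Rintegral do rewrite expr1n; rewrite Rintegral_prob_cst.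
  by have := sqr_ge0 (m j); nra.
Unshelve. all: by end_near. Qed.

End lik.

Section local_laws.
Context d (X : measurableType d) (R : realType).
Variables (calP : set (probability X R)) (P : probability X R).

Lemma L2P (h : L2 P) : (h : X -> R) \in Lfun P 2%:E.
Proof. exact: LfunP. Qed.

Lemma L2normE (f : L2 P) : L2norm f ^+ 2 = \int[P]_x (f x ^+ 2).
Proof.
have i := integrable_Lfun2X (L2P f).
rewrite /L2norm unlock.
rewrite (eq_integral (fun x => (f x ^+ 2)%:E)); last first.
  by move=> x _; rewrite /= powR_mulrn// real_normK ?num_real.
rewrite Rintegral_EFin// poweR_EFin/= powR12_sqrt ?sqr_sqrtr//; exact: Rintegral_sqr_ge0.
Qed.

(** [dqm_bound] handles a bounded score, so a truncation [k_ j] is interposed: it is compared with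
    the local law by [dqm_bound] and with h by [near_lik_sub]. The index j is fixed by the tolerance
    before n grows, so its bound K is constant and t K tends to 0. *)
Lemma cvg_local_lik (h : L2 P) path (F : forall n, n.-tuple X -> R) (M : R) :
  \int[P]_x h x = 0 -> dqm_path calP h path ->
  (forall n, measurable_fun setT (F n)) -> (forall n x, `|F n x| <= M) ->
  (\int[prodn (local_law path n) n]_x F n x -
   \int[prodn P n]_x (F n x * lik h x)) @[n --> \oo] --> (0 : R).
Proof.
move=> h0 [path0 _ dqm] mF FM; have h2 := L2P h.
have [k_ [mk kM k0 hk]] := bounded_approximation h2 h0.
(* 38 = 2 (18 + 1): the squares of I1 - I2 and I2 - I3 are at most 18 M^2 e and M^2 e, where 18 = 12
   (1 + (1 + 1) / 4). *)
apply: (@cvg0_approx R _ (38 * M ^+ 2)); first by rewrite mulr_ge0 ?sqr_ge0.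
move=> e e0.
have k2 j : k_ j \in Lfun P 2%:E by exact: Lfun2_bounded_prob (kM j).
have /cvgr0Pnorm_lt/(_ _ e0) H1 := hk.
have [j [hkj lkj]] : exists j, `|\int[P]_x ((h x - k_ j x) ^+ 2)| < e /\
    \forall n \near \oo, \int[prodn P n]_x ((lik h x - lik (k_ j) x) ^+ 2) <= e.
  have H := filterI H1 (near_lik_sub h2 k2 h0 k0 hk e0).
  by have [j [? ?]] := filter_ex (H _); exists j.
have {}kM := kM j; set K := 2 * j%:R in kM.
pose t n : R := (Num.sqrt n%:R)^-1.
have ct : t n @[n --> \oo] --> (0 : R) by exact: cvg_inv_sqrtn.
have /fine_cvgP[Dfin Dcvg] : (fun n => dqm_remainder P (path (t n)) (t n) h) @ \oo --> 0%E.
  exact: (cvg_comp _ _ (@cvg_inv_sqrtn_right R) dqm).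
have /cvgr0Pnorm_lt/(_ _ e0) De := Dcvg.
have tK : t n * K @[n --> \oo] --> (0 : R).
  by rewrite -[X in _ --> X](mul0r K); exact: cvgMr_tmp.
have t2K : t n ^+ 2 * K ^+ 4 @[n --> \oo] --> (0 : R).
  rewrite -[X in _ --> X](mul0r (K ^+ 4)); apply: cvgMr_tmp.
  by rewrite -[X in _ --> X](mulr0 0); exact: cvgM.
have /cvgr0Pnorm_lt/(_ _ ltr01) tK1 := tK.
have /cvgr0Pnorm_lt/(_ _ e0) t2Ke := t2K.
near=> n.
have n0 : (0 < n)%N by near: n; exact: nbhs_infty_gt.
have Dn : dqm_remainder P (path (t n)) (t n) h \is a fin_num by near: n; exact: Dfin.
have Den : `|fine (dqm_remainder P (path (t n)) (t n) h)| < e by near: n; exact: De.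
have tK1n : `|t n * K| < 1 by near: n; exact: tK1.
have t2Ken : `|t n ^+ 2 * K ^+ 4| < e by near: n; exact: t2Ke.
have likn : \int[prodn P n]_x ((lik h x - lik (k_ j) x) ^+ 2) <= e by near: n; exact: lkj.
have tK1n' : t n * K <= 1 by rewrite (le_trans (ler_norm _))// ltW.
have := dqm_bound (path (t n)) n0 h2 (mk j) kM (k0 j) tK1n' (mF n) (FM n).
rewrite -(fineK Dn) -EFinD -EFinM lee_fin.
set r := fine _ in Den *; set I1 := \int[_]_x F n x.
set I2 := \int[_]_x (_ * _) => H2.
set I3 := \int[_]_x (_ * _).
have l2 := Lfun2_lik n h2; have l2' := Lfun2_lik n (k2 j).
have I23 : (I2 - I3) ^+ 2 <= M ^+ 2 * e.
  have -> : I2 - I3 = \int[prodn P n]_x (F n x * (lik (k_ j) x - lik h x)).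
    rewrite -RintegralB//; first by apply: eq_Rintegral => x _; rewrite mulrBr.
    - exact: Lfun2_integrable (Lfun2_bounded_mul (mF n) (FM n) l2').
    - exact: Lfun2_integrable (Lfun2_bounded_mul (mF n) (FM n) l2).
  apply: (le_trans (sqr_Rintegral_bounded (mF n) (FM n) (Lfun2B l2' l2))).
  rewrite ler_wpM2l ?sqr_ge0//.
  by under eq_Rintegral do rewrite -sqrrN opprB.
have M0 : 0 <= M ^+ 2 by exact: sqr_ge0.
have H12 : (I1 - I2) ^+ 2 <= 18 * M ^+ 2 * e.
  apply: (le_trans H2).
  rewrite (_ : 18 * M ^+ 2 * e = 12 * M ^+ 2 * (e + 4^-1 * (e + e))); last by field.
  apply: ler_wpM2l; first by rewrite mulr_ge0.
  have r_e : r <= e by rewrite (le_trans (ler_norm _))// ltW.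
  apply: lerD => //; rewrite ler_pM2l// lerD//.
    by rewrite (le_trans (ler_norm _))// ltW.
  by rewrite (le_trans (ler_norm _))// ltW.
rewrite (_ : I1 - I3 = (I1 - I2) + (I2 - I3)); last by ring.
have := sqr_ge0 ((I1 - I2) - (I2 - I3)); nra.
Unshelve. all: by end_near. Qed.

End local_laws.

(** * Density of exponentials in L2 of a centered normal law *)

Section normal_density.
Context (R : realType).
Implicit Types m s t : R.
Local Notation leb := (@lebesgue_measure R).

Lemma ge0_integral_normal_prob m s D (f : R -> \bar R) : measurable D ->
  measurable_fun D f -> (forall x, (0 <= f x)%E) ->
  (\int[normal_prob m s]_(x in D) f x =
   \int[leb]_(x in D) (f x * (normal_pdf m s x)%:E))%E.
Proof.
move=> mD mf f0; apply: (@ge0_integral_density _ _ _ leb) => //.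
- exact: measurable_normal_pdf.
- by move=> x; exact: normal_pdf_ge0.
Qed.

Lemma normal_pdf_peak m s x : s != 0 ->
  normal_pdf m s x = normal_peak s * normal_fun m s x.
Proof. by move=> s0; rewrite normal_pdfE. Qed.

(** Exponential tilting: the first factor is the likelihood ratio of N(t s^2, s^2) to N(0, s^2), the
    limit counterpart of the product in direction t psi. *)
Lemma normal_pdf_shift s t x : s != 0 ->
  normal_pdf (t * s ^+ 2) s x =
  expR (t * x - t ^+ 2 * s ^+ 2 / 2) * normal_pdf 0 s x.
Proof.
move=> s0; rewrite !normal_pdf_peak// [RHS]mulrCA; congr (_ * _).
by rewrite /normal_fun -expRD; congr expR; field.
Qed.

Lemma normal_prob_shift s t (D : set R) : s != 0 -> measurable D ->
  (normal_prob (t * s ^+ 2) s D =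
   \int[normal_prob 0 s]_(x in D) (expR (t * x - t ^+ 2 * s ^+ 2 / 2))%:E)%E.
Proof.
move=> s0 mD; rewrite ge0_integral_normal_prob//; last first.
  apply/measurable_EFinP/measurable_funTS/measurableT_comp => //.
  by apply: measurable_funB => //; exact: measurable_funM.
by apply: eq_integral => x _; rewrite normal_pdf_shift// EFinM.
Qed.

Let measurable_expR_shift s t :
  measurable_fun setT (fun x : R => expR (t * x - t ^+ 2 * s ^+ 2 / 2)).
Proof.
by apply: measurableT_comp => //; apply: measurable_funB => //; exact: measurable_funM.
Qed.

Lemma ge0_integral_normal_shift s t (f : R -> \bar R) : s != 0 ->
  measurable_fun setT f -> (forall x, (0 <= f x)%E) ->
  (\int[normal_prob (t * s ^+ 2) s]_x f x =
   \int[normal_prob 0 s]_x (f x * (expR (t * x - t ^+ 2 * s ^+ 2 / 2))%:E))%E.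
Proof.
move=> s0 mf f0.
apply: (@ge0_integral_density _ _ _ (normal_prob 0 s)) => //.
- exact: measurable_expR_shift.
- by move=> A mA; exact: normal_prob_shift.
Qed.

Lemma Rintegral_normal_shift s t (f : R -> R) : s != 0 -> measurable_fun setT f ->
  \int[normal_prob (t * s ^+ 2) s]_x f x =
  \int[normal_prob 0 s]_x (f x * expR (t * x - t ^+ 2 * s ^+ 2 / 2)).
Proof.
move=> s0 mf.
apply: (@Rintegral_density _ _ _ (normal_prob 0 s) (normal_prob (t * s ^+ 2) s)
  (fun x => expR (t * x - t ^+ 2 * s ^+ 2 / 2))) => [x|g mg g0|]; last by [].
- exact: expR_ge0.
- exact: ge0_integral_normal_shift.
Qed.

(** The moment generating function is read off from the total mass 1 of the tilted law. *)
Lemma Rintegral_normal_expR s t : s != 0 ->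
  \int[normal_prob 0 s]_x expR (t * x) = expR (t ^+ 2 * s ^+ 2 / 2).
Proof.
move=> s0; have := ge0_integral_normal_shift t s0 (@measurable_cst _ _ _ _ _ 1%E).
move=> /(_ (fun=> lee01)).
rewrite integral_cst// mul1e => E1.
have : (normal_prob (t * s ^+ 2) s setT = 1)%E by exact: probability_setT.
rewrite E1 => E2.
rewrite -[RHS]/(fine (expR (t ^+ 2 * s ^+ 2 / 2))%:E); congr fine.
transitivity (\int[normal_prob 0 s]_x ((expR (t ^+ 2 * s ^+ 2 / 2))%:E *
    (1 * (expR (t * x - t ^+ 2 * s ^+ 2 / 2))%:E)))%E.
  apply: eq_integral => x _.
  by rewrite mul1e -EFinM -expRD; congr (expR _)%:E; ring.
rewrite ge0_integralZl ?lee_fin ?expR_ge0 ?E2 ?mule1//.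
apply: emeasurable_funM => //; apply/measurable_EFinP.
exact: measurable_expR_shift.
Qed.

(** Against the density of N(0, s^2) this integrand is a constant multiple of the density of N(0, 2
    s^2). *)
Lemma integrable_normal_sqr s : 0 < s ->
  (normal_prob 0 s).-integrable setT (fun x => (expR (x ^+ 2 / (4 * s ^+ 2)))%:E).
Proof.
move=> s0.
have me : measurable_fun setT (fun x : R => expR (x ^+ 2 / (4 * s ^+ 2))).
  by apply: measurableT_comp => //; apply: measurable_funM => //; exact: measurable_funX.
apply/integrableP; split; first exact/measurable_EFinP.
under eq_integral do rewrite /= ger0_norm ?expR_ge0//.
rewrite ge0_integral_normal_prob//; last exact/measurable_EFinP.
have sn0 : s != 0 by rewrite gt_eqF.
pose s' := Num.sqrt 2 * s.
have s'0 : s' != 0 by rewrite mulf_neq0 ?gt_eqF ?sqrtr_gt0.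
have p'0 : normal_peak s' != 0 by rewrite gt_eqF ?normal_peak_gt0.
pose c := normal_peak s / normal_peak s'.
under eq_integral => x _.
  rewrite -EFinM (_ : _ * _ = c * normal_pdf 0 s' x); last first.
    rewrite (normal_pdf_peak _ _ sn0) (normal_pdf_peak _ _ s'0) /c [RHS]mulrA divfK//.
    rewrite [LHS]mulrCA; congr (_ * _); rewrite /normal_fun -expRD; congr expR.
    rewrite subr0 /s' exprMn sqr_sqrtr//; field; rewrite gt_eqF//.
  rewrite EFinM.
over.
rewrite ge0_integralZl//; first by rewrite integral_normal_pdf mule1 ltry.
- by apply/measurable_EFinP; exact: measurable_normal_pdf.
- by move=> x _; rewrite lee_fin normal_pdf_ge0.
- by rewrite lee_fin divr_ge0 ?normal_peak_ge0.
Qed.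

End normal_density.

Section exponential_density.
Context (R : realType) (s : R) (s0 : 0 < s).
Local Notation G := (normal_prob 0 s).
Implicit Types (g v : R -> R) (r : seq (R * R)).

Definition expsum r (z : R) : R := \sum_(p <- r) p.1 * expR (p.2 * z).

Definition exp_approx g := forall e, 0 < e ->
  exists r, \int[G]_z ((g z - expsum r z) ^+ 2) <= e.

(** The admissible Gaussian growth rate: e^(2 u0 z^2) has square e^(z^2 / (4 s^2)), integrable by
    [integrable_normal_sqr]. The margin between u0 and 2 u0 absorbs any factor e^(B |z|). *)
Let u0 : R := (16 * s ^+ 2)^-1.

Let u0_gt0 : 0 < u0. Proof. by rewrite invr_gt0 mulr_gt0// exprn_gt0. Qed.

Lemma Lfun2_expR_sqr c : (fun z => c * expR (2 * u0 * z ^+ 2)) \in Lfun G 2%:E.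
Proof.
apply: Lfun2Z; apply: Lfun2_sqr.
  by apply: measurableT_comp => //; apply: measurable_funM => //; exact: measurable_funX.
apply: (integrable_lty measurableT).
apply: eq_integrable (integrable_normal_sqr s0) => // x _ /=.
rewrite -expRM_natl; congr (expR _)%:E; rewrite /u0; field.
by rewrite gt_eqF.
Qed.

Lemma normr_mul_le_sqr (B z : R) : B * `|z| <= u0 * z ^+ 2 + B ^+ 2 / (4 * u0).
Proof.
have -> : z ^+ 2 = `|z| ^+ 2 by rewrite real_normK ?num_real.
rewrite -subr_ge0.
rewrite (_ : _ - _ = (2 * u0 * `|z| - B) ^+ 2 / (4 * u0)); last first.
  by field; rewrite gt_eqF.
by rewrite divr_ge0 ?sqr_ge0// mulr_ge0// ltW.
Qed.

Lemma Lfun2_growth g (A B : R) : measurable_fun setT g ->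
  (forall z, `|g z| <= A * expR (u0 * z ^+ 2 + B * `|z|)) -> g \in Lfun G 2%:E.
Proof.
move=> mg gA.
pose c := A * expR (B ^+ 2 / (4 * u0)).
apply: (@Lfun2_bounded _ _ R G g (fun z => c * expR (2 * u0 * z ^+ 2)) 1) => //.
  exact: Lfun2_expR_sqr.
move=> z; rewrite mul1r (le_trans (gA z))// (le_trans _ (ler_norm _))//.
have A0 : 0 <= A.
  by rewrite -(pmulr_lge0 _ (expR_gt0 (u0 * z ^+ 2 + B * `|z|))) (le_trans _ (gA z)).
rewrite /c -mulrA -expRD ler_wpM2l// ler_expR.
by have := normr_mul_le_sqr B z; lra.
Qed.

Lemma measurable_expRM (t : R) : measurable_fun setT (fun z : R => expR (t * z)).
Proof. by apply: measurableT_comp => //; exact: measurable_funM. Qed.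

Lemma Lfun2_expR t : (fun z => expR (t * z)) \in Lfun G 2%:E.
Proof.
apply: (@Lfun2_growth _ 1 `|t|); first exact: measurable_expRM.
move=> z; rewrite mul1r ger0_norm ?expR_ge0// ler_expR -normrM.
rewrite (le_trans (ler_norm _))// lerDr mulr_ge0 ?sqr_ge0//; exact: ltW.
Qed.

Lemma Lfun2_expsum r : expsum r \in Lfun G 2%:E.
Proof.
by apply: Lfun2_sum => p; apply: Lfun2Z; exact: Lfun2_expR.
Qed.

Lemma Rintegral_sqrD_le g1 g2 : g1 \in Lfun G 2%:E -> g2 \in Lfun G 2%:E ->
  \int[G]_z ((g1 z + g2 z) ^+ 2) <=
  2 * (\int[G]_z (g1 z ^+ 2)) + 2 * (\int[G]_z (g2 z ^+ 2)).
Proof.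
move=> h1 h2.
have := Rintegral_sqrZD 1 h1 h2; under eq_Rintegral do rewrite mul1r; move=> ->.
have := Rintegral_sqrZD (-1) h1 h2.
have := Rintegral_sqr_ge0 G (fun z => g1 z + -1 * g2 z); lra.
Qed.

Lemma exp_approx_expR t : exp_approx (fun z => expR (t * z)).
Proof.
move=> e e0; exists [:: (1, t)].
under eq_Rintegral do rewrite /expsum big_seq1/= mul1r subrr expr0n/=.
by rewrite Rintegral_prob_cst ltW.
Qed.

Lemma exp_approxZ a g : g \in Lfun G 2%:E -> exp_approx g ->
  exp_approx (fun z => a * g z).
Proof.
move=> g2 ag e e0.
have e1 : 0 < e / (a ^+ 2 + 1) by rewrite divr_gt0// ltr_wpDl ?sqr_ge0.
have [r rg] := ag _ e1; exists [seq (a * p.1, p.2) | p <- r].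
under eq_Rintegral => z _.
  rewrite (_ : (_ - _) ^+ 2 = a ^+ 2 * (g z - expsum r z) ^+ 2); last first.
    rewrite -exprMn mulrBr; congr ((_ - _) ^+ 2).
    by rewrite /expsum big_map mulr_sumr; apply: eq_bigr => p _; rewrite mulrA.
over.
rewrite RintegralZl//; last exact: integrable_Lfun2X (Lfun2B g2 (Lfun2_expsum r)).
apply: (@le_trans _ _ (a ^+ 2 * (e / (a ^+ 2 + 1)))).
  by rewrite ler_wpM2l ?sqr_ge0.
rewrite mulrA ler_pdivrMr ?ltr_wpDl ?sqr_ge0//.
by rewrite mulrC ler_pM2l// lerDl.
Qed.

Lemma exp_approxD g1 g2 : g1 \in Lfun G 2%:E -> g2 \in Lfun G 2%:E ->
  exp_approx g1 -> exp_approx g2 -> exp_approx (fun z => g1 z + g2 z).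
Proof.
move=> h1 h2 a1 a2 e e0.
have e4 : 0 < e / 4 by rewrite divr_gt0.
have [r1 r1e] := a1 _ e4; have [r2 r2e] := a2 _ e4; exists (r1 ++ r2).
under eq_Rintegral => z _.
  rewrite (_ : _ - _ = (g1 z - expsum r1 z) + (g2 z - expsum r2 z)); last first.
    by rewrite /expsum big_cat/=; ring.
over.
apply: (le_trans (Rintegral_sqrD_le _ _)); [exact: Lfun2B (Lfun2_expsum _)..|lra].
Qed.

(** The common growth bound is square-integrable under [G], so dominated convergence turns the
    pointwise limit into an L2 limit. *)
Lemma exp_approx_lim (g_ : nat -> R -> R) g (A B : R) :
  (forall n, measurable_fun setT (g_ n)) -> measurable_fun setT g ->
  (forall n z, `|g_ n z| <= A * expR (u0 * z ^+ 2 + B * `|z|)) ->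
  (forall z, `|g z| <= A * expR (u0 * z ^+ 2 + B * `|z|)) ->
  (forall z, g_ n z @[n --> \oo] --> g z) ->
  (forall n, exp_approx (g_ n)) -> exp_approx g.
Proof.
move=> mg_ mg g_A gA gg ag e e0.
pose D z := A * expR (u0 * z ^+ 2 + B * `|z|).
have mD : measurable_fun setT D.
  apply: measurable_funM => //; apply: measurableT_comp => //.
  apply: measurable_funD; first by apply: measurable_funM => //; exact: measurable_funX.
  by apply: measurable_funM => //; exact: measurableT_comp.
have D2 : D \in Lfun G 2%:E.
  apply: (@Lfun2_growth _ A B) => // z; rewrite ger0_norm//.
  exact: le_trans (gA z).
have mgn n : measurable_fun setT (fun z => (g z - g_ n z) ^+ 2).
  by apply: measurable_funX; exact: measurable_funB.
have c0 : (\int[G]_z ((g z - g_ n z) ^+ 2)) @[n --> \oo] --> (0 : R).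
  rewrite -[X in _ --> X](Rintegral_prob_cst G).
  apply: (@Rintegral_dominated_cvg _ _ R G (fun n z => (g z - g_ n z) ^+ 2)
    (fun=> 0) (fun z => (2 * D z) ^+ 2)).
  - exact: mgn.
  - exact: measurable_cst.
  - move=> z; rewrite -[X in _ --> X](expr0n _ 2).
    rewrite -[X in X ^+ 2](subrr (g z)).
    have c : g z - g_ n z @[n --> \oo] --> g z - g z.
      by apply: cvgB (gg z); exact: cvg_cst.
    by under eq_fun do rewrite expr2; rewrite expr2; exact: cvgM.
  - exact: integrable_Lfun2X (Lfun2Z 2 D2).
  - move=> n z; rewrite normrX lerXn2r ?nnegrE//.
      by rewrite mulr_ge0//; exact: le_trans (gA z).
    by rewrite (le_trans (ler_normB _ _))// mulr_natl mulr2n lerD.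
have g2 : g \in Lfun G 2%:E by exact: Lfun2_growth gA.
have g_2 n : g_ n \in Lfun G 2%:E by exact: Lfun2_growth (g_A n).
have e4 : 0 < e / 4 by rewrite divr_gt0.
have /cvgr0Pnorm_lt/(_ _ e4) H := c0.
have [n Hn] := filter_ex H.
have [r rn] := ag n _ e4; exists r.
under eq_Rintegral => z _.
  rewrite (_ : _ - _ = (g z - g_ n z) + (g_ n z - expsum r z)); last by ring.
over.
apply: (le_trans (Rintegral_sqrD_le _ _)).
- exact: Lfun2B.
- exact: Lfun2B (Lfun2_expsum r).
- have := ler_norm (\int[G]_z ((g z - g_ n z) ^+ 2)); lra.
Qed.

(* Membership in the closure must be stable under multiplication by [expR (t * z)]
   for the induction on multipliers to go through. *)
Definition mult_class g := [/\ measurable_fun setT g,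
  exists A B, 0 <= A /\ forall z, `|g z| <= A * expR (B * `|z|) &
  forall t, exp_approx (fun z => g z * expR (t * z))].

(** The definition of [mult_class] gives no hold on a product of two members, whereas maps
    preserving the class compose; multipliers thus form an algebra at once. *)
Definition multiplier v := forall g, mult_class g -> mult_class (fun z => v z * g z).

Let growth_expR g A B t z : 0 <= A -> `|g z| <= A * expR (B * `|z|) ->
  `|g z * expR (t * z)| <= A * expR ((B + `|t|) * `|z|).
Proof.
move=> A0 gA; rewrite normrM (ger0_norm (expR_ge0 _)).
rewrite mulrDl expRD mulrA ler_pM ?expR_ge0// ler_expR.
by rewrite -normrM ler_norm.
Qed.

Let growth_sqr (A B z : R) : 0 <= A ->
  A * expR (B * `|z|) <= A * expR (u0 * z ^+ 2 + B * `|z|).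
Proof.
move=> A0; rewrite ler_wpM2l// ler_expR lerDr mulr_ge0 ?sqr_ge0//; exact: ltW.
Qed.

Let measurable_mul_expR g t : measurable_fun setT g ->
  measurable_fun setT (fun z => g z * expR (t * z)).
Proof. by move=> mg; apply: measurable_funM => //; exact: measurable_expRM. Qed.

Lemma mult_class_Lfun2 g t : mult_class g ->
  (fun z => g z * expR (t * z)) \in Lfun G 2%:E.
Proof.
move=> [mg [A [B [A0 gA]]] _].
apply: (@Lfun2_growth _ A (B + `|t|)); first exact: measurable_mul_expR.
by move=> z; apply: le_trans (growth_sqr _ _ A0); exact: growth_expR.
Qed.

Lemma mult_class1 : mult_class (fun=> 1).
Proof.
split; first exact: measurable_cst.
- by exists 1, 0; split=> // z; rewrite mul0r expR0 mulr1 normr1.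
- by move=> t; under [X in exp_approx X]eq_fun do rewrite mul1r; exact: exp_approx_expR.
Qed.

Lemma mult_classD g1 g2 : mult_class g1 -> mult_class g2 ->
  mult_class (fun z => g1 z + g2 z).
Proof.
move=> h1 h2; have [m1 [A1 [B1 [A10 gA1]]] a1] := h1; have [m2 [A2 [B2 [A20 gA2]]] a2] := h2.
split; first exact: measurable_funD.
- exists (A1 + A2), (`|B1| + `|B2|); split; first exact: addr_ge0.
  move=> z; rewrite (le_trans (ler_normD _ _))// mulrDl lerD//.
    rewrite (le_trans (gA1 z))// ler_wpM2l// ler_expR ler_wpM2r//.
    by rewrite (le_trans (ler_norm _))// lerDl.
  rewrite (le_trans (gA2 z))// ler_wpM2l// ler_expR ler_wpM2r//.
  by rewrite (le_trans (ler_norm _))// lerDr.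
- move=> t; under [X in exp_approx X]eq_fun do rewrite mulrDl.
  by apply: exp_approxD => //; exact: mult_class_Lfun2.
Qed.

Lemma mult_classZ a g : mult_class g -> mult_class (fun z => a * g z).
Proof.
move=> h; have [m [A [B [A0 gA]]] ag] := h; split; first exact: measurable_funM.
- exists (`|a| * A), B; split; first exact: mulr_ge0.
  by move=> z; rewrite normrM -mulrA ler_wpM2l.
- move=> t; under [X in exp_approx X]eq_fun do rewrite -mulrA.
  by apply: exp_approxZ => //; exact: mult_class_Lfun2.
Qed.

Lemma multiplierM v1 v2 : multiplier v1 -> multiplier v2 ->
  multiplier (fun z => v1 z * v2 z).
Proof.
move=> h1 h2 g hg; under [X in mult_class X]eq_fun do rewrite -mulrA.
by apply/h1/h2.
Qed.

Lemma multiplierD v1 v2 : multiplier v1 -> multiplier v2 ->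
  multiplier (fun z => v1 z + v2 z).
Proof.
move=> h1 h2 g hg; under [X in mult_class X]eq_fun do rewrite mulrDl.
by apply: mult_classD; [exact: h1|exact: h2].
Qed.

Lemma multiplier_cst a : multiplier (fun=> a).
Proof. by move=> g; exact: mult_classZ. Qed.

Lemma multiplier_measurable v : multiplier v -> measurable_fun setT v.
Proof.
by move=> /(_ _ mult_class1)[]; under [X in measurable_fun _ X]eq_fun do rewrite mulr1.
Qed.

Let expR_sub1_bound (x : R) : `|expR x - 1| <= `|x| * expR `|x|.
Proof.
have h1 := expR_ge1Dx x; have h2 := expR_ge1Dx (- x).
have h3 : expR x - 1 <= x * expR x.
  have := expRxMexpNx_1 x; have := expR_gt0 x; nra.
have [x0|x0] := leP 0 x.
- by rewrite (ger0_norm x0) ger0_norm; lra.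
- rewrite (ltr0_norm x0) ltr0_norm ?subr_lt0 ?expR_lt1// opprB.
  have : 1 <= expR (- x) by rewrite -expR0 ler_expR; lra.
  have := expR_gt0 (- x); nra.
Qed.

Lemma cvg_expR_quotient (z : R) :
  (n.+1%:R * (expR (n.+1%:R^-1 * z) - 1)) @[n --> \oo] --> z.
Proof.
have c1 : z * expR (n.+1%:R^-1 * z) @[n --> \oo] --> z.
  have ce : expR (n.+1%:R^-1 * z) @[n --> \oo] --> expR 0.
    apply: continuous_cvg; first exact: continuous_expR.
    by rewrite -[X in _ --> X](mul0r z); apply: cvgMr_tmp; exact: cvg_harmonic.
  have : z * expR (n.+1%:R^-1 * z) @[n --> \oo] --> z * expR 0 by exact: cvgMl_tmp.
  by rewrite expR0 mulr1.
apply: (@squeeze_cvgr _ _ _ _ (fun=> z)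
  (fun n => z * expR (n.+1%:R^-1 * z))) c1; last exact: cvg_cst.
apply: nearW => n; set x := n.+1%:R^-1 * z.
have -> : z = n.+1%:R * x by rewrite /x mulrA divff ?mul1r// gt_eqF.
have h1 := expR_ge1Dx x; have h2 := expR_ge1Dx (- x).
rewrite ler_pM2l// -mulrA ler_pM2l//; apply/andP; split; first by lra.
have := expRxMexpNx_1 x; have := expR_gt0 x; nra.
Qed.

(** z is the limit of the difference quotients n (e^(z / n) - 1). Multiplying g e^(t z) by such a
    quotient gives a combination of g e^((t + 1/n) z) and g e^(t z), approximable because the class
    allows every t. The quotients are dominated by |z| e^|z| <= e^(2 |z|), whence the 2 in the
    growth rates. *)
Lemma multiplier_id : multiplier (fun z => z).
Proof.
move=> g hg; have [mg [A [B [A0 gA]]] ag] := hg.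
have z_exp (z : R) : `|z| <= expR `|z| by rewrite (le_trans _ (expR_ge1Dx _))// lerDr.
have gz z : `|z * g z| <= A * expR ((B + 2) * `|z|).
  rewrite mulrDl expRD mulrA normrM mulrC ler_pM//.
  by rewrite (le_trans (z_exp z))// ler_expR ler_peMl// ler1n.
split; first exact: measurable_funM.
  by exists A, (B + 2).
move=> t.
pose g_ n z := n.+1%:R * (g z * expR ((t + n.+1%:R^-1) * z)) +
               - n.+1%:R * (g z * expR (t * z)).
have g_E n z : g_ n z = (n.+1%:R * (expR (n.+1%:R^-1 * z) - 1)) * (g z * expR (t * z)).
  by rewrite /g_ mulrDl expRD; ring.
apply: (@exp_approx_lim g_ _ A (B + `|t| + 2)).
- move=> n; apply: measurable_funD; apply: measurable_funM => //;
    exact: measurable_mul_expR.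
- by apply: measurable_mul_expR; exact: measurable_funM.
- move=> n z; apply: le_trans (growth_sqr _ _ A0).
  rewrite g_E normrM (mulrDl _ 2) expRD mulrA mulrC ler_pM//.
    exact: growth_expR.
  rewrite normrM ger0_norm//.
  set x := n.+1%:R^-1 * z.
  have -> : 2 * `|z| = `|z| + `|z| by ring.
  have xz : `|x| <= `|z|.
    by rewrite /x normrM ger0_norm// ler_piMl// invf_le1// ler1n.
  apply: (@le_trans _ _ (n.+1%:R * (`|x| * expR `|x|))).
    by rewrite ler_wpM2l// expR_sub1_bound.
  rewrite mulrA expRD ler_pM ?expR_ge0 ?mulr_ge0// ?ler_expR//.
  rewrite /x normrM ger0_norm// mulrA divff ?mul1r// gt_eqF.
- move=> z; apply: le_trans (growth_sqr _ _ A0).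
  rewrite (_ : B + `|t| + 2 = (B + 2) + `|t|); last by ring.
  exact: (@growth_expR (fun z => z * g z) A (B + 2) t z A0 (gz z)).
- move=> z; under eq_fun do rewrite g_E.
  rewrite -mulrA; apply: cvgMr_tmp; exact: cvg_expR_quotient.
- move=> n; apply: exp_approxD; first exact/Lfun2Z/mult_class_Lfun2.
  + exact/Lfun2Z/mult_class_Lfun2.
  + apply: exp_approxZ => //; exact: mult_class_Lfun2.
  + apply: exp_approxZ => //; exact: mult_class_Lfun2.
Qed.

Let cvg_series_expR (x : R) : series (exp_coeff x) n @[n --> \oo] --> expR x.
Proof. exact: is_cvg_series_exp_coeff. Qed.

Let normr_series_expR (x : R) n : `|series (exp_coeff x) n| <= expR `|x|.
Proof.
apply: (@le_trans _ _ (series (exp_coeff `|x|) n)).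
  rewrite /series/= (le_trans (ler_norm_sum _ _ _))// ler_sum// => k _.
  by rewrite normrM normrX normfV (ger0_norm (ler0n _ _)).
apply: nondecreasing_cvgn_le (is_cvg_series_exp_coeff _) _.
by apply/nondecreasing_seqP => k; rewrite /series/= big_nat_recr//= lerDl exp_coeff_ge0.
Qed.

(** Partial sums of the exponential series are polynomials in v, hence multipliers, and are
    dominated by e^|v|. The two bounds have different roles: the quadratic one keeps e^|v| within
    the growth allowed in the limit, the upper one keeps e^v g of exponential growth, so that it
    stays in the class. *)
Lemma multiplier_expR v (K : R) : multiplier v ->
  (forall z, `|v z| <= u0 * z ^+ 2 + K) -> (forall z, v z <= K) ->
  multiplier (fun z => expR (v z)).
Proof.
move=> mv vK vK' g hg; have [mg [A [B [A0 gA]]] _] := hg.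
have mvv := multiplier_measurable mv.
have mX k : multiplier (fun z => v z ^+ k).
  elim: k => [|k ih]; first exact: multiplier_cst.
  by under [X in multiplier X]eq_fun do rewrite exprS; exact: multiplierM.
have mS n : multiplier (fun z => series (exp_coeff (v z)) n).
  elim: n => [|n ih].
    under [X in multiplier X]eq_fun do rewrite /series/= big_geq//.
    exact: multiplier_cst.
  under [X in multiplier X]eq_fun do rewrite seriesSr.
  by apply: multiplierD => //; apply: multiplierM => //; exact: multiplier_cst.
have me : measurable_fun setT (fun z => expR (v z)) by exact: measurableT_comp.
split; first exact: measurable_funM.
- exists (expR K * A), B; split; first by rewrite mulr_ge0 ?expR_ge0.
  move=> z; rewrite normrM -mulrA ger0_norm ?expR_ge0//.
  by rewrite ler_pM ?expR_ge0// ler_expR.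
move=> t.
have bnd z (y : R) : `|y| <= expR `|v z| ->
    `|y * g z * expR (t * z)| <= expR K * A * expR (u0 * z ^+ 2 + (B + `|t|) * `|z|).
  move=> yv; rewrite -mulrA normrM expRD.
  rewrite (_ : expR K * A * _ = (expR (u0 * z ^+ 2) * expR K) *
    (A * expR ((B + `|t|) * `|z|))); last by ring.
  rewrite ler_pM//; last exact: growth_expR.
  by rewrite (le_trans yv)// -expRD ler_expR.
apply: (@exp_approx_lim (fun n z => series (exp_coeff (v z)) n * g z * expR (t * z))
  _ (expR K * A) (B + `|t|)).
- by move=> n; apply: measurable_mul_expR; have [] := mS n g hg.
- by apply: measurable_mul_expR; exact: measurable_funM.
- by move=> n z; apply: bnd; exact: normr_series_expR.
- by move=> z; apply: bnd; rewrite ger0_norm ?expR_ge0// ler_expR ler_norm.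
- by move=> z; do 2 apply: cvgMr_tmp; exact: cvg_series_expR.
- by move=> n; have [_ _] := mS n g hg; exact.
Qed.

(* These functions lie in ]0, 1], are stable under squaring ([c] becomes
   [c + ln 2]), and approximate indicators of half-lines for large [a]. *)
Definition double_exp (a c z : R) : R := expR (- expR (a * z + c)).

(* [z * expR (- u n * z ^+ 2)] is a bounded multiplier converging to [z], so
   exponentials may be applied to it without leaving the class. *)
Lemma exp_approx_double_exp a c : exp_approx (double_exp a c).
Proof.
pose u n : R := n.+1%:R^-1 * u0.
have u_gt0 n : 0 < u n by rewrite mulr_gt0// invr_gt0.
have u_le n : u n <= u0.
  by rewrite /u ler_piMl ?(ltW u0_gt0)// invf_le1// ler1n.
have uz n z : 0 <= u n * z ^+ 2 by rewrite mulr_ge0 ?sqr_ge0// ltW.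
pose w n (z : R) := z * expR (- u n * z ^+ 2).
have mw n : multiplier (w n).
  apply: multiplierM; first exact: multiplier_id.
  (* The exponent - u n z^2 is unbounded below, but u n <= u0 and it is at most 0, which is what the
     two bounds ask for. *)
  apply: (@multiplier_expR _ 0).
  - apply: multiplierM; first exact: multiplier_cst.
    by under [X in multiplier X]eq_fun do rewrite expr2;
      apply: multiplierM; exact: multiplier_id.
  - move=> z; rewrite addr0 mulNr normrN ger0_norm ?uz//.
    by rewrite ler_wpM2r ?sqr_ge0.
  - by move=> z; rewrite mulNr oppr_le0 uz.
(* By e^x >= 1 + x it suffices that |z| <= (1 + 1/u)(1 + u z^2), whose right-hand side exceeds 1 +
   z^2. *)
have wb n z : `|w n z| <= 1 + (u n)^-1.
  rewrite /w normrM (ger0_norm (expR_ge0 _)) mulNr expRN ler_pdivrMr ?expR_gt0//.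
  apply: (@le_trans _ _ ((1 + (u n)^-1) * (1 + u n * z ^+ 2))); last first.
    by rewrite ler_wpM2l ?expR_ge1Dx// addr_ge0// invr_ge0 ltW.
  have -> : z ^+ 2 = `|z| ^+ 2 by rewrite real_normK ?num_real.
  rewrite (_ : (1 + _) * _ = 1 + u n * `|z| ^+ 2 + (u n)^-1 + `|z| ^+ 2);
    last by field; rewrite gt_eqF.
  have := uz n `|z|.
  have : 0 <= (u n)^-1 by rewrite invr_ge0 ltW.
  have := sqr_ge0 (`|z| - 1); nra.
have bounded_multiplier v (K : R) : multiplier v -> (forall z, `|v z| <= K) ->
    multiplier (fun z => expR (v z)).
  move=> mv vK; apply: (@multiplier_expR _ K) => // z.
    by rewrite (le_trans (vK z))// lerDr mulr_ge0 ?sqr_ge0// ltW.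
  by rewrite (le_trans (ler_norm _)).
have md n : multiplier (fun z => double_exp a c (w n z)).
  have b1 z : `|a * w n z + c| <= `|a| * (1 + (u n)^-1) + `|c|.
    by rewrite (le_trans (ler_normD _ _))// lerD2r normrM ler_wpM2l.
  apply: (@bounded_multiplier _ (expR (`|a| * (1 + (u n)^-1) + `|c|))).
    under [X in multiplier X]eq_fun do rewrite -mulN1r.
    apply: multiplierM; first exact: multiplier_cst.
    apply: (bounded_multiplier _ _ _ b1).
    apply: multiplierD; last exact: multiplier_cst.
    by apply: multiplierM => //; exact: multiplier_cst.
  move=> z; rewrite normrN ger0_norm ?expR_ge0// ler_expR.
  exact: le_trans (ler_norm _) (b1 z).
have d1 z : `|double_exp a c z| <= 1.
  by rewrite ger0_norm ?expR_ge0// expR_le1 oppr_le0 expR_ge0.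
have cd : continuous (double_exp a c).
  move=> z; apply: continuous_comp; last exact: continuous_expR.
  apply: continuousN; apply: continuous_comp; last exact: continuous_expR.
  by apply: continuousD; [apply: continuousM|]; try exact: cst_continuous.
have mdE n : measurable_fun setT (fun z => double_exp a c (w n z)).
  exact: multiplier_measurable.
have e1 z : 1 <= 1 * expR (u0 * z ^+ 2 + 0 * `|z|).
  rewrite mul0r addr0 mul1r -expR0 ler_expR mulr_ge0 ?sqr_ge0//; exact: ltW.
apply: (@exp_approx_lim (fun n z => double_exp a c (w n z)) _ 1 0) => //.
- exact: continuous_measurable_fun.
- by move=> n z; exact: le_trans (d1 _) (e1 z).
- by move=> z; exact: le_trans (d1 _) (e1 z).
- move=> z; apply: continuous_cvg; first exact: cd.
  have ce : expR (- u n * z ^+ 2) @[n --> \oo] --> expR 0.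
    apply: continuous_cvg; first exact: continuous_expR.
    rewrite -[X in _ --> X](mul0r (z ^+ 2)); apply: cvgMr_tmp.
    rewrite -[X in _ --> X]oppr0; apply: cvgN.
    by rewrite -[X in _ --> X](mul0r u0); apply: cvgMr_tmp; exact: cvg_harmonic.
  have : w n z @[n --> \oo] --> z * expR 0 by exact: cvgMl_tmp.
  by rewrite expR0 mulr1.
- move=> n e e0; have [_ _ /(_ 0 e e0) [r Hr]] := md n _ mult_class1; exists r.
  by move: Hr; under eq_Rintegral do rewrite mulr1 mul0r expR0 mulr1.
Qed.

End exponential_density.

(** * Normal means of double exponentials *)

Section normal_standard.
Context (R : realType).
Implicit Types m s x : R.

Lemma normal_pdf_standard m s x : 0 < s ->
  normal_pdf m s (s * x + m) * s = normal_pdf 0 1 x.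
Proof.
move=> s0; have sn0 : s != 0 by rewrite gt_eqF.
rewrite (normal_pdf_peak _ _ sn0) (normal_pdf_peak _ _ (oner_neq0 _)).
rewrite mulrAC; congr (_ * _).
  rewrite /normal_peak expr1n mul1r -mulrnAr sqrtrM ?sqr_ge0// sqrtr_sqr gtr0_norm//.
  by rewrite invfM -mulrA mulrC -mulrA mulfV// mulr1.
by rewrite /normal_fun; congr expR; field.
Qed.

Lemma Rintegral_normal_standard m s (f : R -> R) : 0 < s ->
  continuous f -> (forall x, 0 <= f x) ->
  \int[normal_prob m s]_x f x = \int[normal_prob 0 1]_x f (s * x + m).
Proof.
move=> s0 cf f0; have sn0 : s != 0 by rewrite gt_eqF.
have mf : measurable_fun setT f by exact: continuous_measurable_fun.
have caff : continuous (fun x => s * x + m).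
  by move=> x; apply: cvgD; [apply: cvgMl_tmp; exact: cvg_id|exact: cvg_cst].
have daff x : is_derive x 1 (fun x => s * x + m) s.
  by apply: is_derive_eq; rewrite ?addr0 ?scaler1.
have Daff : ((fun x : R^o => s * x + m)^`())%classic = cst s.
  by apply/funext => x; rewrite derive1E; exact: derive_val.
have mg : measurable_fun setT (fun x => f (s * x + m)).
  by apply: (measurableT_comp mf); exact: continuous_measurable_fun.
have E1 := @ge0_integral_normal_prob R m s setT (EFin \o f) measurableT
  ((measurable_EFinP _ _).2 mf) f0.
have E2 := @ge0_integral_normal_prob R 0 1 setT (EFin \o (fun x => f (s * x + m)))
  measurableT ((measurable_EFinP _ _).2 mg) (fun x => f0 _).
apply: (congr1 fine); apply: (etrans E1); apply: (etrans _ (esym E2)).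
under eq_integral do rewrite -EFinM.
rewrite (@increasing_ge0_integration_by_substitutionT R (fun x : R^o => s * x + m)
  (fun x => f x * normal_pdf m s x)).
- apply: eq_integral => x _; rewrite Daff/= -EFinM; congr EFin.
  by rewrite fctE/= -mulrA normal_pdf_standard.
- by move=> x y xy; rewrite ltrD2r ltr_pM2l.
- by rewrite Daff => ?; exact: cvg_cst.
- by rewrite Daff; exact: is_cvg_cst.
- by rewrite Daff; exact: is_cvg_cst.
- by [].
- apply: (@cvg_comp _ _ _ (fun r => s * r) (fun r => r + m)) (cvg_addrr_Ny m).
  exact: gt0_cvgMrNy.
- apply: (@cvg_comp _ _ _ (fun r => s * r) (fun r => r + m)) (cvg_addrr m).
  exact: gt0_cvgMry.
- by move=> x; apply: cvgM; [exact: cf|exact: continuous_normal_pdf].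
- by move=> x; rewrite mulr_ge0// normal_pdf_ge0.
Qed.

End normal_standard.

Section double_exp.
Context (R : realType).
Implicit Types a b c x y z : R.

Lemma double_exp_ge0 a c z : 0 <= double_exp a c z.
Proof. exact: expR_ge0. Qed.

Lemma double_exp_le1 a c z : double_exp a c z <= 1.
Proof. by rewrite expR_le1 oppr_le0 expR_ge0. Qed.

Lemma normr_double_exp_le1 a c z : `|double_exp a c z| <= 1.
Proof. by rewrite ger0_norm ?double_exp_ge0 ?double_exp_le1. Qed.

Lemma continuous_double_exp a c : continuous (double_exp a c).
Proof.
move=> z; apply: continuous_comp; last exact: continuous_expR.
apply: continuousN; apply: continuous_comp; last exact: continuous_expR.
by apply: continuousD; [apply: continuousM|]; try exact: cst_continuous.
Qed.

Lemma measurable_double_exp a c : measurable_fun setT (double_exp a c).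
Proof. by apply: continuous_measurable_fun; exact: continuous_double_exp. Qed.

Lemma double_exp_affine a c x b z :
  double_exp a c (x * z + b) = double_exp (a * x) (a * b + c) z.
Proof. by rewrite /double_exp mulrDr addrA mulrA. Qed.

Lemma double_exp_sqr a c z : double_exp a c z ^+ 2 = double_exp a (c + ln 2) z.
Proof.
rewrite /double_exp -expRM_natl addrA (expRD _ (ln 2)) lnK ?posrE//.
by congr expR; ring.
Qed.

(** For u <= v, e^(- e^u) - e^(- e^v) <= e^(- e^u) (e^v - e^u), and e^u e^(- e^u) <= 1 leaves e^(v -
    u) - 1. The bound depends on y - z alone, so a deterministic drift can be replaced by its limit
    uniformly over the sample. *)
Lemma double_exp_lipschitz a c y z :
  `|double_exp a c y - double_exp a c z| <= expR (`|a| * `|y - z|) - 1.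
Proof.
have key (u v : R) : u <= v -> expR (- expR u) - expR (- expR v) <= expR (v - u) - 1.
  move=> uv.
  have h1 : expR u * expR (- expR u) <= 1.
    rewrite -[leRHS](expRxMexpNx_1 (expR u)) ler_wpM2r ?expR_ge0//.
    by rewrite (le_trans _ (expR_ge1Dx _))// lerDr.
  have h2 : expR (- expR v) = expR (- expR u) * expR (- (expR v - expR u)).
    by rewrite -expRD; congr expR; ring.
  have h3 := expR_ge1Dx (- (expR v - expR u)).
  have h4 : expR v = expR u * expR (v - u) by rewrite -expRD; congr expR; ring.
  have h5 : 1 <= expR (v - u) by rewrite -expR0 ler_expR subr_ge0.
  rewrite h2; have h6 := expR_gt0 (- expR u); set e := expR (- expR u) in h1 h6 *.
  apply: (@le_trans _ _ (e * (expR v - expR u))); first by nra.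
  by rewrite h4; nra.
have mono (u v : R) : u <= v -> expR (- expR v) <= expR (- expR u).
  by move=> uv; rewrite ler_expR lerN2 ler_expR.
have E : a * y + c - (a * z + c) = a * (y - z) by ring.
rewrite -normrM -E /double_exp.
set u := a * y + c; set v := a * z + c.
have [uv|vu] := leP u v.
- have -> : `|u - v| = v - u by rewrite distrC ger0_norm ?subr_ge0.
  by rewrite ger0_norm ?subr_ge0 ?mono// key.
- have -> : `|u - v| = u - v by rewrite gtr0_norm ?subr_gt0.
  by rewrite distrC ger0_norm ?subr_ge0 ?mono ?key// ltW.
Qed.

Lemma Rintegral_normal_double_exp b s a c : 0 < s ->
  \int[normal_prob b s]_x double_exp a c x =
  \int[normal_prob 0 1]_x double_exp (a * s) (a * b + c) x.
Proof.
move=> s0.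
apply: (etrans (Rintegral_normal_standard b s0 (@continuous_double_exp a c)
  (double_exp_ge0 a c))).
by apply: eq_Rintegral => x _; rewrite double_exp_affine.
Qed.

(** Standardization moves the varying mean from the measure into the integrand, where dominated
    convergence applies. *)
Lemma cvg_double_exp_mean (b_ : nat -> R) b s a c : 0 < s ->
  b_ n @[n --> \oo] --> b ->
  \int[normal_prob (b_ n) s]_x double_exp a c x @[n --> \oo] -->
  \int[normal_prob b s]_x double_exp a c x.
Proof.
move=> s0 bb; rewrite (Rintegral_normal_double_exp _ _ _ s0).
have -> : (fun n => \int[normal_prob (b_ n) s]_x double_exp a c x) =
    (fun n => \int[normal_prob 0 1]_x double_exp (a * s) (a * b_ n + c) x).
  by apply/funext => n; exact: Rintegral_normal_double_exp.
apply: (@Rintegral_dominated_cvg _ _ R (normal_prob 0 1)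
  (fun n => double_exp (a * s) (a * b_ n + c)) _ (cst 1)).
- by move=> n; exact: measurable_double_exp.
- exact: measurable_double_exp.
- move=> x; apply: continuous_cvg; first exact: continuous_expR.
  apply: cvgN; apply: continuous_cvg; first exact: continuous_expR.
  apply: cvgD; first exact: cvg_cst.
  by apply: cvgD; [exact: cvgMl_tmp|exact: cvg_cst].
- exact: finite_measure_integrable_cst.
- by move=> n x; exact: normr_double_exp_le1.
Qed.

End double_exp.

(** * The limit law under local alternatives *)

Section linear_combination.
Context d (T : measurableType d) (R : realType).
Variable mu : {measure set T -> \bar R}.
Context (I : Type) (c : I -> R) (g : I -> T -> R).
Hypothesis g2 : forall i, g i \in Lfun mu 2%:E.

Lemma Lfun2_lincomb (r : seq I) :
  (fun x => \sum_(i <- r) c i * g i x) \in Lfun mu 2%:E.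
Proof. by apply: Lfun2_sum => i; exact: Lfun2Z. Qed.

Lemma Rintegral_mul_lincomb (r : seq I) f : f \in Lfun mu 2%:E ->
  \int[mu]_x (f x * \sum_(i <- r) c i * g i x) =
  \sum_(i <- r) c i * \int[mu]_x (f x * g i x).
Proof.
move=> f2; elim: r => [|i r ih].
  rewrite big_nil; under eq_Rintegral do rewrite big_nil mulr0.
  by rewrite /Rintegral integral0.
rewrite big_cons -ih; under eq_Rintegral => x _.
  rewrite big_cons (_ : _ * _ = c i * (f x * g i x) + f x * \sum_(i <- r) c i * g i x);
    last by ring.
over.
have ig := integrable_Lfun2M f2 (g2 i).
rewrite RintegralD//.
- by rewrite RintegralZl.
- exact: (integrableZl measurableT (c i) ig).
- by apply: integrable_Lfun2M => //; exact: Lfun2_lincomb.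
Qed.

Lemma Rintegral_sqr_sub_lincomb (r : seq I) f : f \in Lfun mu 2%:E ->
  \int[mu]_x ((f x - \sum_(i <- r) c i * g i x) ^+ 2) =
  \int[mu]_x (f x ^+ 2) - 2 * (\sum_(i <- r) c i * \int[mu]_x (f x * g i x)) +
  \sum_(i <- r) c i * \sum_(j <- r) c j * \int[mu]_x (g i x * g j x).
Proof.
move=> f2; have S2 := Lfun2_lincomb r.
have := Rintegral_sqrZD (-1) f2 S2.
under eq_Rintegral do rewrite mulN1r; move=> ->.
rewrite Rintegral_mul_lincomb// mulrN1 mulNr sqrrN expr1n mul1r; congr (_ + _).
under eq_Rintegral do rewrite expr2.
rewrite Rintegral_mul_lincomb//; apply: eq_bigr => i _; congr (_ * _).
by under eq_Rintegral do rewrite mulrC; rewrite Rintegral_mul_lincomb.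
Qed.

End linear_combination.

Lemma cvg_seq_sum (R : realType) (I : Type) (r : seq I) (u : nat -> I -> R) (l : I -> R) :
  (forall i, u n i @[n --> \oo] --> l i) ->
  (\sum_(i <- r) u n i) @[n --> \oo] --> \sum_(i <- r) l i.
Proof.
move=> ul; elim: r => [|i r ih].
  by rewrite big_nil; under eq_fun do rewrite big_nil; exact: cvg_cst.
by rewrite big_cons; under eq_fun do rewrite big_cons; exact: cvgD.
Qed.

Lemma cvg_of_sub0 (R : realType) (u : nat -> R) (l : R) :
  (u n - l) @[n --> \oo] --> (0 : R) -> u n @[n --> \oo] --> l.
Proof.
by move=> /cvgr0Pnorm_lt H; apply/cvgrPdistC_lt => e e0; exact: H.
Qed.

Lemma cvg_sub0_trans (R : realType) (u v : nat -> R) (l : R) :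
  (u n - v n) @[n --> \oo] --> (0 : R) -> v n @[n --> \oo] --> l ->
  u n @[n --> \oo] --> l.
Proof.
move=> uv vl; have : (u n - v n) + v n @[n --> \oo] --> 0 + l by exact: cvgD.
by rewrite add0r (_ : (fun n => u n - v n + v n) = u)//; apply/funext => n; rewrite subrK.
Qed.

Section asymptotic_representation.
Context d (X : measurableType d) (R : realType).
Variables (P : probability X R) (psi : X -> R) (s : R).
Variable Z : forall n, n.-tuple X -> R.
Hypotheses (psi2 : psi \in Lfun P 2%:E) (psi0 : \int[P]_x psi x = 0).
Hypotheses (s0 : 0 < s) (psis : \int[P]_x (psi x ^+ 2) = s ^+ 2).
Hypothesis mZ : forall n, measurable_fun setT (@Z n).
Local Notation G := (normal_prob 0 s).
Hypothesis cvgZ : forall a c t,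
  (\int[prodn P n]_x (double_exp a c (Z x) * lik (fun y => t * psi y) x)) @[n --> \oo]
  --> \int[normal_prob (t * s ^+ 2) s]_z double_exp a c z.

Let sn0 : s != 0. Proof. by rewrite gt_eqF. Qed.

(** The density of N(t s^2, s^2) with respect to [G]. Its pairings [eM] are the limits [lik_psi_psi]
    of the pairings of the products for p psi and q psi. *)
Let e t (z : R) := expR (t * z - t ^+ 2 * s ^+ 2 / 2).

Let eE t z : e t z = expR (- (t ^+ 2 * s ^+ 2 / 2)) * expR (t * z).
Proof. by rewrite -expRD; congr expR; ring. Qed.

Let e2 t : e t \in Lfun G 2%:E.
Proof.
rewrite (_ : e t = fun z => expR (- (t ^+ 2 * s ^+ 2 / 2)) * expR (t * z)).
  by apply: Lfun2Z; exact: Lfun2_expR.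
by apply/funext => z; exact: eE.
Qed.

Let eM p q : \int[G]_z (e p z * e q z) = expR (p * q * s ^+ 2).
Proof.
rewrite (_ : _ * _ * _ = - (p ^+ 2 * s ^+ 2 / 2) - (q ^+ 2 * s ^+ 2 / 2)
  + (p + q) ^+ 2 * s ^+ 2 / 2); last by field.
rewrite expRD -(Rintegral_normal_expR (p + q) sn0) -RintegralZl//; last first.
  by apply: Lfun2_integrable; exact: Lfun2_expR.
by apply: eq_Rintegral => z _; rewrite -!expRD; congr expR; ring.
Qed.

Let Fe a c t : \int[G]_z (double_exp a c z * e t z) =
  \int[normal_prob (t * s ^+ 2) s]_z double_exp a c z.
Proof.
by apply: esym; apply: Rintegral_normal_shift => //; exact: measurable_double_exp.
Qed.

Let psiZ2 t : (fun y => t * psi y) \in Lfun P 2%:E.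
Proof. exact: Lfun2Z. Qed.

Let psiZ0 t : \int[P]_y (t * psi y) = 0.
Proof. by rewrite RintegralZl ?psi0 ?mulr0//; exact: Lfun2_integrable. Qed.

Let FZ2 a c n : (fun x : n.-tuple X => double_exp a c (Z x)) \in Lfun (prodn P n) 2%:E.
Proof.
apply: (@Lfun2_bounded_prob _ _ _ _ _ 1); last by move=> x; exact: normr_double_exp_le1.
apply: (@measurableT_comp _ _ _ _ _ _ (double_exp a c) _ (@Z n)).
  exact: measurable_double_exp.
exact: mZ.
Qed.

Let lik_psi_psi p q :
  (\int[prodn P n]_x (lik (fun y => p * psi y) x * lik (fun y => q * psi y) x))
  @[n --> \oo] --> expR (p * q * s ^+ 2).
Proof.
have := cvg_Rintegral_likM (psiZ2 p) (psiZ2 q) (psiZ0 p) (psiZ0 q).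
rewrite (_ : \int[P]_x _ = p * q * s ^+ 2)//.
rewrite -psis -RintegralZl//; last exact: integrable_Lfun2X.
by apply: eq_Rintegral => y _; ring.
Qed.

Let lik_psi h t : h \in Lfun P 2%:E -> \int[P]_x h x = 0 ->
  (\int[prodn P n]_x (lik h x * lik (fun y => t * psi y) x))
  @[n --> \oo] --> expR (t * \int[P]_x (psi x * h x)).
Proof.
move=> h2 h0; have := cvg_Rintegral_likM h2 (psiZ2 t) h0 (psiZ0 t).
rewrite (_ : \int[P]_x _ = t * \int[P]_x (psi x * h x))//.
rewrite -RintegralZl//; last exact: integrable_Lfun2M.
by apply: eq_Rintegral => y _; ring.
Qed.

(* Let S be a combination of exponentials close to f = [double_exp a c] in L2 of
   N(0, s^2), and S_n the same combination of the [lik (t psi)]. The limits of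
   E f(Z)^2, E f(Z) S_n and E S_n^2 show that S_n is asymptotically as close to
   f(Z) in L2, so that f(Z) may be replaced by S_n in E f(Z) lik h, whose limit
   is explicit. *)
Lemma cvg_double_exp_lik a c h : h \in Lfun P 2%:E -> \int[P]_x h x = 0 ->
  (\int[prodn P n]_x (double_exp a c (Z x) * lik h x)) @[n --> \oo]
  --> \int[normal_prob (\int[P]_x (psi x * h x)) s]_z double_exp a c z.
Proof.
move=> h2 h0; set b := \int[P]_x (psi x * h x).
(* N(b, s^2) is the limit law in direction tau psi, and [e tau] pairs with [e t] to e^(t b), the
   limiting pairing of the products for h and t psi. *)
pose tau := b / s ^+ 2.
have bE : b = tau * s ^+ 2 by rewrite /tau divfK// expf_neq0.
rewrite bE -Fe.
pose f := double_exp a c.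
have f2 : f \in Lfun G 2%:E.
  apply: (@Lfun2_bounded_prob _ _ _ G _ 1); first exact: measurable_double_exp.
  by move=> x; exact: normr_double_exp_le1.
set N := \int[P]_x (h x * h x).
(* The three summands weight the bounds [A1], [A2], [A3] on the squares of successive differences;
   the 3 is that of [sqr_sum3]. *)
pose C := 3 * (2 * (expR N + 1) + 1 + expR (tau * tau * s ^+ 2)).
have C0 : 0 <= C by rewrite mulr_ge0// !addr_ge0 ?expR_ge0// mulr_ge0// addr_ge0 ?expR_ge0.
suff : (\int[prodn P n]_x (double_exp a c (Z x) * lik h x) -
    \int[G]_z (double_exp a c z * e tau z)) @[n --> \oo] --> (0 : R).
  exact: cvg_of_sub0.
apply: (cvg0_approx C0) => eps eps0.
have [r Hr] := exp_approx_double_exp s0 a c eps0.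
(* The extra factor undoes the normalization in [e], so that the same coefficients express
   [expsum r] through the likelihood ratios. *)
pose co (p : R * R) := p.1 * expR (p.2 ^+ 2 * s ^+ 2 / 2).
pose S' z := \sum_(p <- r) co p * e p.2 z.
have SE : S' = expsum r.
  apply/funext => z; apply: eq_bigr => p _; rewrite eE /co.
  by rewrite mulrACA -!mulrA -!expRD; congr (_ * expR _); ring.
pose S n (x : n.-tuple X) := \sum_(p <- r) co p * lik (fun y => p.2 * psi y) x.
have l2 n t := Lfun2_lik n (psiZ2 t).
have lh2 n := Lfun2_lik n h2.
have S2 n : @S n \in Lfun (prodn P n) 2%:E.
  exact: (@Lfun2_lincomb _ _ _ _ _ co _ (fun p : R * R => l2 n p.2) r).
have S'2 : S' \in Lfun G 2%:E.
  exact: (@Lfun2_lincomb _ _ _ _ _ co _ (fun p : R * R => e2 p.2) r).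
have c1 : (\int[prodn P n]_x ((f (Z x) - S n x) ^+ 2)) @[n --> \oo] -->
    \int[G]_z ((f z - S' z) ^+ 2).
  rewrite (Rintegral_sqr_sub_lincomb _ (fun p : R * R => e2 p.2))//.
  have En n := @Rintegral_sqr_sub_lincomb _ _ _ (prodn P n) _ co _
    (fun p : R * R => l2 n p.2) r _ (FZ2 a c n).
  rewrite (funext En).
  apply: cvgD.
    apply: cvgB.
      have -> : \int[G]_z (f z ^+ 2) = \int[G]_z double_exp a (c + ln 2) z.
        by apply: eq_Rintegral => z _; exact: double_exp_sqr.
      (* At t = 0 the product is identically 1, and f^2 is a double exponential with another c, so
         the second moment is covered by the hypothesis. *)
      have := @cvgZ a (c + ln 2) 0; rewrite mul0r.
      apply: cvg_trans; apply: near_eq_cvg; apply: nearW => n.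
      apply: eq_Rintegral => x _; rewrite double_exp_sqr /lik big1 ?mulr1// => i _.
      by rewrite mul0r mulr0 addr0.
    apply: cvgMl_tmp; apply: cvg_seq_sum => p; apply: cvgMl_tmp; rewrite Fe.
    exact: cvgZ.
  apply: cvg_seq_sum => p; apply: cvgMl_tmp; apply: cvg_seq_sum => q.
  by apply: cvgMl_tmp; rewrite eM; exact: lik_psi_psi.
have c2 : (\int[prodn P n]_x (lik h x * S n x)) @[n --> \oo] -->
    \int[G]_z (e tau z * S' z).
  rewrite (Rintegral_mul_lincomb _ (fun p : R * R => e2 p.2))//.
  have En n := @Rintegral_mul_lincomb _ _ _ (prodn P n) _ co _
    (fun p : R * R => l2 n p.2) r _ (lh2 n).
  rewrite (funext En).
  apply: cvg_seq_sum => p; apply: cvgMl_tmp; rewrite eM.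
  by rewrite (mulrC tau) -mulrA -bE; exact: lik_psi.
have c3 := cvg_Rintegral_likM h2 h2 h0 h0.
rewrite -SE in Hr.
have eps2 : \int[G]_z ((f z - S' z) ^+ 2) < 2 * eps by lra.
have n1 := @cvgr_lt _ _ _ _ _ _ c1 _ eps2.
have N1 : expR N < expR N + 1 by rewrite ltrDl.
have n3 := @cvgr_lt _ _ _ _ _ _ c3 _ N1.
have e1 : 0 < Num.sqrt eps by rewrite sqrtr_gt0.
have n2 := (@cvgrPdist_lt _ _ _ _ _ _ _).1 c2 _ e1.
near=> n.
have H1 : \int[prodn P n]_x ((f (Z x) - S n x) ^+ 2) < 2 * eps.
  by near: n; exact: n1.
have H3 : \int[prodn P n]_x (lik h x * lik h x) < expR N + 1.
  by near: n; exact: n3.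
have H2 : `|\int[G]_z (e tau z * S' z) - \int[prodn P n]_x (lik h x * S n x)| < Num.sqrt eps.
  by near: n; exact: n2.
have i1 := integrable_Lfun2M (FZ2 a c n) (lh2 n).
have i2 := integrable_Lfun2M (lh2 n) (S2 n).
have i3 := integrable_Lfun2M f2 (e2 tau).
have i4 := integrable_Lfun2M (e2 tau) S'2.
have A1 : (\int[prodn P n]_x (f (Z x) * lik h x) - \int[prodn P n]_x (lik h x * S n x)) ^+ 2
    <= 2 * eps * (expR N + 1).
  rewrite -RintegralB//.
  rewrite (@eq_Rintegral _ _ _ _ _ (fun x => (f (Z x) - S n x) * lik h x)); last first.
    by move=> x _; ring.
  apply: (le_trans (cauchy_schwarz (Lfun2B (FZ2 a c n) (S2 n)) (lh2 n))).
  rewrite ler_pM ?Rintegral_sqr_ge0 ?(ltW H1)//.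
  by apply: ltW; move: H3; under eq_Rintegral do rewrite -expr2.
have A3 : (\int[G]_z (e tau z * S' z) - \int[G]_z (f z * e tau z)) ^+ 2
    <= eps * expR (tau * tau * s ^+ 2).
  rewrite -sqrrN opprB -RintegralB//.
  have -> : \int[G]_z (f z * e tau z - e tau z * S' z) =
      \int[G]_z ((f z - S' z) * e tau z).
    by apply: eq_Rintegral => z _; ring.
  apply: (le_trans (cauchy_schwarz (Lfun2B f2 S'2) (e2 tau))).
  rewrite ler_pM ?Rintegral_sqr_ge0//.
  by under eq_Rintegral do rewrite expr2; rewrite eM.
have A2 : (\int[prodn P n]_x (lik h x * S n x) - \int[G]_z (e tau z * S' z)) ^+ 2 <= eps.
  rewrite -[leRHS]sqr_sqrtr ?(ltW eps0)// -[leLHS]real_normK ?num_real//.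
  by rewrite lerXn2r ?nnegrE ?sqrtr_ge0// distrC ltW.
set I1 := \int[prodn P n]_x (f (Z x) * lik h x) in A1 *.
set I2 := \int[prodn P n]_x (lik h x * S n x) in A1 A2 *.
set I3 := \int[G]_z (e tau z * S' z) in A2 A3 *.
set I4 := \int[G]_z (f z * e tau z) in A3 *.
rewrite -/f (_ : _ - _ = (I1 - I2) + (I2 - I3) + (I3 - I4)); last by ring.
apply: (le_trans (sqr_sum3 _ _ _)); rewrite /C; nra.
Unshelve. all: by end_near. Qed.

End asymptotic_representation.

Lemma gauss0_sqr (R : realType) (s : R) : 0 < s ->
  gauss0 (s ^+ 2) = normal_prob 0 s :> probability (measurableTypeR R) R.
Proof.
move=> s0; rewrite /gauss0 ifF; last by apply/negbTE; rewrite expf_neq0// gt_eqF.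
by rewrite sqrtr_sqr gtr0_norm.
Qed.

(** * From the efficient directions to all tangent directions *)

Section limit_law.
Context d (X : measurableType d) (R : realType).
Variables (calP : set (probability X R)) (P : probability X R).
Variables (T V : set (L2 P)) (Psi : probability X R -> R) (gamma : L2 P -> R).
Variables (psi : L2 P) (Tn : forall n, {mfun n.-tuple X >-> R}) (s : R).
Hypotheses (T0 : T `<=` mean_zero P) (Tassum : assumption1 calP T).
Hypothesis diffPsi : dir_pathwise_differentiable calP T Psi gamma.
Hypothesis linV : linearity_subspace T gamma V.
Hypothesis rieszV : riesz_representer V gamma psi.
Hypothesis effV : V_efficient calP V psi Psi Tn.
Hypotheses (s0 : 0 < s) (spsi : s ^+ 2 = L2norm psi ^+ 2).

Lemma L2_sub_apply (f g : L2 P) x : (f - g) x = f x - g x.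
Proof. by []. Qed.

Definition centered n (x : n.-tuple X) : R := Num.sqrt n%:R * (Tn n x - Psi P).
Local Notation Z := centered.

Lemma measurable_centered n : measurable_fun setT (@centered n).
Proof. by apply: measurable_funM => //; exact: measurable_funB. Qed.

Let measurable_double_exp_centered a c n :
  measurable_fun setT (fun x : n.-tuple X => double_exp a c (Z x)).
Proof.
apply: (@measurableT_comp _ _ _ _ _ _ (double_exp a c) _ (@centered n)).
  exact: measurable_double_exp.
exact: measurable_centered.
Qed.

Lemma cvg_Psi_drift h path : T h -> dqm_path calP h path ->
  (Num.sqrt n%:R * (Psi (local_law path n) - Psi P)) @[n --> \oo] --> gamma h.
Proof.
move=> Th dqm; have := (diffPsi.2 h path Th dqm).
move=> /(cvg_comp _ _ (@cvg_inv_sqrtn_right R)).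
by apply: cvg_trans; apply: near_eq_cvg; apply: nearW => n /=; rewrite invrK.
Qed.

(** V-efficiency centers T_n at Psi(P_{n,g}), [Z] at Psi(P). The difference is the deterministic
    drift [r n], whose limit gamma(g) becomes the mean of the limit law. *)
Lemma cvg_law_linear g path a c : V g -> dqm_path calP g path ->
  (\int[prodn (local_law path n) n]_x double_exp a c (Z x)) @[n --> \oo] -->
  \int[normal_prob (gamma g) s]_z double_exp a c z.
Proof.
move=> Vg dqm; have [_ VT _] := linV.
set b := gamma g.
pose r n : R := Num.sqrt n%:R * (Psi (local_law path n) - Psi P).
have cr : r n @[n --> \oo] --> b by apply: cvg_Psi_drift dqm; exact: VT.
pose Y n (x : n.-tuple X) : R := Num.sqrt n%:R * (Tn n x - Psi (local_law path n)).
have ZE n (x : n.-tuple X) : Z x = Y n x + r n by rewrite /Z /Y /r; ring.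
(* This f is the double exponential with parameters a, c translated by b, so its mean under N(0,
   s^2) is the wanted mean under N(b, s^2). *)
pose f := double_exp a (a * b + c).
have cY : (\int[prodn (local_law path n) n]_x f (Y n x)) @[n --> \oo] -->
    \int[normal_prob b s]_z double_exp a c z.
  have bf : bounded_fun f.
    exists 1; split; first exact: num_real.
    by move=> M M1 x _ /=; rewrite (le_trans (normr_double_exp_le1 _ _ _))// ltW.
  have := effV Vg dqm (@continuous_double_exp R a (a * b + c)) bf.
  rewrite -spsi (gauss0_sqr s0).
  have -> : \int[normal_prob b s]_z double_exp a c z = \int[normal_prob 0 s]_z f z.
    apply: (etrans (Rintegral_normal_double_exp b a c s0)); apply: esym.
    by apply: (etrans (Rintegral_normal_double_exp 0 _ _ s0)); rewrite mulr0 add0r.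
  exact: id.
have mY n : measurable_fun setT (Y n) by apply: measurable_funM => //; exact: measurable_funB.
have mfY n : measurable_fun setT (fun x => f (Y n x)).
  apply: (@measurableT_comp _ _ _ _ _ _ f _ (Y n)); last exact: mY.
  exact: measurable_double_exp.
have cdiff : (expR (`|a| * `|r n - b|) - 1) @[n --> \oo] --> (0 : R).
  rewrite -[X in _ --> X](subrr 1); apply: cvgB; last exact: cvg_cst.
  rewrite -[X in _ --> X]expR0; apply: continuous_cvg; first exact: continuous_expR.
  rewrite -[X in _ --> X](mulr0 `|a|); apply: cvgMl_tmp.
  rewrite -[X in _ --> X](normr0 R) -(subrr b); apply: cvg_norm.
  by apply: cvgB => //; exact: cvg_cst.
have H : (\int[prodn (local_law path n) n]_x double_exp a c (Z x) -
    \int[prodn (local_law path n) n]_x f (Y n x)) @[n --> \oo] --> (0 : R).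
  apply/cvgr0Pnorm_lt => e e0; have /cvgr0Pnorm_lt/(_ _ e0) := cdiff.
  apply: filterS => n Hn; apply: le_lt_trans Hn.
  rewrite -RintegralB//; last 2 first.
  - apply: (@integrable_bounded _ _ _ (prodn (local_law path n) n) _ 1).
      exact: measurable_double_exp_centered.
    by move=> x; exact: normr_double_exp_le1.
  - apply: (@integrable_bounded _ _ _ (prodn (local_law path n) n) _ 1).
      exact: mfY.
    by move=> x; exact: normr_double_exp_le1.
  rewrite (le_trans _ (ler_norm _))//.
  apply: (@normr_Rintegral_le _ _ _ (prodn (local_law path n) n)).
    by apply: measurable_funB; [exact: measurable_double_exp_centered|exact: mfY].
  have fE y : f y = double_exp a c (y + b).
    by rewrite /f /double_exp; congr (expR (- expR _)); ring.
  move=> x; rewrite fE ZE.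
  have := double_exp_lipschitz a c (Y n x + r n) (Y n x + b).
  by rewrite (_ : Y n x + r n - (Y n x + b) = r n - b); last ring.
exact: cvg_sub0_trans H cY.
Qed.

Lemma L2norm_ge0 (f : L2 P) : 0 <= L2norm f.
Proof. by rewrite /L2norm fine_ge0// Lnorm_ge0. Qed.

Lemma sub_L2closure (A : set (L2 P)) : A `<=` L2closure A.
Proof.
move=> f Af e e0; exists f => //; rewrite (_ : L2norm _ = 0)//.
apply/eqP; rewrite -sqrf_eq0 L2normE.
under eq_Rintegral do rewrite L2_sub_apply subrr expr0n.
by rewrite Rintegral_prob_cst.
Qed.

Lemma L2closureS (A B : set (L2 P)) : A `<=` B -> L2closure A `<=` L2closure B.
Proof. by move=> AB f Af e e0; have [g Ag ge] := Af e e0; exists g => //; exact: AB. Qed.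

(** The representer is given in the closure of V only; closedness of T places it in T, which makes
    it centered. *)
Lemma T_representer : T psi.
Proof.
have [_ VT _] := linV.
by apply: Tassum.1; apply: (L2closureS VT); exact: rieszV.1.
Qed.

Lemma gamma_representer h : V h -> gamma h = dot psi h.
Proof.
move=> Vh; have [_ [ext [extV _ extc]]] := rieszV.
by rewrite -extV// extc//; exact: sub_L2closure.
Qed.

Lemma approx_representer : exists2 v_ : nat -> L2 P, (forall j, V (v_ j)) &
  (\int[P]_x ((psi x - v_ j x) ^+ 2)) @[j --> \oo] --> (0 : R).
Proof.
have H j : exists g, V g /\ L2norm (g - psi) < j.+1%:R^-1.
  by have [|g Vg gj] := rieszV.1 (j.+1%:R^-1); [rewrite invr_gt0|exists g].
have /choice[v_ Hv] := H; exists v_ => [j|]; first exact: (Hv j).1.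
apply: (@squeeze_cvgr _ _ _ _ (fun=> 0) (fun n : nat => n.+1%:R^-1 * n.+1%:R^-1)).
- apply: nearW => j; rewrite Rintegral_sqr_ge0/=.
  have -> : \int[P]_x ((psi x - v_ j x) ^+ 2) = L2norm (v_ j - psi) ^+ 2.
    rewrite L2normE; apply: eq_Rintegral => x _.
    by rewrite L2_sub_apply -sqrrN opprB.
  by rewrite -expr2 lerXn2r ?nnegrE ?L2norm_ge0// ltW// (Hv j).2.
- exact: cvg_cst.
- by rewrite -[X in _ --> X](mulr0 0); apply: cvgM; exact: cvg_harmonic.
Qed.

Let mean0 h : T h -> \int[P]_x h x = 0.
Proof. exact: T0. Qed.

Let psi0 : \int[P]_x psi x = 0. Proof. exact/mean0/T_representer. Qed.

Let psis : \int[P]_x (psi x ^+ 2) = s ^+ 2. Proof. by rewrite spsi L2normE. Qed.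

(** No path appears in the conclusion: Assumption 1 supplies one with score g, on which V-efficiency
    is read and then transferred to P. *)
Lemma cvg_lik_linear g a c : V g ->
  (\int[prodn P n]_x (double_exp a c (Z x) * lik g x)) @[n --> \oo] -->
  \int[normal_prob (gamma g) s]_z double_exp a c z.
Proof.
move=> Vg; have [_ VT _] := linV.
have [path dqm] := Tassum.2 g (VT _ Vg).
have H1 := @cvg_law_linear g path a c Vg dqm.
have H2 := @cvg_local_lik _ _ _ calP P g path (fun n x => double_exp a c (Z x)) 1
  (mean0 (VT _ Vg)) dqm (measurable_double_exp_centered a c)
  (fun n x => normr_double_exp_le1 a c (Z x)).
apply: (cvg_sub0_trans _ H1); rewrite -[X in _ --> X]oppr0.
by under eq_fun do rewrite -opprB; exact: cvgN.
Qed.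

(** V-efficiency speaks of V, and t psi is known to lie in its closure. It is approached by g_j = t
    v_j with v_j in V: the products are close in L2, and gamma(g_j) = <psi, g_j> tends to t s^2, on
    which the normal mean depends continuously. *)
Lemma cvg_lik_representer a c t :
  (\int[prodn P n]_x (double_exp a c (Z x) * lik (fun y => t * psi y) x)) @[n --> \oo]
  --> \int[normal_prob (t * s ^+ 2) s]_z double_exp a c z.
Proof.
have [_ VT _] := linV.
have [v_ Vv cv] := approx_representer.
have VD : submod_closed (mem V) by case: linV => -[].
pose g_ j : L2 P := t *: v_ j.
have Vg j : V (g_ j).
  by have := VD.2 t (v_ j) 0 (mem_set (Vv j)) VD.1; rewrite addr0 => /set_mem.
have psiL := L2P psi; have vL j := L2P (v_ j); have gL j := L2P (g_ j).
have gE j x : g_ j x = t * v_ j x by [].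
have psiZ2 : (fun y => t * psi y) \in Lfun P 2%:E by exact: Lfun2Z.
have psiZ0 : \int[P]_y (t * psi y) = 0.
  by rewrite RintegralZl ?psi0 ?mulr0//; exact: Lfun2_integrable.
have cg : (\int[P]_x ((t * psi x - g_ j x) ^+ 2)) @[j --> \oo] --> (0 : R).
  have E j : \int[P]_x ((t * psi x - g_ j x) ^+ 2) =
      t ^+ 2 * \int[P]_x ((psi x - v_ j x) ^+ 2).
    rewrite -RintegralZl//; last exact: integrable_Lfun2X (Lfun2B psiL (vL j)).
    by apply: eq_Rintegral => x _; rewrite gE; ring.
  by rewrite (funext E) -[X in _ --> X](mulr0 (t ^+ 2)); exact: cvgMl_tmp.
have cgam : gamma (g_ j) @[j --> \oo] --> t * s ^+ 2.
  apply: cvg_of_sub0; apply: (@cvg0_approx R _ (s ^+ 2)); first exact: sqr_ge0.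
  move=> e e0; have /cvgr0Pnorm_lt/(_ _ e0) := cg; apply: filterS => j Hj.
  rewrite gamma_representer// /dot -sqrrN opprB -psis.
  rewrite -RintegralZl//; last exact: integrable_Lfun2X.
  rewrite -RintegralB//; last 2 first.
  - exact: (integrableZl measurableT t (integrable_Lfun2X psiL)).
  - exact: integrable_Lfun2M.
  have -> : \int[P]_x (t * psi x ^+ 2 - psi x * g_ j x) =
      \int[P]_x (psi x * (t * psi x - g_ j x)).
    by apply: eq_Rintegral => x _; ring.
  apply: (le_trans (cauchy_schwarz psiL (Lfun2B psiZ2 (gL j)))).
  rewrite psis ler_wpM2l ?sqr_ge0//.
  by apply: ltW; apply: le_lt_trans Hj; exact: ler_norm.
have cm := @cvg_double_exp_mean _ _ _ s a c s0 cgam.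
set m := \int[normal_prob (t * s ^+ 2) s]_z double_exp a c z in cm *.
(* 9 = 3 times 3: three differences, each with square at most e, combined by [sqr_sum3]. *)
apply: cvg_of_sub0; apply: (@cvg0_approx R _ 9) => // e e0.
have e1 : 0 < Num.sqrt e by rewrite sqrtr_gt0.
have H1 := near_lik_sub psiZ2 gL psiZ0 (fun j => mean0 (VT _ (Vg j))) cg e0.
have H2 := (@cvgrPdist_lt _ _ _ _ _ _ _).1 cm _ e1.
have [j [Hj1 Hj2]] := filter_ex (filterI H1 (H2 _)).
have H3 := (@cvgrPdist_lt _ _ _ _ _ _ _).1 (@cvg_lik_linear (g_ j) a c (Vg j)) _ e1.
near=> n.
have A1 : \int[prodn P n]_x ((lik (fun y => t * psi y) x - lik (g_ j) x) ^+ 2) <= e.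
  by near: n; exact: Hj1.
have A2 : `|\int[normal_prob (gamma (g_ j)) s]_z double_exp a c z
    - \int[prodn P n]_x (double_exp a c (Z x) * lik (g_ j) x)| < Num.sqrt e.
  by near: n; exact: H3.
have sq x : `|x| < Num.sqrt e -> x ^+ 2 <= e.
  move=> xe; rewrite -[leRHS]sqr_sqrtr ?(ltW e0)// -[leLHS]real_normK ?num_real//.
  by rewrite lerXn2r ?nnegrE ?sqrtr_ge0// ltW.
have {}A2 := sq _ A2; have A3 := sq _ Hj2.
have l1 := Lfun2_lik n psiZ2; have l2 := Lfun2_lik n (gL j).
have FZ2 (k : n.-tuple X -> R) : k \in Lfun (prodn P n) 2%:E ->
    (prodn P n).-integrable setT (fun x => (double_exp a c (Z x) * k x)%:E).
  move=> k2; apply: Lfun2_integrable.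
  apply: (@Lfun2_bounded_mul _ _ _ _ (fun x => double_exp a c (Z x)) _ 1) => //.
    exact: measurable_double_exp_centered.
  by move=> x; exact: normr_double_exp_le1.
have A4 : (\int[prodn P n]_x (double_exp a c (Z x) * lik (fun y => t * psi y) x)
    - \int[prodn P n]_x (double_exp a c (Z x) * lik (g_ j) x)) ^+ 2 <= e.
  rewrite -RintegralB ?FZ2//.
  have -> : \int[prodn P n]_x (double_exp a c (Z x) * lik (fun y => t * psi y) x
      - double_exp a c (Z x) * lik (g_ j) x) =
      \int[prodn P n]_x (double_exp a c (Z x) *
        (lik (fun y => t * psi y) x - lik (g_ j) x)).
    by apply: eq_Rintegral => x _; ring.
  have := @sqr_Rintegral_bounded _ _ _ (prodn P n) (fun x => double_exp a c (Z x)) _ 1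
    (@measurable_double_exp_centered a c n) (fun x => normr_double_exp_le1 a c (Z x))
    (Lfun2B l1 l2).
  by rewrite expr1n mul1r => /le_trans; apply.
set u := \int[prodn P n]_x (double_exp a c (Z x) * lik (fun y => t * psi y) x) in A4 *.
set w := \int[prodn P n]_x (double_exp a c (Z x) * lik (g_ j) x) in A2 A4.
set m' := \int[normal_prob (gamma (g_ j)) s]_z double_exp a c z in A2 A3.
have -> : u - m = (u - w) + (- (m' - w)) + (- (m - m')) by ring.
by apply: (le_trans (sqr_sum3 _ _ _)); rewrite !sqrrN; lra.
Unshelve. all: by end_near. Qed.

Theorem cvg_local_law h path a c : T h -> dqm_path calP h path ->
  (\int[prodn (local_law path n) n]_x double_exp a c (Z x)) @[n --> \oo] -->
  \int[normal_prob (dot psi h) s]_z double_exp a c z.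
Proof.
move=> Th dqm.
have H1 := @cvg_local_lik _ _ _ calP P h path (fun n x => double_exp a c (Z x)) 1
  (mean0 Th) dqm (measurable_double_exp_centered a c)
  (fun n x => normr_double_exp_le1 a c (Z x)).
have H2 := @cvg_double_exp_lik _ _ _ P psi s (@centered) (L2P psi) psi0 s0 psis
  measurable_centered cvg_lik_representer a c h (L2P h) (mean0 Th).
exact: cvg_sub0_trans H1 H2.
Qed.

(** One half of contiguity. Cauchy-Schwarz bounds the square of the integral of [lik h] over A_n by
    P^n(A_n) times the second moment of [lik h], which tends to e^<h, h>. *)
Lemma local_law_contiguous h path (A : forall n, set (n.-tuple X)) : T h ->
  dqm_path calP h path -> (forall n, measurable (A n)) ->
  (fun n => prodn P n (A n)) @ \oo --> 0%E ->
  (fun n => prodn (local_law path n) n (A n)) @ \oo --> 0%E.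
Proof.
move=> Th dqm mA PA.
have mI n : measurable_fun setT (\1_(A n) : n.-tuple X -> R).
  by apply: measurable_indic; exact: mA.
have I1 n (x : n.-tuple X) : `|\1_(A n) x| <= 1 :> R by exact: normr_indic_le1.
have H1 := @cvg_local_lik _ _ _ calP P h path (fun n => \1_(A n)) 1 (mean0 Th) dqm mI I1.
have intI (mu : forall n, probability (n.-tuple X) R) n :
    (mu n (A n) = (\int[mu n]_x \1_(A n) x)%:E)%E.
  exact: (probability_Rintegral (mu n) (mA n)).
have c3 := cvg_Rintegral_likM (L2P h) (L2P h) (mean0 Th) (mean0 Th).
set N := expR _ in c3.
have PA' : (\int[prodn P n]_x \1_(A n) x) @[n --> \oo] --> (0 : R).
  have E n : prodn P n (A n) = (\int[prodn P n]_x \1_(A n) x)%:E.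
    exact: (intI (fun n => prodn P n)).
  by move: PA; rewrite (funext E) => /fine_cvg.
have H2 : (\int[prodn P n]_x (\1_(A n) x * lik h x)) @[n --> \oo] --> (0 : R).
  apply: (@cvg0_approx R _ (N + 1)); first by rewrite addr_ge0// expR_ge0.
  move=> e e0; have /cvgr0Pnorm_lt/(_ _ e0) HA := PA'.
  have N1 : N < N + 1 by rewrite ltrDl.
  have HN := @cvgr_lt _ _ _ _ _ _ c3 _ N1.
  near=> n.
  have a1 : `|\int[prodn P n]_x \1_(A n) x| < e by near: n; exact: HA.
  have a2 : \int[prodn P n]_x (lik h x * lik h x) < N + 1 by near: n; exact: HN.
  have i2 := Lfun2_bounded_prob (prodn P n) (mI n) (I1 n).
  apply: (le_trans (cauchy_schwarz i2 (Lfun2_lik n (L2P h)))).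
  rewrite mulrC ler_pM ?Rintegral_sqr_ge0//.
    by apply: ltW; move: a2; under eq_Rintegral do rewrite -expr2.
  have -> : \int[prodn P n]_x (\1_(A n) x ^+ 2) = \int[prodn P n]_x \1_(A n) x :> R.
    by apply: eq_Rintegral => x _; rewrite indicE; case: (_ \in _); rewrite ?expr1n// expr0n.
  by rewrite (le_trans (ler_norm _))// ltW.
have H3 : (\int[prodn (local_law path n) n]_x \1_(A n) x) @[n --> \oo] --> (0 : R).
  exact: cvg_sub0_trans H1 H2.
rewrite (_ : (fun n => _) = EFin \o (fun n => \int[prodn (local_law path n) n]_x \1_(A n) x)).
  by apply: cvg_EFin => //; exact: nearW.
by apply/funext => n /=; exact: (intI (fun n => prodn (local_law path n) n)).
Unshelve. all: by end_near. Qed.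

End limit_law.

(** * The standard normal distribution function *)

Section normal_distribution_function.
Context {R : realType}.
Local Notation phi := (normal_pdf (0 : R) 1).

Lemma normal_pdf01_gt0 x : 0 < phi x.
Proof.
by rewrite normal_pdf_peak ?oner_neq0// mulr_gt0 ?expR_gt0// normal_peak_gt0 ?oner_neq0.
Qed.

Lemma derive_Phi x : derivable (@Phi R) x 1 /\ derive1 (@Phi R) x = phi x.
Proof.
have xu : x < x + 1 by rewrite ltrDl.
apply: (@continuous_FTC1 R phi -oo%O x (x + 1) xu).
- by apply: integrableS (integrable_normal_pdf 0 1).
- exact: ltNyr.
- by apply: continuous_normal_pdf; exact: oner_neq0.
Qed.

Lemma is_derive_Phi x : is_derive x (1 : R) (@Phi R) (phi x).
Proof.
by have [h1 h2] := derive_Phi x; apply: DeriveDef => //; rewrite -derive1E.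
Qed.

Lemma continuous_Phi : continuous (@Phi R).
Proof.
move=> x; apply: differentiable_continuous; apply/derivable1_diffP.
exact: (derive_Phi x).1.
Qed.

Lemma ltr_Phi : {mono (@Phi R) : x y / x < y}.
Proof.
apply: leW_mono; apply: le_mono => x y xy.
apply: (@gtr0_derive1_incr _ _ x y) => //.
- by move=> z _; exact: (derive_Phi z).1.
- by move=> z _; rewrite (derive_Phi z).2 normal_pdf01_gt0.
- by apply: continuous_subspaceT; exact: continuous_Phi.
Qed.

(** [Phi] is the distribution function of the identity, viewed as a random variable under N(0, 1);
    its limits at infinity are those of a distribution function. *)
Let idTR : measurableTypeR R -> R := idfun.

#[local] HB.instance Definition _ :=
  @isMeasurableFun.Build _ _ _ _ idTR (@measurable_id _ _ setT).

Let N01 : probability (measurableTypeR R) R := normal_prob 0 1.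

Lemma cvg_Phiy : (@Phi R) x @[x --> +oo] --> (1 : R).
Proof.
exact: (fine_cvg (@cvg_cdfy1 _ _ _ _ (idTR : {RV N01 >-> R}))).
Qed.

Lemma cvg_PhiNy : (@Phi R) x @[x --> -oo] --> (0 : R).
Proof.
exact: (fine_cvg (@cvg_cdfNy0 _ _ _ _ (idTR : {RV N01 >-> R}))).
Qed.

(** The intermediate value theorem, between points supplied by the limits 0 and 1, shows that [xget]
    picks a solution and not its default. *)
Lemma Phi_zq (p : R) : 0 < p < 1 -> Phi (zq p) = p.
Proof.
move=> /andP[p0 p1]; apply: (@xgetPex _ 0 [set x | Phi x = p]).
have [a Ha] := filter_ex (@cvgr_lt _ _ _ _ _ _ cvg_PhiNy _ p0).
have [b Hb] := filter_ex (@cvgr_gt _ _ _ _ _ _ cvg_Phiy _ p1).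
have ab : a <= b by rewrite ltW// -ltr_Phi (lt_trans Ha).
have [||c _ Hc] := @IVT R (@Phi R) a b p ab.
- by apply: continuous_subspaceT; exact: continuous_Phi.
- by rewrite ge_min le_max (ltW Ha) (ltW Hb) orbT.
- by exists c.
Qed.

Lemma is_derive_PhiB (c y : R) :
  is_derive y (1 : R) (fun y => Phi (c - y)) (- phi (c - y)).
Proof.
have g : is_derive y (1 : R) (fun y => c - y) (- 1).
  by rewrite -[X in is_derive _ _ _ X]add0r; apply: is_deriveB.
have := @is_derive1_comp _ (@Phi R) (fun y => c - y) y _ _ (is_derive_Phi (c - y)) g.
by rewrite mulrN1.
Qed.

Lemma normal_pdf01N x : phi (- x) = phi x.
Proof. by rewrite !normal_pdf_peak ?oner_neq0// /normal_fun !subr0 sqrrN. Qed.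

(** Phi(y) + Phi(- y) has derivative zero by evenness of the density, and tends to 1 at infinity. *)
Lemma PhiN (x : R) : Phi (- x) = 1 - Phi x.
Proof.
pose F y : R := Phi y + Phi (0 - y).
have dF y : is_derive y (1 : R) F 0.
  have -> : 0 = phi y - phi (0 - y) by rewrite sub0r normal_pdf01N subrr.
  by apply: is_deriveD; [exact: is_derive_Phi|exact: is_derive_PhiB].
have FE y : F y = F x by exact: is_derive_0_is_cst.
have cF : F y @[y --> +oo] --> (1 + 0 : R).
  apply: cvgD; first exact: cvg_Phiy.
  under eq_fun do rewrite sub0r.
  by apply: (@cvg_comp _ _ _ -%R (@Phi R)) cvg_PhiNy; rewrite ninfty.
have : F y @[y --> +oo] --> F x by rewrite (funext FE); exact: cvg_cst.
move=> /(cvg_unique (@Rhausdorff R) cF); rewrite /F sub0r addr0 => ->; ring.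
Qed.

(** The left-hand side is even in t, so t > 0 may be assumed. Its derivative at y > 0 is phi(z + y)
    - phi(z - y), negative because (z - y)^2 < (z + y)^2. *)
Lemma Phi_interval_lt (z t : R) : 0 < z -> t != 0 ->
  Phi (z - t) - Phi (- z - t) < Phi z - Phi (- z).
Proof.
move=> z0; wlog t0 : t / 0 < t => [wl|_].
  rewrite neq_lt => /orP[t0|t0]; last by apply: wl => //; rewrite gt_eqF.
  have := wl (- t); rewrite oppr_gt0 oppr_eq0 t0 lt_eqF// => /(_ isT isT).
  have -> : z - - t = - (- z - t) by ring.
  have -> : - z - - t = - (z - t) by ring.
  by rewrite (PhiN (- z - t)) (PhiN (z - t)); lra.
pose D y : R := Phi (z - y) - Phi (- z - y).
have dD y : is_derive y (1 : R) D (- phi (z - y) - - phi (- z - y)).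
  by apply: is_deriveB; exact: is_derive_PhiB.
have -> : Phi z - Phi (- z) = D 0 by rewrite /D !subr0.
apply: (@ltr0_derive1_decr _ D 0 t) => //.
- move=> y; rewrite in_itv/= => /andP[y0 _]; rewrite derive1E derive_val.
  rewrite opprK addrC subr_lt0.
  rewrite !normal_pdf_peak ?oner_neq0// ltr_pM2l ?normal_peak_gt0 ?oner_neq0//.
  rewrite ltr_expR !subr0 !mulNr ltrN2 ltr_pM2r; first nra.
  by rewrite invr_gt0 expr1n.
- apply: continuous_subspaceT => y.
  by apply: differentiable_continuous; apply/derivable1_diffP.
Qed.

Lemma zq_gt0 (p : R) : 2^-1 < p < 1 -> 0 < zq p.
Proof.
move=> /andP[p2 p1]; have := PhiN 0; rewrite oppr0 => h.
have P0 : Phi 0 = 2^-1 :> R by lra.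
by rewrite -ltr_Phi Phi_zq ?P0// p1 andbT; lra.
Qed.

End normal_distribution_function.

(** * Coverage probabilities *)

Section probability_sandwich.
Context d (T : measurableType d) (R : realType) (Q : probability T R).
Implicit Types (f : T -> R) (A B : set T).

Let integrable_indic_cst A (k : R) : measurable A ->
  Q.-integrable setT (EFin \o (fun x => \1_A x + k)).
Proof.
move=> mA; apply: (@integrable_bounded _ _ _ _ _ (1 + `|k|)).
  by apply: measurable_funD => //; exact: measurable_indic.
by move=> x; rewrite (le_trans (ler_normD _ _))// lerD2r normr_indic_le1.
Qed.

Let Rintegral_indic_cst A B (k : R) : measurable A -> measurable B ->
  \int[Q]_x (\1_A x + (\1_B x + k)) = fine (Q A) + fine (Q B) + k.
Proof.
move=> mA mB; have iI D : measurable D -> Q.-integrable setT (EFin \o (\1_D : T -> R)).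
  move=> mD; apply: (@integrable_bounded _ _ _ _ _ 1); first exact: measurable_indic.
  exact: normr_indic_le1.
have [iA iB] := (iI _ mA, iI _ mB).
rewrite RintegralD//; last exact: integrable_indic_cst.
rewrite RintegralD//; last exact: finite_measure_integrable_cst.
by rewrite Rintegral_prob_cst !probability_Rintegral// addrA.
Qed.

(** Pointwise, f <= 1_A + 1_B + k. In the applications f is a smoothed indicator of the event A, k
    its error, and B an exceptional set: empty for the normal law, the event of an atypical
    threshold for the sample. *)
Lemma Rintegral_le_prob f A B (k : R) :
  measurable_fun setT f -> (forall x, `|f x| <= 1) ->
  measurable A -> measurable B ->
  (forall x, ~ A x -> ~ B x -> f x <= k) -> 0 <= k ->
  \int[Q]_x f x <= fine (Q A) + fine (Q B) + k.
Proof.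
move=> mf f1 mA mB H k0; rewrite -Rintegral_indic_cst//.
apply: le_Rintegral => //; first exact: integrable_bounded f1.
- apply: (@integrable_bounded _ _ _ _ _ (1 + (1 + `|k|))).
    apply: measurable_funD; first exact: measurable_indic.
    by apply: measurable_funD => //; exact: measurable_indic.
  move=> x; rewrite (le_trans (ler_normD _ _))// lerD ?normr_indic_le1//.
  by rewrite (le_trans (ler_normD _ _))// lerD ?normr_indic_le1.
- move=> x _; have := f1 x; have := ler_norm (f x).
  rewrite !indicE; have [xA|xA] := boolP (x \in A) => /=.
    by case: (x \in B) => /= *; lra.
  have [xB|xB] := boolP (x \in B) => /=; first by move=> *; lra.
  move=> _ _; rewrite !add0r; apply: H.
    by move=> Ax; move: xA; rewrite mem_set.
  by move=> Bx; move: xB; rewrite mem_set.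
Qed.

Lemma prob_le_Rintegral f A B (k : R) :
  measurable_fun setT f -> (forall x, 0 <= f x <= 1) ->
  measurable A -> measurable B ->
  (forall x, A x -> ~ B x -> 1 - k <= f x) -> 0 <= k ->
  fine (Q A) <= \int[Q]_x f x + fine (Q B) + k.
Proof.
move=> mf f01 mA mB H k0.
have f1 x : `|f x| <= 1 by have /andP[? ?] := f01 x; rewrite ger0_norm.
have g1 x : `|1 - f x| <= 1 by have /andP[? ?] := f01 x; rewrite ger0_norm; lra.
have mg : measurable_fun setT (fun x => 1 - f x) by exact: measurable_funB.
have := @Rintegral_le_prob (fun x => 1 - f x) (~` A) B k mg g1 (measurableC mA) mB.
rewrite RintegralB//; last 2 first.
- exact: finite_measure_integrable_cst.
- exact: integrable_bounded f1.
rewrite Rintegral_prob_cst probability_setC// fineB ?fin_num_measure//=.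
move=> h; suff : 1 - \int[Q]_x f x <= 1 - fine (Q A) + fine (Q B) + k by lra.
apply: h => // x /contrapT Ax nBx.
by have := H x Ax nBx; lra.
Qed.

End probability_sandwich.

Section step.
Context {R : realType}.
Implicit Types l eta b z : R.

Lemma expRNexpR_le (x : R) : expR (- expR x) <= expR (- x).
Proof. by rewrite ler_expR lerN2 (le_trans _ (expR_ge1Dx x))// lerDr. Qed.

Lemma double_exp_left l eta b z : 0 <= l -> z <= b - eta ->
  1 - expR (- (l * eta)) <= double_exp l (- (l * b)) z.
Proof.
move=> l0 zb; rewrite /double_exp.
have h : expR (l * z + - (l * b)) <= expR (- (l * eta)).
  by rewrite ler_expR; nra.
by have := expR_ge1Dx (- expR (l * z + - (l * b))); lra.
Qed.

Lemma double_exp_right l eta b z : 0 <= l -> b + eta <= z ->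
  double_exp l (- (l * b)) z <= expR (- (l * eta)).
Proof.
move=> l0 zb; rewrite /double_exp (le_trans (expRNexpR_le _))// ler_expR; nra.
Qed.

Lemma expRN_small (eta e : R) : 0 < eta -> 0 < e ->
  exists2 l, 0 < l & expR (- (l * eta)) <= e.
Proof.
(* This slope makes the exponent - 1 / e, and e^(1/e) >= 1 / e. *)
move=> eta0 e0; exists ((e * eta)^-1); first by rewrite invr_gt0 mulr_gt0.
have -> : (e * eta)^-1 * eta = e^-1 by field; rewrite !gt_eqF.
rewrite expRN -[leRHS]invrK lef_pV2 ?posrE ?expR_gt0 ?invr_gt0//.
by rewrite (le_trans _ (expR_ge1Dx _))// lerDr.
Qed.

Lemma Phi_double_exp_le m s l eta b : 0 < s -> 0 <= l ->
  \int[normal_prob m s]_x double_exp l (- (l * b)) x <=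
  Phi ((b + eta - m) / s) + expR (- (l * eta)).
Proof.
move=> s0 l0; rewrite Rintegral_normal_double_exp//.
set y := (b + eta - m) / s.
have mf : measurable_fun setT (double_exp (l * s) (l * m + - (l * b))).
  exact: measurable_double_exp.
have := @Rintegral_le_prob _ _ R (normal_prob 0 1) _ `]-oo, y]%classic set0
  (expR (- (l * eta))) mf (fun x => normr_double_exp_le1 _ _ x) _ measurable0.
rewrite measure0/= addr0; apply; [exact: measurable_itv| |exact: expR_ge0].
move=> x /negP; rewrite /= in_itv/= -ltNge ltr_pdivrMr// => yx _.
rewrite /double_exp (le_trans (expRNexpR_le _))// ler_expR; nra.
Qed.

Lemma Phi_double_exp_ge m s l eta b : 0 < s -> 0 <= l ->
  Phi ((b - eta - m) / s) <=
  \int[normal_prob m s]_x double_exp l (- (l * b)) x + expR (- (l * eta)).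
Proof.
move=> s0 l0; rewrite Rintegral_normal_double_exp//.
set y := (b - eta - m) / s.
have mf : measurable_fun setT (double_exp (l * s) (l * m + - (l * b))).
  exact: measurable_double_exp.
have f01 x : 0 <= double_exp (l * s) (l * m + - (l * b)) x <= 1.
  by rewrite double_exp_ge0 double_exp_le1.
have := @prob_le_Rintegral _ _ R (normal_prob 0 1) _ `]-oo, y]%classic set0
  (expR (- (l * eta))) mf f01 _ measurable0.
rewrite measure0/= addr0; apply; [exact: measurable_itv| |exact: expR_ge0].
move=> x; rewrite /= in_itv/= ler_pdivlMr// => yx _.
have := @double_exp_left l eta b (s * x + m) l0.
rewrite double_exp_affine; apply; lra.
Qed.

End step.

Lemma measurable_set_le d (T : measurableType d) (R : realType) (f g : T -> R) :
  measurable_fun setT f -> measurable_fun setT g -> measurable [set x | f x <= g x].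
Proof.
move=> mf mg; have := @measurable_lee _ _ _ _ measurableT (EFin \o f) (EFin \o g).
by rewrite setTI; apply; exact/measurable_EFinP.
Qed.

Section slutsky.
Context d (X : measurableType d) (R : realType).
Variables (Q : forall n, probability (n.-tuple X) R) (m s : R).
Variables (Z B : forall n, n.-tuple X -> R) (b : R) (A : forall n, set (n.-tuple X)).
Hypotheses (s0 : 0 < s) (mZ : forall n, measurable_fun setT (@Z n)).
Hypothesis mB : forall n, measurable_fun setT (@B n).
Hypothesis cvgZ : forall a c, \int[Q n]_x double_exp a c (Z x) @[n --> \oo] -->
  \int[normal_prob m s]_x double_exp a c x.
Hypothesis cvgB : cvg_in_prob Q B b.
Hypothesis mA : forall n, measurable (@A n).
Hypothesis ltA : forall n (x : n.-tuple X), Z x < B x -> A x.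
Hypothesis leA : forall n (x : n.-tuple X), A x -> Z x <= B x.

Let far (eta : R) n := [set x : n.-tuple X | eta <= `|B x - b|].

Let mfar eta n : measurable (@far eta n).
Proof.
have mBb : measurable_fun setT (fun x : n.-tuple X => B x - b).
  by apply: measurable_funB; [exact: mB|exact: measurable_cst].
apply: (@measurable_set_le _ _ _ (fun=> eta) (fun x : n.-tuple X => `|B x - b|)).
  exact: measurable_cst.
exact: (@measurableT_comp _ _ _ _ _ _ (@Num.norm R R) _ _ (@normr_measurable _ _) mBb).
Qed.

Let mdZ l c n : measurable_fun setT (fun x : n.-tuple X => double_exp l c (Z x)).
Proof.
apply: (@measurableT_comp _ _ _ _ _ _ (double_exp l c) _ (@Z n)).
  exact: measurable_double_exp.
exact: mZ.
Qed.

(** The event A is only caught between Z < B and Z <= B, so one statement serves strict and weak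
    inequalities. Smoothed steps at b + 2 eta and b - 2 eta bound it: one eta covers the fluctuation
    of B around b, the other the transition of the step. *)
Lemma slutsky_prob : (fun n => Q n (@A n)) @ \oo --> (Phi ((b - m) / s))%:E.
Proof.
have QE n : Q n (@A n) = (fine (Q n (@A n)))%:E by rewrite fineK//; apply: fin_num_measure; exact: mA.
rewrite (funext QE); apply: cvg_EFin; first exact: nearW.
(* Five errors: convergence of the integral, the event where B is far from b, the error of the step
   once under the sample law and once under the normal law, and the variation of [Phi]. *)
apply/cvgrPdist_lt => e5 e50; pose e := e5 / 5.
have e0 : 0 < e by rewrite divr_gt0.
have [r r0 Hr] : exists2 r, 0 < r & forall y, `|y - (b - m) / s| < r ->
    `|Phi y - Phi ((b - m) / s)| < e.
  have := (@cvgrPdist_lt _ _ _ _ _ _ _).1 (@continuous_Phi R ((b - m) / s)) _ e0.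
  move=> /(_ _)/nbhs_ballP[r /= r0 Hr]; exists r => // y yr.
  by rewrite distrC; apply: Hr; rewrite /ball/= distrC.
(* [Phi] is eventually read at b + 3 eta and b - 3 eta, the third eta coming from the transition of
   the step under the normal law; 3 eta < r s keeps both within the continuity radius. *)
pose eta := r * s / 4.
have eta0 : 0 < eta by rewrite divr_gt0// mulr_gt0.
have arl (u v : R) : u <= v -> v < b + eta -> u <= b + 2 * eta - eta by lra.
have arr (u v : R) : b - eta < v -> v <= u -> b - 2 * eta + eta <= u by lra.
have [l l0 le] := expRN_small eta0 e0.
have HrS u : `|u| < r * s -> `|Phi ((b + u - m) / s) - Phi ((b - m) / s)| < e.
  move=> ur; apply: Hr.
  have -> : (b + u - m) / s - (b - m) / s = u / s by field; rewrite gt_eqF.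
  by rewrite normrM (gtr0_norm (_ : 0 < s^-1)) ?invr_gt0// ltr_pdivrMr.
have rs0 : 0 < r * s by rewrite mulr_gt0.
have c3 : `|3 * eta| < r * s by rewrite gtr0_norm ?mulr_gt0// /eta; lra.
have := HrS _ c3; have := HrS (- (3 * eta)).
rewrite normrN => /(_ c3) Plo Phi'.
have up := @Phi_double_exp_le _ m s l eta (b + 2 * eta) s0 (ltW l0).
have lo := @Phi_double_exp_ge _ m s l eta (b - 2 * eta) s0 (ltW l0).
have Eup : b + 2 * eta + eta - m = b + 3 * eta - m by ring.
have Elo : b - 2 * eta - eta - m = b - 3 * eta - m by ring.
rewrite {}Eup in up; rewrite {}Elo in lo.
have cvgl (c : R) : \forall n \near \oo,
    `|\int[normal_prob m s]_x double_exp l (- (l * c)) x -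
      \int[Q n]_x double_exp l (- (l * c)) (Z x)| < e.
  exact: ((@cvgrPdist_lt _ _ _ _ _ _ _).1 (@cvgZ l (- (l * c))) _ e0).
have H3 : \forall n \near \oo, fine (Q n (@far eta n)) < e.
  by have /fine_cvg/cvgr_lt := cvgB eta0; apply.
apply: filterS3 (cvgl (b + 2 * eta)) (cvgl (b - 2 * eta)) H3 => n h1 h2 h3.
have k0 : 0 <= expR (- (l * eta)) by exact: expR_ge0.
have nfar (x : n.-tuple X) : ~ far eta x -> b - eta < B x < b + eta.
  by move=> /negP; rewrite -ltNge ltr_distl.
have qup : fine (Q n (@A n)) <=
    \int[Q n]_x double_exp l (- (l * (b + 2 * eta))) (Z x) +
    fine (Q n (@far eta n)) + expR (- (l * eta)).
  apply: (@prob_le_Rintegral _ _ _ (Q n)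
    (fun x : n.-tuple X => double_exp l (- (l * (b + 2 * eta))) (Z x))
    (@A n) (@far eta n) _ _ _ (@mA n) (@mfar eta n) _ k0); first exact: mdZ.
    by move=> x; rewrite double_exp_ge0 double_exp_le1.
  move=> x Ax /nfar/andP[_ Bx]; apply: (double_exp_left (ltW l0)).
  exact: arl (leA Ax) Bx.
have qlo : \int[Q n]_x double_exp l (- (l * (b - 2 * eta))) (Z x) <=
    fine (Q n (@A n)) + fine (Q n (@far eta n)) + expR (- (l * eta)).
  apply: (@Rintegral_le_prob _ _ _ (Q n)
    (fun x : n.-tuple X => double_exp l (- (l * (b - 2 * eta))) (Z x))
    (@A n) (@far eta n) _ _ _ (@mA n) (@mfar eta n) _ k0); first exact: mdZ.
    by move=> x; exact: normr_double_exp_le1.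
  move=> x nAx /nfar/andP[Bx _]; apply: (double_exp_right (ltW l0)).
  by apply: (arr _ _ Bx); rewrite leNgt; apply/negP => /ltA.
change (`|Phi ((b - m) / s) - fine (Q n (@A n))| < e5).
move: h1 h2 h3 le up lo Plo Phi' qup qlo.
move: (\int[_]_x _) (\int[_]_x _) (\int[_]_x _) (\int[_]_x _) => i1 i2 i3 i4.
move: (Phi _) (Phi _) (Phi _) (expR _) (fine _) (fine _) => p1 p2 p3 k q1 q2.
rewrite !ltr_norml /e; clear => /andP[? ?] /andP[? ?] ? ? ? ? /andP[? ?] /andP[? ?] ? ?.
by apply/andP; split; lra.
Qed.

End slutsky.

Section coverage.
Context d (X : measurableType d) (R : realType).
Variables (calP : set (probability X R)) (P : probability X R).
Variables (T V : set (L2 P)) (Psi : probability X R -> R) (gamma : L2 P -> R).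
Variables (psi : L2 P) (Tn shat : forall n, {mfun n.-tuple X >-> R}) (s : R).
Hypotheses (T0 : T `<=` mean_zero P) (Tassum : assumption1 calP T).
Hypothesis diffPsi : dir_pathwise_differentiable calP T Psi gamma.
Hypothesis linV : linearity_subspace T gamma V.
Hypothesis rieszV : riesz_representer V gamma psi.
Hypothesis effV : V_efficient calP V psi Psi Tn.
Hypotheses (s0 : 0 < s) (spsi : s ^+ 2 = L2norm psi ^+ 2).
Hypothesis cvg_shat : cvg_in_prob (prodn P) shat s.
Variables (h : L2 P) (path : R -> probability X R).
Hypotheses (Th : T h) (dqm : dqm_path calP h path).

Local Notation Q n := (prodn (local_law path n) n).
Local Notation Z := (centered P Psi Tn).

(* [Z x] is compared with this random bound, since [Psi (local_law path n)]
   is compared with [Tn n x] up to a multiple of [shat n x / sqrt n] *)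
Definition critical (c : R) n (x : n.-tuple X) : R :=
  c * shat n x + Num.sqrt n%:R * (Psi (local_law path n) - Psi P).

Let measurable_critical c n : measurable_fun setT (@critical c n).
Proof.
apply: measurable_funD; last exact: measurable_cst.
by apply: measurable_funM; first exact: measurable_cst.
Qed.

Let measurable_le_critical c n : measurable [set x : n.-tuple X | Z x <= critical c x].
Proof.
apply: measurable_set_le; first exact: measurable_centered.
exact: measurable_critical.
Qed.

Let measurable_lt_critical c n : measurable [set x : n.-tuple X | Z x < critical c x].
Proof.
rewrite (_ : [set _ | _] = ~` [set x | critical c x <= Z x]).
  apply: measurableC; apply: measurable_set_le; last exact: measurable_centered.
  exact: measurable_critical.
by apply/seteqP; split=> x /=; rewrite ltNge => /negP.
Qed.

Lemma cvg_critical c : cvg_in_prob (fun n => Q n) (@critical c) (c * s + gamma h).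
Proof.
(* Half of e is for the drift, half for c (shat - s); adding 1 avoids division by zero when c =
   0. *)
move=> e e0; pose e' := e / 2 / (`|c| + 1).
have e2 : 0 < e / 2 by rewrite divr_gt0.
have e'0 : 0 < e' by rewrite divr_gt0.
pose far n := [set x : n.-tuple X | e' <= `|shat n x - s|].
have mabs n (f : n.-tuple X -> R) (r : R) : measurable_fun setT f ->
    measurable_fun setT (fun x => `|f x - r|).
  move=> mf; have mfr : measurable_fun setT (fun x => f x - r).
    by apply: measurable_funB => //; exact: measurable_cst.
  exact: (@measurableT_comp _ _ _ _ _ _ (@Num.norm R R) _ _ (@normr_measurable _ _) mfr).
have mfar n : measurable (far n).
  apply: (@measurable_set_le _ _ _ (fun=> e') (fun x : n.-tuple X => `|shat n x - s|)).
    exact: measurable_cst.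
  exact: mabs.
have mcrit n : measurable [set x : n.-tuple X | e <= `|critical c x - (c * s + gamma h)|].
  apply: (@measurable_set_le _ _ _ (fun=> e)
    (fun x : n.-tuple X => `|critical c x - (c * s + gamma h)|)).
    exact: measurable_cst.
  by apply: mabs; exact: measurable_critical.
have Qfar := local_law_contiguous T0 Th dqm mfar (cvg_shat e'0).
have drift := (@cvgrPdist_lt _ _ _ _ _ _ _).1 (cvg_Psi_drift diffPsi Th dqm) _ e2.
apply: (squeeze_cvge _ (cvg_cst 0%E) Qfar).
apply: filterS (drift _) => n {}drift; apply/andP; split; first exact: measure_ge0.
apply: le_measure; rewrite ?inE; [exact: mcrit|exact: mfar|].
move=> x /= ex; rewrite /far/= leNgt; apply/negP => shx.
move: ex; rewrite leNgt => /negP; apply.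
rewrite /critical.
set r := Num.sqrt n%:R * (Psi (local_law path n) - Psi P) in drift *.
have -> : c * shat n x + r - (c * s + gamma h) =
  c * (shat n x - s) - (gamma h - r) by ring.
rewrite (le_lt_trans (ler_normB _ _))// normrM [ltRHS]splitr ler_ltD//.
rewrite (@le_trans _ _ (`|c| * e'))//; first by rewrite ler_wpM2l// ltW.
by rewrite /e' mulrA ler_pdivrMr// mulrC ler_pM2l// lerDl.
Qed.

Let limit_value c :
  (c * s + gamma h - dot psi h) / s = c - (dot psi h - gamma h) / s.
Proof. by field; rewrite gt_eqF. Qed.

Lemma cvg_prob_le_critical c :
  (fun n => Q n [set x : n.-tuple X | Z x <= critical c x]) @ \oo -->
  (Phi (c - (dot psi h - gamma h) / s))%:E.
Proof.
rewrite -limit_value.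
apply: (@slutsky_prob _ _ _ (fun n => Q n) _ _ (fun n => @centered _ _ _ P Psi Tn n)
  (@critical c)) => //.
- by move=> n; exact: measurable_centered.
- by move=> a b; exact: (cvg_local_law T0 Tassum diffPsi linV rieszV effV s0 spsi Th dqm).
- exact: cvg_critical.
- by move=> n x /= /ltW.
Qed.

Lemma cvg_prob_lt_critical c :
  (fun n => Q n [set x : n.-tuple X | Z x < critical c x]) @ \oo -->
  (Phi (c - (dot psi h - gamma h) / s))%:E.
Proof.
rewrite -limit_value.
apply: (@slutsky_prob _ _ _ (fun n => Q n) _ _ (fun n => @centered _ _ _ P Psi Tn n)
  (@critical c)) => //.
- by move=> n; exact: measurable_centered.
- by move=> a b; exact: (cvg_local_law T0 Tassum diffPsi linV rieszV effV s0 spsi Th dqm).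
- exact: cvg_critical.
- by move=> n x /= /ltW.
Qed.

Lemma ge_lower_bound c n (x : n.-tuple X) : (0 < n)%N ->
  (Tn n x - c * (shat n x / Num.sqrt n%:R) <= Psi (local_law path n)) =
  (Z x <= critical c x).
Proof.
move=> n0; have r0 : 0 < Num.sqrt n%:R :> R by rewrite sqrtr_gt0 ltr0n.
rewrite /centered /critical -(ler_pM2l r0) -subr_ge0 -[RHS]subr_ge0; congr (0 <= _).
by field; rewrite gt_eqF.
Qed.

Lemma le_upper_bound c n (x : n.-tuple X) : (0 < n)%N ->
  (Psi (local_law path n) <= Tn n x + c * (shat n x / Num.sqrt n%:R)) =
  (critical (- c) x <= Z x).
Proof.
move=> n0; have r0 : 0 < Num.sqrt n%:R :> R by rewrite sqrtr_gt0 ltr0n.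
rewrite /centered /critical -(ler_pM2l r0) -subr_ge0 -[RHS]subr_ge0; congr (0 <= _).
by field; rewrite gt_eqF.
Qed.

Lemma cvg_lower_coverage c :
  (fun n => Q n [set x | Tn n x - c * (shat n x / Num.sqrt n%:R)
                         <= Psi (local_law path n)]) @ \oo
  --> (Phi (c - (dot psi h - gamma h) / s))%:E.
Proof.
apply: cvg_trans (cvg_prob_le_critical (c := c)); apply: near_eq_cvg.
near=> n; congr (Q n _); apply/seteqP; split=> x /=; rewrite ge_lower_bound//;
  by near: n; exact: nbhs_infty_gt.
Unshelve. all: by end_near. Qed.

(** The event is the difference of Z <= critical c and Z < critical (- c); strictness of the second
    comes from the closed upper endpoint. Nonnegativity of c and of [shat] nests the two events, so
    that their probabilities subtract. *)
Lemma cvg_interval_coverage c : 0 <= c -> (forall n x, 0 <= shat n x) ->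
  (fun n => Q n [set x | Psi (local_law path n) \in
      `[Tn n x - c * (shat n x / Num.sqrt n%:R),
        Tn n x + c * (shat n x / Num.sqrt n%:R)]]) @ \oo
  --> (Phi (c - (dot psi h - gamma h) / s) - Phi (- c - (dot psi h - gamma h) / s))%:E.
Proof.
move=> c0 shat0; rewrite EFinB.
have H := @cvgeB _ _ _ _ _ _ _ _ _ (cvg_prob_le_critical (c := c))
  (cvg_prob_lt_critical (c := - c)).
apply: cvg_trans (H _ _) => //; apply: near_eq_cvg; near=> n.
have n0 : (0 < n)%N by near: n; exact: nbhs_infty_gt.
pose A := [set x : n.-tuple X | Z x <= critical c x].
pose A' := [set x : n.-tuple X | Z x < critical (- c) x].
have A'A : A `&` A' = A'.
  apply/setIidPr => x /= /ltW/le_trans; apply.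
  by rewrite lerD2r ler_wpM2r// ge0_cp.
have mA : measurable A by exact: measurable_le_critical.
have mA' : measurable A' by exact: measurable_lt_critical.
have -> : [set x : n.-tuple X | Psi (local_law path n) \in
    `[Tn n x - c * (shat n x / Num.sqrt n%:R),
      Tn n x + c * (shat n x / Num.sqrt n%:R)]] = A `\` A'.
  apply/seteqP; split=> x /=; rewrite in_itv/= ge_lower_bound// le_upper_bound//.
    by move=> /andP[h1 h2]; split=> //; apply/negP; rewrite -leNgt.
  by move=> [h1 /negP]; rewrite -leNgt => h2; apply/andP.
rewrite measureD// ?A'A//.
by rewrite (le_lt_trans (probability_le1 _ _))// ltry.
Unshelve. all: by end_near. Qed.

End coverage.

Theorem corollary7 (R : realType) (d : measure_display) (X : measurableType d)
    (calP : set (probability X R)) (P : probability X R)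
    (T V : set (L2 P)) (Psi : probability X R -> R) (gamma : L2 P -> R)
    (psi : L2 P) (Tn shat : forall n, {mfun n.-tuple X >-> R}) (s alpha : R) :
  calP P ->
  linear_subspace T -> T `<=` mean_zero P ->
  assumption1 calP T ->
  dir_pathwise_differentiable calP T Psi gamma ->
  linearity_subspace T gamma V ->
  riesz_representer V gamma psi ->
  V_efficient calP V psi Psi Tn ->
  0 < s -> s ^+ 2 = L2norm psi ^+ 2 ->
  (forall n x, 0 <= shat n x) ->
  cvg_in_prob (prodn P) shat s ->
  0 < alpha < 1 ->
  let delta h := dot psi h - gamma h in
  let z := zq (1 - alpha / 2) in
  let I n x : interval R := `[Tn n x - z * (shat n x / Num.sqrt n%:R),
                              Tn n x + z * (shat n x / Num.sqrt n%:R)] in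
  let lower n x := Tn n x - zq (1 - alpha) * (shat n x / Num.sqrt n%:R) in
  let limit h := Phi (z - delta h / s) - Phi (- z - delta h / s) in
  [/\ forall h path, T h -> dqm_path calP h path ->
        (fun n => prodn (local_law path n) n
                    [set x | Psi (local_law path n) \in I n x]) @ \oo
          --> (limit h)%:E,
      forall h, T h -> delta h = 0 -> limit h = 1 - alpha,
      forall h, V h -> delta h = 0 /\ limit h = 1 - alpha,
      forall h, T h -> delta h != 0 -> limit h < 1 - alpha
    & forall h path, T h -> dqm_path calP h path -> delta h <= 0 ->
        (fun n => prodn (local_law path n) n
                    [set x | lower n x <= Psi (local_law path n)]) @ \oo
          --> (Phi (zq (1 - alpha) - delta h / s))%:E
        /\ 1 - alpha <= Phi (zq (1 - alpha) - delta h / s)].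
Proof.
move=> _ _ T0 Tassum diffPsi linV rieszV effV s0 spsi shat0 cvg_shat /andP[a0 a1].
move=> delta z I lower limit.
have s1 : s != 0 by rewrite gt_eqF.
(* Exceeding 1/2 makes the quantile positive, which orders the endpoints of the interval and makes
   the loss of coverage strict when [delta] is nonzero. *)
have p1 : 2^-1 < 1 - alpha / 2 < 1 by apply/andP; split; lra.
have z0 : 0 < z by exact: zq_gt0.
have Phiz : Phi z = 1 - alpha / 2.
  by apply: Phi_zq; move: p1 => /andP[? ->]; rewrite andbT; lra.
have level : Phi z - Phi (- z) = 1 - alpha by rewrite PhiN Phiz; lra.
have Phil : Phi (zq (1 - alpha)) = 1 - alpha by apply: Phi_zq; apply/andP; split; lra.
have limit0 h : delta h = 0 -> limit h = 1 - alpha.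
  by move=> dh; rewrite /limit dh mul0r !subr0.
split.
- move=> h path Th dqm.
  exact: (cvg_interval_coverage T0 Tassum diffPsi linV rieszV effV s0 spsi
    cvg_shat Th dqm (ltW z0) shat0).
- by move=> h _; exact: limit0.
- move=> h Vh; have dh : delta h = 0.
    by rewrite /delta (gamma_representer rieszV Vh) subrr.
  by split; last exact: limit0.
- move=> h _ dh; rewrite -level; apply: Phi_interval_lt => //.
  by rewrite mulf_neq0// invr_neq0.
- move=> h path Th dqm dh; split.
    exact: (cvg_lower_coverage T0 Tassum diffPsi linV rieszV effV s0 spsi
      cvg_shat Th dqm).
  rewrite -[leLHS]Phil leNgt ltr_Phi -leNgt lerBrDl gerDr.
  by rewrite pmulr_lle0// invr_gt0.
Qed.
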